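(* On the algebra $\mathrm{JS}^\infty=\mathbb C[\wp,\partial_z\wp,\mathrm e_4,\mathrm E_1,\mathrm e_2]$ of singular quasi-Jacobi forms of index zero, consider for $n\ge0$ the transvectants $$\{f,g\}_n=\sum_{r=0}^n(-1)^r\binom nr\,\partial_\tau^{n-r}\partial_z^{r}(f)\;\partial_\tau^{r}\partial_z^{n-r}(g)\qquad(f,g\in\mathrm{JS}^\infty).$$ The sequence $\left(\frac1{n!}\{\cdot,\cdot\}_n\right)_{n\ge0}$ (by restriction) is a formal deformation of the algebra $\mathrm{JS}^{\infty,0}=\mathbb C[\wp,\partial_z\wp,\mathrm e_4,\mathrm e_2]$ of quasi-Jacobi forms of quasimodular type.
   Context: $\mathcal H$ is the upper half-plane. All functions are functions of $(\tau,z)\in\mathcal H\times\mathbb C$, possibly with poles in $z$ at $\mathbb Z\oplus\tau\mathbb Z$; functions of $\tau$ alone are viewed as functions of $(\tau,z)$. $\partial_z=\partial/\partial z$ and $\partial_\tau=\frac{\pi}{2i}\frac{\partial}{\partial\tau}$. $\wp(\tau,z)=\frac1{z^2}+\sum_{w\in(\mathbb Z\oplus\tau\mathbb Z)\setminus\{0\}}\left(\frac1{(z-w)^2}-\frac1{w^2}\right)$; $\mathrm e_4(\tau)=\sum_{w\in(\mathbb Z\oplus\tau\mathbb Z)\setminus\{0\}}w^{-4}$; $\mathrm e_2(\tau)=\frac{\pi^2}3\left(1-24\sum_{n\ge1}\sigma_1(n)e^{2i\pi n\tau}\right)$ with $\sigma_1(n)=\sum_{d\mid n}d$; $\mathrm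 E_1(\tau,z)=\lim_{N\to\infty}\sum_{n=-N}^N\left(\lim_{M\to\infty}\sum_{m=-M}^M\frac1{z+m+n\tau}\right)$. $\mathrm{JS}^\infty$ is stable under $\partial_\tau$ and $\partial_z$. A formal deformation of a commutative $\mathbb C$-algebra $A$ is a sequence $(\mu_n)_{n\ge0}$ of bilinear maps $A\times A\to A$ with $\mu_0$ the product of $A$ and such that the $\mathbb C[[\hbar]]$-bilinear extension to $A[[\hbar]]$ of $f\star g=\sum_{n\ge0}\mu_n(f,g)\hbar^n$ is associative. In particular the claim includes that $\{f,g\}_n\in\mathrm{JS}^{\infty,0}$ for $f,g\in\mathrm{JS}^{\infty,0}$. *)

(* Defs.v *)
From HB Require Import structures.
From mathcomp Require Import all_boot all_order all_algebra.
From mathcomp Require Import sesquilinear complex.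
From mathcomp Require Import all_classical all_reals all_analysis.
From mathcomp Require summability.

Set Implicit Arguments.
Unset Strict Implicit.
Unset Printing Implicit Defensive.

Import Order.TTheory GRing.Theory Num.Theory.
Import numFieldNormedType.Exports.

Local Open Scope classical_set_scope.
Local Open Scope complex_scope.
Local Open Scope ring_scope.

(* R[i] is given the topology and the normed module structure (over itself)
   that the library puts on every numFieldType, so that derive1 is the complex
   derivative. *)
HB.instance Definition _ (R : rcfType) := GRing.ComAlgebra.copy R[i] R[i]^o.
HB.instance Definition _ (R : rcfType) := Vector.copy R[i] R[i]^o.
HB.instance Definition _ (R : rcfType) := NormedModule.copy R[i] R[i]^o.

Section GeneratedSubalgebra.
Context {K : comNzRingType} {A : comAlgType K}.
Implicit Types X : set A.

Definition gen_subalg X : set A :=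
  smallest (fun S : set A => GRing.subalg_closed [in S]) X.

Lemma gen_subalg_closed X : GRing.subalg_closed [in gen_subalg X].
Proof.
split=> [|a f g|f g].
- by apply/mem_set => S [[S1 _ _] _]; exact/set_mem.
- move=> /set_mem fX /set_mem gX; apply/mem_set => S SX; apply/set_mem.
  by case: (SX) => -[_ SZ _] _; apply: SZ; apply/mem_set; [exact: fX|exact: gX].
- move=> /set_mem fX /set_mem gX; apply/mem_set => S SX; apply/set_mem.
  by case: (SX) => -[_ _ SM] _; apply: SM; apply/mem_set; [exact: fX|exact: gX].
Qed.

Lemma gen_subalgS X Y : X `<=` Y -> gen_subalg X `<=` gen_subalg Y.
Proof. by apply: sub_smallest2r; exact: gen_subalg_closed. Qed.

Definition in_gen_subalg X : {pred A} := [in gen_subalg X].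

HB.instance Definition _ X :=
  GRing.isSubalgClosed.Build K A (in_gen_subalg X) (gen_subalg_closed X).

Definition subalg X : Type := {f : A | in_gen_subalg X f}.

HB.instance Definition _ X := [isSub of subalg X for @sval _ _].
HB.instance Definition _ X := [Choice of subalg X by <:].
HB.instance Definition _ X := [SubChoice_isSubComNzRing of subalg X by <:].
HB.instance Definition _ X := [SubZmodule_isSubLmodule of subalg X by <:].
HB.instance Definition _ X :=
  [SubNzRing_SubLmodule_isSubLalgebra of subalg X by <:].
HB.instance Definition _ X := [SubLalgebra_isSubAlgebra of subalg X by <:].

Definition subalg_incl X Y (XY : X `<=` Y) (f : subalg X) : subalg Y :=
  exist (in_gen_subalg Y) (val f)
    (mem_set (gen_subalgS XY (set_mem (valP f)))).

End GeneratedSubalgebra.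

Section FormalDeformation.
Context {K : comNzRingType} {A : comAlgType K}.

(* A formal power series in A[[hbar]] is the sequence of its coefficients. *)
Definition star (mu : nat -> A -> A -> A) (F G : nat -> A) : nat -> A :=
  fun n => \sum_(k < n.+1) \sum_(i < (n - k).+1) mu k (F i) (G (n - k - i)%N).

Definition formal_deformation (mu : nat -> A -> A -> A) : Prop :=
  [/\ forall n, bilinear_for *:%R *:%R (mu n),
      forall f g, mu 0%N f g = f * g
    & forall F G H : nat -> A,
        star mu F (star mu G H) = star mu (star mu F G) H].

End FormalDeformation.

Section SingularQuasiJacobiForms.
Context {R : realType}.
Local Notation C := R[i].

Definition upper_half_plane : set C := [set tau | 0 < complex.Im tau].

Definition lattice (tau : C) : set C :=
  [set w | exists m n : int, w = m%:~R + n%:~R * tau].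

Definition off_lattice : set (C * C) :=
  [set p | upper_half_plane p.1 /\ ~ lattice p.1 p.2].

Definition cexp (z : C) : C :=
  (expR (complex.Re z))%:C * (cos (complex.Im z) +i* sin (complex.Im z)).

(* unordered summation over the nonzero lattice points: limit of the partial
   sums along the finite subsets, ordered by inclusion *)
Definition lattice_sum (tau : C) (F : C -> C) : C :=
  summability.sum (fun w : set_type (lattice tau `\ 0) => F (val w)).

Definition symmetric_sum (F : int -> C) (N : nat) : C :=
  \sum_(k < (N.*2).+1) F (k%:Z - N%:Z).

Definition wp (tau z : C) : C :=
  (z ^+ 2)^-1 + lattice_sum tau (fun w => ((z - w) ^+ 2)^-1 - (w ^+ 2)^-1).

Definition e4 (tau : C) : C := lattice_sum tau (fun w => (w ^+ 4)^-1).

Definition sigma1 (n : nat) : nat := (\sum_(d <- divisors n) d)%N.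

Definition e2 (tau : C) : C :=
  (pi ^+ 2 / 3)%:C *
  (1 - 24 * \big[+%R/0]_(1 <= n <oo)
              ((sigma1 n)%:R * cexp (2 * 'i * pi%:C * n%:R * tau))).

Definition E1 (tau z : C) : C :=
  limn (symmetric_sum (fun n =>
    limn (symmetric_sum (fun m => (z + m%:~R + n%:~R * tau)^-1)))).

(* The functions under consideration may have poles on the lattice, so they are
   taken on the set of pairs (tau, z) with z off the lattice of tau; functions
   of tau alone are viewed as functions on this set. *)
Definition domain : Type := {p : C * C | p \in off_lattice}.

Lemma off_lattice_i_half : ('i, (2^-1)%:C) \in off_lattice.
Proof.
apply/mem_set; split => /=; first by rewrite /upper_half_plane/= ltr01.
move=> [m [n /(congr1 (@complex.Re R))]].
have -> : m%:~R + n%:~R * 'i = m%:~R +i* n%:~R :> C.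
  by rewrite -!(rmorph_int (real_complex R)); simpc.
move=> /= m2; have : (m * 2)%:~R = 1%:~R :> R.
  by rewrite intrM -m2 mulVf// pnatr_eq0.
move/intr_inj => h; have : odd `|(m * 2)%R|%N by rewrite h.
by rewrite abszM oddM andbF.
Qed.

HB.instance Definition _ := [isSub of domain for @sval _ _].
HB.instance Definition _ := [Choice of domain by <:].
HB.instance Definition _ :=
  isPointed.Build domain
    (exist (fun p => p \in off_lattice) _ off_lattice_i_half).

Definition dfun : Type := domain -> C.

HB.instance Definition _ := GRing.ComNzRing.on dfun.
HB.instance Definition _ := GRing.Lmodule.on dfun.

Lemma dfun_scalerAl (a : C) (f g : dfun) : a *: (f * g) = (a *: f) * g.
Proof. by apply/funext => p; exact: scalerAl. Qed.

HB.instance Definition _ :=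
  GRing.Lmodule_isLalgebra.Build C dfun dfun_scalerAl.
HB.instance Definition _ := GRing.Lalgebra_isComAlgebra.Build C dfun.

Definition restr (f : C -> C -> C) : dfun := fun p => f (val p).1 (val p).2.

(* extension by 0 off the domain; as the domain is open, this convention does
   not affect the partial derivatives at points of the domain *)
Definition ext0 (f : dfun) (tau z : C) : C := oapp f 0 (insub (tau, z)).

Definition dz (f : dfun) : dfun :=
  restr (fun tau z => derive1 (ext0 f tau) z).

Definition dtau (f : dfun) : dfun :=
  (pi%:C / (2 * 'i)) *: restr (fun tau z => derive1 (fun t => ext0 f t z) tau).

Definition wpf : dfun := restr wp.
Definition e4f : dfun := restr (fun tau _ => e4 tau).
Definition e2f : dfun := restr (fun tau _ => e2 tau).
Definition E1f : dfun := restr E1.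

Definition quasimodular_gens : set dfun :=
  [set wpf; dz wpf; e4f; e2f].

Definition singular_gens : set dfun :=
  [set wpf; dz wpf; e4f; E1f; e2f].

Lemma quasimodular_gensS : quasimodular_gens `<=` singular_gens.
Proof.
by move=> f [[[|]|]|] ->; rewrite /singular_gens /=; tauto.
Qed.

Definition JS0_incl (f : subalg quasimodular_gens) : subalg singular_gens :=
  subalg_incl quasimodular_gensS f.

Definition transvectant (n : nat) (f g : dfun) : dfun :=
  \sum_(r < n.+1) ((-1) ^+ r * 'C(n, r)%:R : C) *:
    (iter (n - r) dtau (iter r dz f) * iter r dtau (iter (n - r) dz g)).

End SingularQuasiJacobiForms.

(* JS R is C[wp, dz wp, e4, E1, e2]; JS0 R is C[wp, dz wp, e4, e2]. *)
Notation JS R := (subalg (@singular_gens R)).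
Notation JS0 R := (subalg (@quasimodular_gens R)).

(* Main.v *)
(* With T = dtau and Z = dz, n! mu_n is the n-th power of the bidifferential
   operator T (x) Z - Z (x) T followed by the product; as T and Z are commuting
   derivations, this is a Moyal product, and associativity is the Leibniz rule.

   The stability of JS under T and Z comes from writing its generators as row
   sums: with c(x) = pi cot(pi x) and s(x) = pi^2 / sin(pi x)^2,
     wp + e2 = sum_n s(z + n tau),  E1 = sum_n (c(z + n tau) + i pi sgn n),
   and from multiplying these series by means of the addition law
   c(a - b) (c(b) - c(a)) = c(a) c(b) + pi^2, which yields the differential
   equation of wp, the heat equations and Ramanujan's formula for e2'.

   The stability of JS0 under the transvectants comes from the translation
   sigma : z |-> z + tau.  It fixes wp, dz wp, e4, e2 and maps E1 to
   E1 - 2 pi i, so that JS0 is the subalgebra of the sigma-invariants of JS;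
   moreover sigma Z = Z sigma and sigma T = (T - kap Z) sigma, and
   T (x) Z - Z (x) T does not change when a multiple of Z is added to T. *)

Require Import Defs.
From HB Require Import structures.
From mathcomp Require Import all_boot all_order all_algebra finmap.
From mathcomp Require Import sesquilinear complex.
From mathcomp Require Import all_classical all_reals all_analysis.
From mathcomp Require summability.
From mathcomp Require Import ring lra zify.

Set Implicit Arguments.
Unset Strict Implicit.
Unset Printing Implicit Defensive.

Import Order.TTheory GRing.Theory Num.Theory.
Import numFieldNormedType.Exports.
Import ComplexField.Normc.

Local Open Scope classical_set_scope.
Local Open Scope fset_scope.
Local Open Scope complex_scope.
Local Open Scope ring_scope.

(** The obstacle is that [E1f] enters the tau-derivatives of [wpf] and [dz wpf]: single terms of a
    transvectant leave JS0, and only invariance under sigma brings their sum back. Invariants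
    contain no [E1f] because [E1f] takes infinitely many values along an orbit of sigma, on which
    elements of JS0 are constant. The function theory is Eisenstein's. A product of two row sums is
    regrouped by the difference k of the row indices; the addition law makes each group linear in
    the row functions, and what converges only conditionally is governed by the sum over m of sgn(m
    + k) - sgn(m), which is 2k. One passage to z = 0 identifies the constant in wp'' = 6 wp^2 - 30
    e4, and the value found is also Ramanujan's formula. Differentiating the product relation for E1
    in z gives the heat equations; differentiating the equation of wp in tau gives e4'. [dz] and
    [dtau] are total operators with junk values, hence treated as derivations on JS only; that they
    commute there is read off from the explicit derivatives of the five generators. *)

Section Modulus.
Context {R : realType}.
Implicit Types x y : R[i].

(** The norm of [R[i]] takes its values in [R[i]]; a real-valued copy makes [lra] and [nra]
    available. *)
Definition nm x : R := normc x.

Lemma normE x : `|x| = (nm x)%:C. Proof. exact: erefl. Qed.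
Lemma nm_ge0 x : 0 <= nm x. Proof. by rewrite -ler0c -normE normr_ge0. Qed.
Lemma nmM x y : nm (x * y) = nm x * nm y. Proof. exact: normcM. Qed.
Lemma nmV x : nm x^-1 = (nm x)^-1. Proof. exact: normcV. Qed.
Lemma nmN x : nm (- x) = nm x.
Proof. by apply: complexI; rewrite -!normE normrN. Qed.
Lemma nm_eq0 x : (nm x == 0) = (x == 0).
Proof. by rewrite -(inj_eq (@complexI R)) -normE normr_eq0. Qed.
Lemma nm0 : nm 0 = 0. Proof. by apply/eqP; rewrite nm_eq0. Qed.
Lemma nm1 : nm 1 = 1. Proof. by apply: complexI; rewrite -normE normr1. Qed.
Lemma nm_gt0 x : (0 < nm x) = (x != 0).
Proof. by rewrite lt0r nm_ge0 andbT nm_eq0. Qed.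
Lemma nmD x y : nm (x + y) <= nm x + nm y.
Proof. by rewrite -lecR rmorphD -!normE ler_normD. Qed.
Lemma nmB x y : nm (x - y) <= nm x + nm y.
Proof. by rewrite -(nmN y) nmD. Qed.
Lemma nm_distC x y : nm (x - y) = nm (y - x).
Proof. by rewrite -nmN opprB. Qed.
Lemma nm_ge x y : nm x - nm y <= nm (x + y).
Proof. by rewrite lerBlDr -{1}[x](addrK y); exact: nmB. Qed.
Lemma nmX x n : nm (x ^+ n) = nm x ^+ n.
Proof. by elim: n => [|n IH]; rewrite ?expr0 ?nm1 // !exprS nmM IH. Qed.
Lemma nm_real (a : R) : nm a%:C = `|a|.
Proof. by rewrite /nm /= expr0n addr0 sqrtr_sqr. Qed.
Lemma nm_nat n : nm (n%:R : R[i]) = n%:R.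
Proof. by rewrite -(rmorph_nat (real_complex R)) nm_real ger0_norm. Qed.
Lemma nm_int (n : int) : nm (n%:~R : R[i]) = `|n%:~R|.
Proof. by rewrite -(rmorph_int (real_complex R)) nm_real. Qed.
Lemma nmi : nm 'i = 1.
Proof. by rewrite /nm /= expr0n expr1n add0r sqrtr1. Qed.
Lemma nm_sum (I : Type) (r : seq I) (P : pred I) (F : I -> R[i]) :
  nm (\sum_(i <- r | P i) F i) <= \sum_(i <- r | P i) nm (F i).
Proof.
elim/big_rec2: _ => [|i a b _ h]; first by rewrite nm0.
by apply: le_trans (nmD _ _) _; rewrite lerD2l.
Qed.
Lemma Re_nm x : `|complex.Re x| <= nm x.
Proof.
case: x => a b; rewrite /nm /= -sqrtr_sqr ler_sqrt ?addr_ge0 ?sqr_ge0//.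
by rewrite lerDl sqr_ge0.
Qed.
Lemma Im_nm x : `|complex.Im x| <= nm x.
Proof.
case: x => a b; rewrite /nm /= -sqrtr_sqr ler_sqrt ?addr_ge0 ?sqr_ge0//.
by rewrite lerDr sqr_ge0.
Qed.
Lemma nm_ReIm x : nm x <= `|complex.Re x| + `|complex.Im x|.
Proof.
rewrite {1}[x]complexE; apply: le_trans (nmD _ _) _.
by rewrite nmM nmi mul1r !nm_real.
Qed.

Lemma nm_eps0 x : (forall e, 0 < e -> nm x <= e) -> x = 0.
Proof.
move=> h; apply/eqP; rewrite -nm_eq0 eq_le nm_ge0 andbT.
by apply/ler_addgt0Pr => e e0; rewrite add0r h.
Qed.

End Modulus.

Arguments nm : simpl never.

Lemma sum_fset_split (I : choiceType) (V : nmodType) (S T : {fset I})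
    (F : I -> V) : S `<=` T ->
  \sum_(i <- T) F i = \sum_(i <- S) F i + \sum_(i <- T `\` S) F i.
Proof.
move=> ST; rewrite (big_fsetID _ (mem S)) /=; congr (_ + _);
  congr (\sum_(i <- enum_fset _) F i); apply/fsetP => i; rewrite !inE //=.
- by case: (boolP (i \in S)) => // iS; rewrite ?andbF // (fsubsetP ST).
- by rewrite andbC.
Qed.

(** * Unordered sums *)

Section Unordered.
Context {R : realType}.
Local Notation C := R[i].

(** Convergence of the net of finite partial sums, as a relation with the value. [has_sum_lim],
    [has_sum_sym] and [has_sum_nat_cvg] translate it into the three kinds of limits that define
    [wp], [e4], [E1] and [e2]. *)
Definition has_sum (I : choiceType) (f : I -> C) (l : C) :=
  forall e : R, 0 < e -> exists S : {fset I}, forall T : {fset I},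
    S `<=` T -> nm (\sum_(i <- T) f i - l) <= e.

Definition summ (I : choiceType) (f : I -> C) :=
  exists B : R, forall T : {fset I}, \sum_(i <- T) nm (f i) <= B.

Lemma has_sum_unique (I : choiceType) (f : I -> C) l l' :
  has_sum f l -> has_sum f l' -> l = l'.
Proof.
move=> h h'; apply/eqP; rewrite -subr_eq0; apply/eqP/nm_eps0 => e e0.
have e2 : 0 < e / 2 by rewrite divr_gt0.
have [S hS] := h _ e2; have [S' hS'] := h' _ e2.
rewrite -[l](subrK (\sum_(i <- S `|` S') f i)) -addrA.
apply: le_trans (nmD _ _) _; rewrite (splitr e); apply: lerD.
  by rewrite nm_distC hS // fsubsetUl.
by rewrite hS' // fsubsetUr.
Qed.

Lemma eq_has_sum (I : choiceType) (f g : I -> C) l : f =1 g ->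
  has_sum f l -> has_sum g l.
Proof. by move=> /funext ->. Qed.

Lemma has_sumD (I : choiceType) (f g : I -> C) a b :
  has_sum f a -> has_sum g b -> has_sum (fun i => f i + g i) (a + b).
Proof.
move=> hf hg e e0; have e2 : 0 < e / 2 by rewrite divr_gt0.
have [S hS] := hf _ e2; have [S' hS'] := hg _ e2.
exists (S `|` S') => T; rewrite fsubUset => /andP[h1 h2].
rewrite big_split /= opprD addrACA; apply: le_trans (nmD _ _) _.
by rewrite (splitr e); apply: lerD; [exact: hS|exact: hS'].
Qed.

Lemma has_sumZ (I : choiceType) (f : I -> C) a k :
  has_sum f a -> has_sum (fun i => k * f i) (k * a).
Proof.
move=> hf e e0.
have h : 0 < nm k + 1 by rewrite ltr_wpDl ?nm_ge0.
have [S hS] := hf _ (divr_gt0 e0 h); exists S => T /hS hT.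
rewrite -mulr_sumr -mulrBr nmM.
apply: le_trans (_ : (nm k + 1) * (e / (nm k + 1)) <= e); last first.
  by rewrite mulrCA divff ?mulr1 // gt_eqF.
by apply: ler_pM; rewrite ?nm_ge0 // lerDl.
Qed.

Lemma has_sumN (I : choiceType) (f : I -> C) a :
  has_sum f a -> has_sum (fun i => - f i) (- a).
Proof.
move=> /(has_sumZ (-1)); rewrite mulN1r; apply: eq_has_sum => i.
by rewrite mulN1r.
Qed.

Lemma has_sumB (I : choiceType) (f g : I -> C) a b :
  has_sum f a -> has_sum g b -> has_sum (fun i => f i - g i) (a - b).
Proof. by move=> hf /has_sumN; exact: has_sumD. Qed.

Lemma has_sum_fin (I : choiceType) (f : I -> C) (S : {fset I}) :
  (forall i, i \notin S -> f i = 0) -> has_sum f (\sum_(i <- S) f i).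
Proof.
move=> h e e0; exists S => T ST.
rewrite (big_fset_incl _ ST) ?subrr ?nm0 ?ltW // => i _; exact: h.
Qed.

Lemma has_sum1 (I : choiceType) (f : I -> C) i :
  (forall j, j != i -> f j = 0) -> has_sum f (f i).
Proof.
move=> h; have <- : \sum_(j <- [fset i]) f j = f i by rewrite big_seq_fset1.
by apply: has_sum_fin => j; rewrite inE; exact: h.
Qed.

Lemma has_sum_le (I : choiceType) (f : I -> C) l B :
  has_sum f l -> (forall T : {fset I}, \sum_(i <- T) nm (f i) <= B) -> nm l <= B.
Proof.
move=> h hB; apply/ler_addgt0Pr => e /h [S] /(_ S (fsubset_refl _)) hS.
rewrite -[l](subKr (\sum_(i <- S) f i)); apply: le_trans (nmB _ _) _.
by apply: lerD => //; apply: le_trans (nm_sum _ _ _) (hB S).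
Qed.

(** The sum is the supremum of the finite partial sums. *)
Lemma summ_has_sum_nneg (I : choiceType) (a : I -> R) (B : R) :
  (forall i, 0 <= a i) -> (forall T : {fset I}, \sum_(i <- T) a i <= B) ->
  exists l, has_sum (fun i => (a i)%:C) l.
Proof.
move=> a0 hB.
pose E := [set \sum_(i <- T) a i | T in [set: {fset I}]].
have hE : has_sup E.
  by split; [exists (\sum_(i <- fset0) a i), fset0|exists B => _ [T _ <-]].
exists (sup E)%:C => e e0.
have [_ [S _ <-] hS] := sup_adherent e0 hE.
exists S => T ST.
have -> : \sum_(i <- T) (a i)%:C = (\sum_(i <- T) a i)%:C by rewrite rmorph_sum.
rewrite -rmorphB nm_real ler_norml; apply/andP; split; last first.
  rewrite lerBlDr; apply: ler_wpDl; first exact: ltW.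
  by apply: ub_le_sup; [case: hE|exists T].
rewrite lerBrDl; apply: ltW; apply: lt_le_trans hS _.
by rewrite (sum_fset_split _ ST) lerDl sumr_ge0.
Qed.

Lemma summ_le (I : choiceType) (f : I -> C) (M : I -> R) (B : R) :
  (forall i, nm (f i) <= M i) -> (forall T : {fset I}, \sum_(i <- T) M i <= B) ->
  summ f.
Proof.
by move=> fM hB; exists B => T; apply: le_trans (hB T); apply: ler_sum.
Qed.

Lemma summD (I : choiceType) (f g : I -> C) :
  summ f -> summ g -> summ (fun i => f i + g i).
Proof.
move=> [B hB] [B' hB']; exists (B + B') => T.
apply: le_trans (lerD (hB T) (hB' T)).
by rewrite -big_split; apply: ler_sum => i _; exact: nmD.
Qed.

Lemma summZ (I : choiceType) (f : I -> C) k :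
  summ f -> summ (fun i => k * f i).
Proof.
move=> [B hB]; exists (nm k * B) => T.
under eq_bigr do rewrite nmM.
by rewrite -mulr_sumr ler_wpM2l ?nm_ge0.
Qed.

Lemma summ_has_sum (I : choiceType) (f : I -> C) :
  summ f -> exists l, has_sum f l.
Proof.
move=> [B hB].
(* A real family [u] dominated by [nm f] is the difference of the nonnegative families [u + nm f]
   and [nm f]. *)
have key (u : I -> R) : (forall i, `|u i| <= nm (f i)) ->
    exists l, has_sum (fun i => (u i)%:C) l.
  move=> hu.
  have [l1 h1] : exists l, has_sum (fun i => (u i + nm (f i))%:C) l.
    apply: (@summ_has_sum_nneg _ _ (B + B)) => [i|T].
      by rewrite -lerBlDr sub0r; have /ler_normlP[] := hu i; lra.
    apply: le_trans (lerD (hB T) (hB T)); rewrite -big_split.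
    by apply: ler_sum => i _; rewrite lerD2r; have /ler_normlP[] := hu i.
  have [l2 h2] : exists l, has_sum (fun i => (nm (f i))%:C) l.
    by apply: (@summ_has_sum_nneg _ _ B) => // i; exact: nm_ge0.
  exists (l1 - l2); apply: eq_has_sum (has_sumB h1 h2) => i.
  by rewrite -rmorphB addrK.
have [l1 h1] := key _ (fun i => Re_nm (f i)).
have [l2 h2] := key _ (fun i => Im_nm (f i)).
exists (l1 + 'i * l2).
by apply: eq_has_sum (has_sumD h1 (has_sumZ 'i h2)) => i; rewrite -complexE.
Qed.

(** Small tails for the Weierstrass test: the sum over [T] is the difference of those over [S]
    united with [T] and over [S], both within e / 2 of the limit. *)
Lemma summ_tail (I : choiceType) (M : I -> R) (B : R) :
  (forall i, 0 <= M i) -> (forall T : {fset I}, \sum_(i <- T) M i <= B) ->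
  forall e, 0 < e -> exists S : {fset I}, forall T : {fset I},
    [disjoint S & T] -> \sum_(i <- T) M i <= e.
Proof.
move=> M0 hB e e0.
have [l hl] := summ_has_sum_nneg M0 hB.
have e2 : 0 < e / 2 by rewrite divr_gt0.
have [S hS] := hl _ e2; exists S => T dST.
have := hS (S `|` T) (fsubsetUl _ _).
have := hS S (fsubset_refl _).
rewrite (sum_fset_split _ (fsubsetUl S T)).
have -> : (S `|` T) `\` S = T.
  rewrite fsetDUl fsetDv fset0U; apply/fsetDidPl.
  by rewrite fdisjoint_sym.
set a := \sum_(i <- S) _; set b := \sum_(i <- T) _ => ha hb.
have : nm b <= e.
  rewrite -[b](addKr (a - l)) [e]splitr addrC; apply: le_trans (nmB _ _) _.
  by rewrite addrAC; apply: lerD.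
have -> : b = (\sum_(i <- T) M i)%:C by rewrite rmorph_sum.
rewrite nm_real.
by rewrite ger0_norm // sumr_ge0.
Qed.

(** The image of [j] only has to contain the support of [f]. This serves the embeddings of nat into
    int, of the even and odd integers, and of the nonzero lattice points into pairs of integers. *)
Lemma has_sum_reindex (I J : choiceType) (f : J -> C) (j : I -> J) (k : J -> I) l :
  (forall i, k (j i) = i) -> (forall y, f y != 0 -> j (k y) = y) ->
  has_sum f l -> has_sum (f \o j) l.
Proof.
move=> jK kK h e e0; have [S hS] := h _ e0.
have jinj : injective j by exact: can_inj jK.
exists [fset k y | y in S] => T ST.
have -> : \sum_(i <- T) (f \o j) i = \sum_(y <- [fset j i | i in T]) f y.
  by rewrite big_imfset // => ? ? _ _; exact: jinj.
rewrite (big_fset_incl _ (fsubsetUl [fset j i | i in T] S)); last first.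
  move=> y; rewrite in_fsetU => /orP[->//|yS] yT.
  apply/eqP/negP => /negP fy; move/negP: yT; apply.
  apply/imfsetP; exists (k y) => /=; last by rewrite kK.
  by apply: (fsubsetP ST); apply/imfsetP; exists y.
by apply: hS; exact: fsubsetUr.
Qed.

Lemma has_sum_bij (I J : choiceType) (f : J -> C) (j : I -> J) (k : J -> I) l :
  cancel j k -> cancel k j -> has_sum f l -> has_sum (f \o j) l.
Proof. by move=> jK kK; apply: has_sum_reindex jK _ => y _. Qed.

Lemma has_sum_sigma (I J : choiceType) (f : I * J -> C) (r : I -> C) l :
  has_sum f l -> (forall i, has_sum (fun j => f (i, j)) (r i)) -> has_sum r l.
Proof.
move=> hf hr e e0; have [S hS] := hf _ e0.
exists [fset p.1 | p in S] => T ST.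
apply/ler_addgt0Pr => d d0.
(* The finitely many rows in [T] share the error [d]; each [V i] also contains the second
   projections of [S], so that the union [U] of the rows contains [S]. *)
pose d' := d / (#|` T|.+1)%:R.
have d'0 : 0 < d' by rewrite divr_gt0 ?ltr0n.
have /choice[V hV] : forall i, exists V : {fset J}, [fset p.2 | p in S] `<=` V /\
    nm (\sum_(j <- V) f (i, j) - r i) <= d'.
  move=> i; have [V hV] := hr i _ d'0.
  by exists (V `|` [fset p.2 | p in S]); rewrite fsubsetUr hV ?fsubsetUl.
pose U := [fset ((i, j) : (I * J)%type) | i in T, j in V i].
have SU : S `<=` U.
  apply/fsubsetP => -[i j] ijS; apply/imfset2P => /=.
  exists i; first by apply: (fsubsetP ST); apply/imfsetP; exists (i, j).
  exists j => //; apply: (fsubsetP (hV i).1).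
  by apply/imfsetP; exists (i, j).
have := hS _ SU.
have -> : \sum_(p <- U) f p = \sum_(i <- T) \sum_(j <- V i) f (i, j).
  rewrite big_imfset2 /=; last by move=> [? ?] [? ?] _ _ /= [-> ->].
  by [].
move=> hU.
rewrite -[X in nm (X - l)](subrK (\sum_(i <- T) \sum_(j <- V i) f (i, j))).
rewrite -addrA addrC; apply: le_trans (nmD _ _) _; apply: lerD => //.
rewrite -sumrB; apply: le_trans (nm_sum _ _ _) _.
apply: (@le_trans _ _ (\sum_(i <- T) d')).
  by apply: ler_sum => i _; rewrite nm_distC; case: (hV i).
rewrite big_const_seq count_predT iter_addr_0 -[size _]/#|` T|.
rewrite -[d' *+ _]mulr_natr /d' mulrAC ler_pdivrMr ?ltr0n // ler_pM2l // ler_nat.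
exact: leqnSn.
Qed.

Lemma summ_prod (I J : choiceType) (f : I -> C) (g : J -> C) :
  summ f -> summ g -> summ (fun p : I * J => f p.1 * g p.2).
Proof.
move=> [A hA] [B hB]; exists (A * B) => T.
pose T1 := [fset p.1 | p in T]; pose T2 := [fset p.2 | p in T].
pose U := [fset ((i, j) : (I * J)%type) | i in T1, j in T2].
have TU : T `<=` U.
  apply/fsubsetP => -[i j] ijT; apply/imfset2P => /=.
  by exists i; [apply/imfsetP; exists (i, j)|exists j => //; apply/imfsetP; exists (i, j)].
apply: (@le_trans _ _ (\sum_(p <- U) nm (f p.1 * g p.2))).
  by rewrite (sum_fset_split _ TU) lerDl sumr_ge0 // => ? _; exact: nm_ge0.
rewrite big_imfset2 /=; last by move=> [? ?] [? ?] _ _ /= [-> ->].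
apply: (@le_trans _ _ ((\sum_(i <- T1) nm (f i)) * (\sum_(j <- T2) nm (g j)))).
  rewrite mulr_suml; apply: ler_sum => i _; rewrite mulr_sumr.
  by apply: ler_sum => j _; rewrite nmM.
by apply: ler_pM; rewrite ?hA ?hB //; apply: sumr_ge0 => *; exact: nm_ge0.
Qed.

(** Absolute summability provides some sum of the double family; summing it row by row identifies
    the value. *)
Lemma has_sum_prod (I J : choiceType) (f : I -> C) (g : J -> C) a b :
  summ f -> summ g -> has_sum f a -> has_sum g b ->
  has_sum (fun p : I * J => f p.1 * g p.2) (a * b).
Proof.
move=> sf sg hf hg; have [l hl] := summ_has_sum (summ_prod sf sg).
suff -> : a * b = l by [].
apply: has_sum_unique (has_sum_sigma hl _) => /=; last first.
  by move=> i; apply: has_sumZ; exact: hg.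
rewrite mulrC; apply: eq_has_sum (has_sumZ b hf) => i.
by rewrite mulrC.
Qed.

End Unordered.

(** * Complex derivatives *)

Section Derivative.
Context {R : realType}.
Local Notation C := R[i].

Lemma ltr0c (k : R) : (0 < k%:C) = (0 < k).
Proof. by rewrite ltcE /= eqxx. Qed.

Lemma gt0_complex (e : C) : 0 < e -> exists2 e1 : R, 0 < e1 & e = e1%:C.
Proof.
by case: e => a b; rewrite ltcE /= => /andP[/eqP -> a0]; exists a.
Qed.

Lemma diff_quotientE (K : fieldType) (a d h : K) : h != 0 ->
  d - h^-1 * a = - (h^-1 * (a - h * d)).
Proof. by move=> h0; field. Qed.

(** Differentiability without division: there is no exception at [h = 0] and the estimates are
    between real numbers. It agrees with [is_derive] by [cderiv_is_derive] and
    [is_derive_cderiv]. *)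
Definition cderiv (f : C -> C) (x d : C) :=
  forall e : R, 0 < e -> exists2 r : R, 0 < r &
    forall h : C, nm h < r -> nm (f (x + h) - f x - h * d) <= e * nm h.

Lemma cderiv_is_derive (f : C -> C) x d : cderiv f x d -> is_derive x 1 f d.
Proof.
move=> hf.
have key : (fun h => h^-1 *: ((f \o shift x) (h *: (1 : C)) - f x)) @ 0^' --> d.
  apply/cvgrPdist_le => _ /gt0_complex[e e10 ->].
  have [r r0 hr] := hf _ e10.
  rewrite near_withinE; near=> h => h0.
  have hr' : nm h < r.
    rewrite -ltcR -normE; near: h; by apply: nbhs0_lt; rewrite ltr0c.
  rewrite normE lecR /= [h *: 1]mulr1 [h + x]addrC.
  have -> : d - h^-1 *: (f (x + h) - f x) = - (h^-1 * (f (x + h) - f x - h * d)).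
    exact: diff_quotientE.
  rewrite nmN nmM nmV mulrC ler_pdivrMr ?nm_gt0 //; exact: hr.
by apply: DeriveDef; [apply/cvg_ex; exists d|exact: cvg_lim key].
Unshelve. all: by end_near.
Qed.

Lemma is_derive_cderiv (f : C -> C) (x d : C) : is_derive x 1 f d -> cderiv f x d.
Proof.
move=> [df fd] e e0.
have key : (fun h => h^-1 *: ((f \o shift x) (h *: (1 : C)) - f x)) @ 0^' --> d.
  by rewrite -fd.
have eC : 0 < e%:C by rewrite ltr0c.
have /cvgrPdist_le/(_ _ eC) := key.
rewrite near_withinE => /nbhs_ballP[_ /= /gt0_complex[r1 r10 ->] hr]; exists r1 => // h hh.
have [->|h0] := eqVneq h 0; first by rewrite addr0 mul0r !subr0 subrr nm0 mulr0.
have : h != 0 -> nm (d - h^-1 * (f (x + h) - f x)) <= e.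
  have hb : ball (0 : C) r1%:C h.
    by rewrite -ball_normE /ball_ /= sub0r normrN normE ltcR.
  have := hr h hb.
  by rewrite normE lecR /= [h *: 1]mulr1 [h + x]addrC.
move=> /(_ h0).
by rewrite diff_quotientE // nmN nmM nmV mulrC ler_pdivrMr ?nm_gt0.
Qed.

Lemma cderiv_unique (f : C -> C) x d d' :
  cderiv f x d -> cderiv f x d' -> d = d'.
Proof. by move=> /cderiv_is_derive[_ <-] /cderiv_is_derive[_ <-]. Qed.

Lemma cderiv_near (f g : C -> C) x d r : 0 < r ->
  (forall h, nm h < r -> f (x + h) = g (x + h)) -> cderiv f x d -> cderiv g x d.
Proof.
move=> r0 fg hf e /hf[r1 r10 h1].
exists (Num.min r r1); first by rewrite lt_min r0.
move=> h; rewrite lt_min => /andP[hr hr1].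
by rewrite -fg // -[x]addr0 -fg ?nm0 // addr0; exact: h1.
Qed.

Lemma cderiv_cst a x : cderiv (fun=> a) x 0.
Proof.
by move=> e e0; exists 1 => // h _; rewrite subrr mulr0 subr0 nm0 mulr_ge0 ?nm_ge0 ?ltW.
Qed.

Lemma cderiv_id x : cderiv id x 1.
Proof.
move=> e e0; exists 1 => // h _; rewrite /= mulr1 addrAC addrK subrr nm0.
by rewrite mulr_ge0 ?nm_ge0 ?ltW.
Qed.

Lemma cderivD (f g : C -> C) x a b : cderiv f x a -> cderiv g x b ->
  cderiv (fun y => f y + g y) x (a + b).
Proof.
move=> /cderiv_is_derive hf /cderiv_is_derive hg; exact: is_derive_cderiv.
Qed.

Lemma cderivM (f g : C -> C) x a b : cderiv f x a -> cderiv g x b ->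
  cderiv (fun y => f y * g y) x (a * g x + f x * b).
Proof.
move=> /cderiv_is_derive hf /cderiv_is_derive hg; apply: is_derive_cderiv.
have := @is_deriveM _ _ f g x 1 a b hf hg.
by rewrite [f x *: b + _]addrC [g x *: a]mulrC.
Qed.

Lemma cderivV (f : C -> C) x a : f x != 0 -> cderiv f x a ->
  cderiv (fun y => (f y)^-1) x (- a / f x ^+ 2).
Proof.
move=> f0 /cderiv_is_derive hf; apply: is_derive_cderiv.
apply: DeriveDef; first by apply: derivableV => //; exact: ex_derive.
by rewrite deriveV // derive_val /GRing.scale /= mulNr mulrC mulNr mulrC.
Qed.

Lemma cderiv_affine (f : C -> C) a b x d : cderiv f (a + b * x) d ->
  cderiv (fun y => f (a + b * y)) x (b * d).
Proof.
move=> hf e e0.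
have b1 : 0 < nm b + 1 by rewrite ltr_wpDl ?nm_ge0.
have [r r0 hr] := hf _ (divr_gt0 e0 b1).
exists (r / (nm b + 1)); first by rewrite divr_gt0.
move=> h hh.
have hb : nm (b * h) <= (nm b + 1) * nm h by rewrite nmM ler_wpM2r ?nm_ge0 // lerDl.
have hbr : nm (b * h) < r.
  by apply: le_lt_trans hb _; rewrite mulrC -ltr_pdivlMr.
have := hr _ hbr; rewrite mulrDr addrA mulrCA mulrA => hh'.
apply: le_trans hh' _.
apply: le_trans (ler_wpM2l _ hb) _; first by rewrite divr_ge0 // ltW.
by rewrite mulrA divfK ?gt_eqF.
Qed.

Lemma cderiv_cont (f : C -> C) x d : cderiv f x d -> forall e, 0 < e ->
  exists2 r, 0 < r & forall h, nm h < r -> nm (f (x + h) - f x) <= e.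
Proof.
move=> hf e e0; have [r r0 hr] := hf 1 ltr01.
have k0 : 0 < 1 + nm d by rewrite ltr_wpDr ?nm_ge0.
exists (Num.min r (e / (1 + nm d))); first by rewrite lt_min r0 divr_gt0.
move=> h; rewrite lt_min ltr_pdivlMr // => /andP[/hr h1 h2].
rewrite -[f (x + h) - f x](subrK (h * d)); apply: le_trans (nmD _ _) _.
rewrite nmM; nra.
Qed.

(* Constant 2 because the mean value theorem is applied separately to the real
   and imaginary parts. *)
Lemma cderiv_lip (f df : C -> C) (M : R) x h :
  (forall t : R, 0 <= t <= 1 -> cderiv f (x + t%:C * h) (df (x + t%:C * h))) ->
  (forall t : R, 0 <= t <= 1 -> nm (df (x + t%:C * h)) <= M) ->
  nm (f (x + h) - f x) <= 2 * M * nm h.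
Proof.
move=> hf hM.
have key (P : C -> R) : (forall a b, P (a + b) = P a + P b) ->
    (forall (a : R) b, P (a%:C * b) = a * P b) -> (forall a, `|P a| <= nm a) ->
    `|P (f (x + h) - f x)| <= M * nm h.
  move=> PD PZ Pn.
  have PB a b : P (a - b) = P a - P b.
    by rewrite PD -mulN1r -[-1]/((-1) +i* (- 0)) oppr0 -[_ +i* 0]/((-1)%:C) PZ mulN1r.
  pose g (t : R) := P (f (x + t%:C * h)).
  pose dg (t : R) := P (h * df (x + t%:C * h)).
  have hg (t : R) : 0 <= t <= 1 -> is_derive t 1 g (dg t).
    move=> t01.
    have key : (fun k => k^-1 *: ((g \o shift t) (k *: (1 : R)) - g t)) @ 0^' --> dg t.
      apply/cvgrPdist_le => e e0.
      have h1 : 0 < nm h + 1 by rewrite ltr_wpDl ?nm_ge0.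
      have [r r0 hr] := hf t t01 _ (divr_gt0 e0 h1).
      near=> k; have k0 : k != 0 by near: k; exact: nbhs_dnbhs_neq.
      have kr : `|k| < r / (nm h + 1).
        by near: k; apply: dnbhs0_lt; rewrite divr_gt0.
      have khr : nm (k%:C * h) < r.
        rewrite nmM nm_real; apply: le_lt_trans (_ : `|k| * (nm h + 1) < r).
          by rewrite ler_wpM2l // lerDl.
        by rewrite -ltr_pdivlMr.
      have := hr _ khr.
      rewrite /= [k *: 1]mulr1 [k + t]addrC /g /dg.
      have -> : x + t%:C * h + k%:C * h = x + (t + k)%:C * h.
        by rewrite rmorphD /= mulrDl addrA.
      rewrite -mulrA [t + k]addrC => hk.
      have -> : P (h * df (x + t%:C * h)) -
          k^-1 *: (P (f (x + (k + t)%:C * h)) - P (f (x + t%:C * h))) =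
          - (k^-1 * P (f (x + (k + t)%:C * h) - f (x + t%:C * h)
                        - k%:C * (h * df (x + t%:C * h)))).
        rewrite !PB PZ; exact: diff_quotientE.
      rewrite normrN normrM normfV mulrC ler_pdivrMr ?normr_gt0 //.
      apply: le_trans (Pn _) _; apply: le_trans hk _.
      rewrite nmM nm_real mulrCA [leRHS]mulrC ler_wpM2l //.
      by rewrite mulrAC ler_pdivrMr // ler_pM2l // lerDl.
    by apply: DeriveDef; [apply/cvg_ex; exists (dg t)|exact: cvg_lim key].
  have [c /andP[c0 c1]] : exists2 c, 0 <= c <= 1 & g 1 - g 0 = dg c * (1 - 0).
    have [||c] := @MVT_segment R g dg 0 1 ler01.
    - by move=> t /andP[t0 t1]; apply: hg; rewrite !bnd_simp in t0 t1; rewrite !ltW.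
    - apply: derivable_within_continuous => t; rewrite in_itv /= => t01.
      by have [] := hg t t01.
    - by rewrite in_itv /= => c01 gc; exists c.
  rewrite /g mul1r mul0r addr0 subr0 mulr1 -PB => ->.
  apply: le_trans (Pn _) _; rewrite nmM mulrC ler_wpM2r ?nm_ge0 // hM //.
  by rewrite c0.
apply: le_trans (nm_ReIm _) _; rewrite -mulrA mulr_natl mulr2n; apply: lerD.
- apply: key => [[? ?] [? ?]|a [? ?]|a] //=; last exact: Re_nm.
  by rewrite mul0r subr0.
- apply: key => [[? ?] [? ?]|a [? ?]|a] //=; last exact: Im_nm.
  by rewrite mul0r addr0.
Unshelve. all: by end_near.
Qed.

Lemma cderiv0_eq (f : C -> C) x h :
  (forall t : R, 0 <= t <= 1 -> cderiv f (x + t%:C * h) 0) -> f (x + h) = f x.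
Proof.
move=> hf; apply/eqP; rewrite -subr_eq0 -nm_eq0 eq_le nm_ge0 andbT.
have := @cderiv_lip f (fun=> 0) 0 x h hf _; rewrite mulr0 mul0r; apply.
by move=> t _; rewrite nm0.
Qed.

(** Weierstrass test for derivatives: finitely many terms are handled by their own
    differentiability; on the tail, [cderiv_lip] turns the majorant of the derivatives into one of
    the difference quotients. *)
Lemma cderiv_sum (I : choiceType) (f df : I -> C -> C) (F : C -> C) (D : C)
    (M : I -> R) (B r : R) (x : C) : 0 < r ->
  (forall i h, nm h < r -> cderiv (f i) (x + h) (df i (x + h))) ->
  (forall i h, nm h < r -> nm (df i (x + h)) <= M i) ->
  (forall T : {fset I}, \sum_(i <- T) M i <= B) ->
  (forall h, nm h < r -> has_sum (fun i => f i (x + h)) (F (x + h))) ->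
  has_sum (fun i => df i x) D ->
  cderiv F x D.
Proof.
move=> r0 hf hM hB hF hD e e0.
have M0 i : 0 <= M i.
  by apply: le_trans (hM i 0 _); rewrite ?nm_ge0 ?nm0.
have lip i h : nm h < r -> nm (f i (x + h) - f i x) <= 2 * M i * nm h.
  have hht (t : R) : nm h < r -> 0 <= t <= 1 -> nm (t%:C * h) < r.
    move=> hr /andP[t0 t1]; apply: le_lt_trans hr.
    by rewrite nmM nm_real ger0_norm // ler_piMl ?nm_ge0.
  move=> hr; apply: cderiv_lip => t t01; first by apply: hf; exact: hht.
  by apply: hM; exact: hht.
(* A tail term costs at most 3 M i |h|, namely 2 from [cderiv_lip] and 1 from [h * df i x]. Hence e
   / 6 for the tail, which leaves e / 2 for the part over [S]. *)
have e6 : 0 < e / 6 by rewrite divr_gt0.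
have [S hS] := summ_tail M0 hB e6.
pose d := e / 2 / (#|` S|.+1)%:R.
have d0 : 0 < d by rewrite !divr_gt0 ?ltr0n.
have [r1 r10 hr1] : exists2 r1 : R, 0 < r1 & forall h, nm h < r1 -> forall i,
    i \in S -> nm (f i (x + h) - f i x - h * df i x) <= d * nm h.
  have : exists2 r1 : R, 0 < r1 & forall h, nm h < r1 -> forall i,
    i \in (S : seq I) -> nm (f i (x + h) - f i x - h * df i x) <= d * nm h.
    elim: (S : seq I) => [|i s [r1 r10 IH]]; first by exists 1.
    have : cderiv (f i) x (df i x) by rewrite -[x]addr0; apply: hf; rewrite nm0.
    move=> /(_ _ d0)[r2 r20 h2]; exists (Num.min r1 r2); first by rewrite lt_min r10.
    move=> h; rewrite lt_min => /andP[h1 h2'] j; rewrite inE => /orP[/eqP ->|js].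
      exact: h2.
    exact: IH.
  by [].
exists (Num.min r r1); first by rewrite lt_min r0.
move=> h; rewrite lt_min => /andP[hr hr1'].
have hx : has_sum (fun i => f i x) (F x) by have := hF 0; rewrite nm0 addr0; exact.
have := has_sumB (has_sumB (hF h hr) hx) (has_sumZ h hD).
move=> /has_sum_le; apply => T.
apply: (@le_trans _ _ (\sum_(i <- S `|` T) nm (f i (x + h) - f i x - h * df i x))).
  rewrite (sum_fset_split _ (fsubsetUr S T)) lerDl.
  by apply: sumr_ge0 => *; exact: nm_ge0.
rewrite (sum_fset_split _ (fsubsetUl S T)) [e]splitr mulrDl; apply: lerD.
  apply: (@le_trans _ _ (\sum_(i <- S) d * nm h)).
    by rewrite big_seq [leRHS]big_seq; apply: ler_sum => i iS; exact: hr1.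
  rewrite big_const_seq count_predT iter_addr_0 -[size _]/#|` S|.
  rewrite -[d * nm h *+ _]mulr_natr mulrAC ler_wpM2r ?nm_ge0 //.
  rewrite /d mulrAC ler_pdivrMr ?ltr0n // ler_pM2l ?divr_gt0 // ler_nat.
  exact: leqnSn.
set U := _ `\` _.
have dSU : [disjoint S & U].
  rewrite /U fsetDUl fsetDv fset0U.
  by apply/fdisjointP => i iS; rewrite !inE iS.
apply: (@le_trans _ _ (\sum_(i <- U) 3 * nm h * M i)).
  apply: ler_sum => i _; apply: le_trans (nmB _ _) _.
  have h1 := lip i h hr.
  have h2 : nm (df i x) <= M i by rewrite -[x]addr0; apply: hM; rewrite nm0.
  rewrite nmM; have := nm_ge0 h; nra.
rewrite -mulr_sumr; have := hS _ dSU; have := nm_ge0 h; nra.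
Qed.

End Derivative.

(** * The cotangent and its partial fractions *)

Section CotangentDef.
Context {R : realType}.
Local Notation C := R[i].
Implicit Types x y : C.

Lemma is_derive_eps (f : R -> R) (x d : R) : is_derive x 1 f d ->
  forall e, 0 < e -> exists2 r : R, 0 < r &
    forall h, `|h| < r -> `|f (x + h) - f x - h * d| <= e * `|h|.
Proof.
move=> [df fd] e e0.
have key : (fun h => h^-1 *: ((f \o shift x) (h *: (1 : R)) - f x)) @ 0^' --> d.
  by rewrite -fd.
have /cvgrPdist_le/(_ _ e0) := key.
rewrite near_withinE => /nbhs_ballP[r /= r0 hr].
exists r => // h hh.
have [->|h0] := eqVneq h 0; first by rewrite addr0 mul0r !subr0 subrr normr0 mulr0.
have hb : ball (0 : R) r h by rewrite -ball_normE /ball_ /= sub0r normrN.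
have := hr h hb h0; rewrite /= [h *: 1]mulr1 [h + x]addrC.
by rewrite diff_quotientE // normrN normrM normfV mulrC ler_pdivrMr ?normr_gt0.
Qed.

Lemma cexpD x y : cexp (x + y) = cexp x * cexp y.
Proof.
case: x y => a b [c d]; rewrite /cexp /= expRD cosD sinD; simpc.
by congr (_ +i* _); ring.
Qed.

Lemma cexp0 : cexp (0 : C) = 1.
Proof. by rewrite /cexp /= expR0 cos0 sin0; simpc. Qed.

Lemma nm_cexp x : nm (cexp x) = expR (complex.Re x).
Proof.
rewrite /cexp nmM nm_real ger0_norm ?expR_ge0 // /nm /=.
by rewrite cos2Dsin2 sqrtr1 mulr1.
Qed.

Lemma cexp_neq0 x : cexp x != 0.
Proof. by rewrite -nm_eq0 nm_cexp gt_eqF // expR_gt0. Qed.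

Lemma cexpN x : cexp (- x) = (cexp x)^-1.
Proof.
apply: (mulfI (cexp_neq0 x)); rewrite -cexpD subrr cexp0 divff //.
exact: cexp_neq0.
Qed.

Lemma cexpMn n x : cexp (n%:R * x) = cexp x ^+ n.
Proof.
elim: n => [|n IH]; first by rewrite mul0r cexp0 expr0.
by rewrite mulrSr mulrDl mul1r cexpD IH exprSr.
Qed.

Lemma cexp_deriv0 : cderiv cexp (0 : C) 1.
Proof.
move=> e e0.
(* With [n] the modulus of the increment, the errors below add up to 7 d n: 3 d n in the real part
   and 4 d n in the imaginary part. *)
have [d [d0 d1 de]] : exists d : R, [/\ 0 < d, d <= 1 & d <= e / 16].
  exists (Num.min 1 (e / 16)).
  by rewrite lt_min ltr01 divr_gt0 // !ge_min !lexx orbT.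
have [r1 r10 h1] := is_derive_eps (is_derive_expR (0 : R)) d0.
have [r2 r20 h2] := is_derive_eps (is_derive_cos (0 : R)) d0.
have [r3 r30 h3] := is_derive_eps (is_derive_sin (0 : R)) d0.
exists (Num.min d (Num.min r1 (Num.min r2 r3))).
  by rewrite !lt_min d0 r10 r20.
move=> [a b]; rewrite !lt_min => /and4P[hd hr1 hr2 hr3].
have ha : `|a| <= nm (a +i* b) := Re_nm (a +i* b).
have hb : `|b| <= nm (a +i* b) := Im_nm (a +i* b).
have := h1 a (le_lt_trans ha hr1).
have := h2 b (le_lt_trans hb hr2).
have := h3 b (le_lt_trans hb hr3).
rewrite !add0r expR0 cos0 sin0 oppr0 !mulr0 !mulr1 !subr0 addr0 => s3 s2 s1.
rewrite cexp0; set n := nm (a +i* b).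
rewrite -/n in ha hb.
have n0 : 0 <= n := nm_ge0 _.
apply: le_trans (nm_ReIm _) _.
rewrite /cexp /= !mul0r subr0 addr0 !oppr0 addr0.
have -> : expR a * cos b - 1 - a = (expR a - 1 - a) * cos b + (1 + a) * (cos b - 1).
  by ring.
have -> : expR a * sin b - b = (expR a - 1 - a) * sin b + a * sin b + (sin b - b).
  by ring.
have cb := cos_max b; have sb := sin_max b.
have dn : d * n <= e / 16 * n by rewrite ler_wpM2r.
have A : `|expR a - 1 - a| <= d * n by apply: le_trans s1 _; rewrite ler_pM2l.
have B : `|cos b - 1| <= d * n by apply: le_trans s2 _; rewrite ler_pM2l.
have B' : `|sin b - b| <= d * n by apply: le_trans s3 _; rewrite ler_pM2l.
have ad : `|a| <= d by apply: le_trans ha (ltW hd).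
have sb2 : `|sin b| <= 2 * n.
  have dn1 : d * n <= n by rewrite ler_piMl.
  rewrite -[sin b](subrK b); apply: le_trans (ler_normD _ _) _. lra.
have T1 : `|(expR a - 1 - a) * cos b| <= d * n.
  rewrite normrM; have := normr_ge0 (cos b); have := normr_ge0 (expR a - 1 - a); nra.
have T2 : `|(1 + a) * (cos b - 1)| <= 2 * (d * n).
  rewrite normrM; apply: ler_pM => //; apply: le_trans (ler_normD _ _) _.
  by rewrite normr1; lra.
have T3 : `|(expR a - 1 - a) * sin b| <= d * n.
  rewrite normrM; have := normr_ge0 (sin b); have := normr_ge0 (expR a - 1 - a); nra.
have T4 : `|a * sin b| <= d * (2 * n) by rewrite normrM; apply: ler_pM.
have en : 0 <= e * n by rewrite mulr_ge0 // ltW.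
have := ler_normD ((expR a - 1 - a) * cos b) ((1 + a) * (cos b - 1)).
have := ler_normD ((expR a - 1 - a) * sin b + a * sin b) (sin b - b).
have := ler_normD ((expR a - 1 - a) * sin b) (a * sin b).
lra.
Qed.

Lemma cexp_deriv x : cderiv cexp x (cexp x).
Proof.
move=> e e0; have n0 : 0 < nm (cexp x) by rewrite nm_gt0 cexp_neq0.
have [r r0 hr] := cexp_deriv0 (divr_gt0 e0 n0).
exists r => // h /hr; rewrite add0r cexp0 mulr1 => hh.
have -> : cexp (x + h) - cexp x - h * cexp x = cexp x * (cexp h - 1 - h).
  by rewrite cexpD; ring.
by rewrite nmM mulrC -ler_pdivlMr // mulrAC.
Qed.

Lemma ReD x y : complex.Re (x + y) = complex.Re x + complex.Re y.
Proof. by case: x y => ? ? []. Qed.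
Lemma ImD x y : complex.Im (x + y) = complex.Im x + complex.Im y.
Proof. by case: x y => ? ? []. Qed.
Lemma ReB x y : complex.Re (x - y) = complex.Re x - complex.Re y.
Proof. by case: x y => ? ? []. Qed.
Lemma Re_int (n : int) : complex.Re (n%:~R : C) = n%:~R.
Proof. by rewrite -(rmorph_int (real_complex R)). Qed.
Lemma Im_int (n : int) : complex.Im (n%:~R : C) = 0.
Proof. by rewrite -(rmorph_int (real_complex R)). Qed.

Definition isint x := exists n : int, x = n%:~R.

Definition vv x : C := cexp (2 * 'i * pi%:C * x).

Lemma Re_2pii x : complex.Re (2 * 'i * pi%:C * x) = - (2 * pi * complex.Im x).
Proof.
have -> : (2 : C) = (2 : R)%:C by rewrite rmorph_nat.
by case: x => a b /=; ring.
Qed.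

Lemma Im_2pii x : complex.Im (2 * 'i * pi%:C * x) = 2 * pi * complex.Re x.
Proof.
have -> : (2 : C) = (2 : R)%:C by rewrite rmorph_nat.
by case: x => a b /=; ring.
Qed.

Lemma nm_vv x : nm (vv x) = expR (- (2 * pi * complex.Im x)).
Proof. by rewrite nm_cexp Re_2pii. Qed.

Lemma vvD x y : vv (x + y) = vv x * vv y.
Proof. by rewrite /vv mulrDr cexpD. Qed.

Lemma vvN x : vv (- x) = (vv x)^-1.
Proof. by rewrite /vv mulrN cexpN. Qed.

Lemma vvB x y : vv (x - y) = vv x / vv y.
Proof. by rewrite vvD vvN. Qed.

Lemma vv0 : vv 0 = 1. Proof. by rewrite /vv mulr0 cexp0. Qed.

Lemma vv_neq0 x : vv x != 0. Proof. exact: cexp_neq0. Qed.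

Lemma vvMn n x : vv (n%:R * x) = vv x ^+ n.
Proof. by rewrite /vv mulrCA cexpMn. Qed.

Lemma vv1 : vv 1 = 1.
Proof.
rewrite /vv /cexp Re_2pii Im_2pii /= !mulr0 oppr0 expR0 mulr1.
by rewrite mulr_natl cos2pi sin2pi; simpc.
Qed.

Lemma vv_half : vv 2^-1 = -1.
Proof.
have h2 : (2^-1 : C) = (2^-1 : R)%:C by rewrite fmorphV rmorph_nat.
rewrite /vv /cexp Re_2pii Im_2pii h2 /= !mulr0 oppr0 expR0.
rewrite [2 * pi]mulrC mulfK ?pnatr_eq0 // cospi sinpi; simpc.
by rewrite complexr0 rmorphN.
Qed.

Lemma vv_int (n : int) : vv n%:~R = 1.
Proof.
have vv_nat (m : nat) : vv m%:R = 1 by rewrite -[m%:R]mulr1 vvMn vv1 expr1n.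
by case: n => m; [exact: vv_nat|rewrite NegzE mulrNz vvN vv_nat invr1].
Qed.

Lemma vvDint x (n : int) : vv (x + n%:~R) = vv x.
Proof. by rewrite vvD vv_int mulr1. Qed.

(** Let [y] be [x] minus the floor of its real part. The modulus of [vv y] forces [Im y = 0], and
    its real part, a cosine, forces [Re y = 0]. *)
Lemma vv_eq1 x : vv x = 1 <-> isint x.
Proof.
split=> [h|[n ->]]; last exact: vv_int.
pose n := Num.floor (complex.Re x); pose y := x - n%:~R.
have hy : vv y = 1 by rewrite vvB h vv_int divr1.
suff y0 : y = 0 by exists n; apply/eqP; rewrite -subr_eq0 -/y y0.
have y2 : complex.Im y = 0.
  have := nm_vv y; rewrite hy nm1 => /esym/eqP.
  rewrite -[X in _ == X](@expR0 R) (inj_eq (@expR_inj R)) oppr_eq0 !mulf_eq0 pnatr_eq0 /=.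
  by rewrite gt_eqF ?pi_gt0 //= => /eqP.
have [y1 y1'] : 0 <= complex.Re y /\ complex.Re y < 1.
  have -> : complex.Re y = complex.Re x - n%:~R.
    by rewrite /y ReB Re_int.
  have := floor_itv (complex.Re x); rewrite -/n intrD => /andP[]; lra.
have hc : cos (2 * pi * complex.Re y) = 1.
  have := congr1 (@complex.Re R) hy; rewrite /vv /cexp Re_2pii Im_2pii y2.
  by rewrite mulr0 oppr0 expR0 /= mul0r subr0 mul1r.
have p0 := pi_gt0 R.
have p2 : 2 * pi != 0 :> R by rewrite mulf_neq0 ?pnatr_eq0 // gt_eqF.
have in0 : 0 \in `[0, (pi : R)] by rewrite in_itv /= lexx pi_ge0.
have y0 : complex.Re y = 0.
  (* [cos] is injective on [0, pi] only; beyond 1/2, [1 - Re y] takes the place of [Re y]. *)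
  have [l|l] := lerP (complex.Re y) (1 / 2).
    have : 2 * pi * complex.Re y = 0.
      by apply: cos_inj => //; rewrite ?in_itv /= ?hc ?cos0 //; apply/andP; split; nra.
    by move/eqP; rewrite mulf_eq0 (negPf p2) => /eqP.
  have : 2 * pi * (1 - complex.Re y) = 0.
    apply: cos_inj => //; rewrite ?in_itv /=; first by apply/andP; split; nra.
    have -> : 2 * pi * (1 - complex.Re y) = - (2 * pi * complex.Re y) + pi *+ 2.
      ring.
    by rewrite cosD2pi cosN hc cos0.
  by move/eqP; rewrite mulf_eq0 (negPf p2) => /eqP; lra.
by move: y0 y2; case: (y) => a b /= -> ->.
Qed.

Lemma vv_neq1 x : ~ isint x -> vv x != 1.
Proof. by move=> h; apply/eqP => /vv_eq1. Qed.

Lemma vv_deriv x : cderiv vv x (2 * 'i * pi%:C * vv x).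
Proof.
have := @cderiv_affine _ cexp 0 (2 * 'i * pi%:C) x (vv x).
rewrite add0r => /(_ (cexp_deriv _)).
by apply: (@cderiv_near _ _ _ _ _ 1) => // h _; rewrite add0r.
Qed.

Definition piC : C := pi%:C.

Lemma piC_neq0 : piC != 0.
Proof. by rewrite -(rmorph0 (real_complex R)) (inj_eq (@complexI R)) gt_eqF ?pi_gt0. Qed.

Lemma iC_neq0 : 'i != 0 :> C.
Proof. by rewrite -nm_eq0 nmi oner_eq0. Qed.

(* cc x = pi cot (pi x) and ss x = pi^2 / sin^2 (pi x) *)
Definition cc x : C := 'i * piC * (vv x + 1) / (vv x - 1).
Definition ss x : C := cc x ^+ 2 + piC ^+ 2.

Lemma ccDint x (n : int) : cc (x + n%:~R) = cc x.
Proof. by rewrite /cc vvDint. Qed.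

Lemma ssDint x (n : int) : ss (x + n%:~R) = ss x.
Proof. by rewrite /ss ccDint. Qed.

Lemma ccN x : cc (- x) = - cc x.
Proof.
rewrite /cc vvN; have [->|h] := eqVneq (vv x) 1.
  by rewrite invr1 subrr invr0 !mulr0 oppr0.
by field; rewrite ?mulN1r ?vv_neq0 ?subr_eq0 ?(eq_sym 1) ?h.
Qed.

Lemma ssN x : ss (- x) = ss x.
Proof. by rewrite /ss ccN sqrrN. Qed.

Lemma ssE x : vv x != 1 -> ss x = - 4 * piC ^+ 2 * vv x / (vv x - 1) ^+ 2.
Proof.
move=> h; rewrite /ss /cc !(expr_div_n, exprMn) sqr_i.
by field; rewrite subr_eq0.
Qed.

(** Up to sign this is the x-derivative of [cc_ss_mul], itself the y-derivative of the addition law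
    of [cc]. For a fixed difference [x - y] the right-hand side is linear in functions of [x] alone
    and of [y] alone, so it can be summed along a diagonal. *)
Lemma ss_mul x y : vv x != 1 -> vv y != 1 -> vv x != vv y ->
  ss x * ss y = ss (x - y) * (ss x + ss y) + 2 * cc (x - y) * ss (x - y) * (cc x - cc y).
Proof.
move=> hx hy hxy; rewrite /ss /cc vvB.
(* Written through i pi, the claim is a rational identity in [vv x], [vv y] and i pi. *)
have -> : piC ^+ 2 = - ('i * piC) ^+ 2 by rewrite exprMn sqr_i; ring.
field.
by rewrite ?mulN1r ?vv_neq0 ?subr_eq0 ?[vv y == vv x]eq_sym ?(eq_sym 1) ?hx ?hy ?hxy.
Qed.

Lemma cc_ss_mul x y : vv x != 1 -> vv y != 1 -> vv x != vv y ->
  cc x * ss y = ss (x - y) * (cc x - cc y) + cc (x - y) * ss y.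
Proof.
move=> hx hy hxy; rewrite /ss /cc vvB.
have -> : piC ^+ 2 = - ('i * piC) ^+ 2 by rewrite exprMn sqr_i; ring.
field.
by rewrite ?mulN1r ?vv_neq0 ?subr_eq0 ?[vv y == vv x]eq_sym ?(eq_sym 1) ?hx ?hy ?hxy.
Qed.

(** The counterpart for [ss] of splitting a row sum into its even and odd terms, as in
    [T2_double]. *)
Lemma ss_double x : vv x != 1 -> ss (x / 2) + ss ((x + 1) / 2) = 4 * ss x.
Proof.
move=> hx; rewrite /ss /cc mulrDl mul1r vvD vv_half.
have -> : vv x = vv (x / 2) ^+ 2.
  by rewrite -vvMn mulrC divfK ?pnatr_eq0.
have : vv (x / 2) ^+ 2 != 1.
  by rewrite -vvMn mulrC divfK ?pnatr_eq0.
move: (vv (x / 2)) => p h12; move: (h12); rewrite sqrf_eq1 => /norP[h1 h2].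
have -> : piC ^+ 2 = - ('i * piC) ^+ 2 by rewrite exprMn sqr_i; ring.
field.
by rewrite !subr_eq0 h12 h1 mulrN1 eqr_oppLR h2.
Qed.

Lemma cc_deriv x : vv x != 1 -> cderiv cc x (- ss x).
Proof.
move=> h; have hv := vv_deriv x.
have h1 : vv x - 1 != 0 by rewrite subr_eq0.
have hm := cderivV (f := fun y => vv y - 1) h1 (cderivD hv (cderiv_cst (- 1) x)).
have hp := cderivM (cderiv_cst ('i * piC) x) (cderivD hv (cderiv_cst 1 x)).
have := cderivM hp hm.
congr cderiv; rewrite ssE // -/piC.
have -> : - (- 4 * piC ^+ 2 * vv x / (vv x - 1) ^+ 2) =
   - (('i * 'i) * 4 * piC ^+ 2 * vv x / (vv x - 1) ^+ 2).
  by rewrite -expr2 sqr_i; ring.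
by field; rewrite subr_eq0.
Qed.

End CotangentDef.

(** * Families indexed by the integers *)

Section IntFamilies.
Context {R : realType}.
Local Notation C := R[i].

Lemma big_fset_seq (I : choiceType) (V : nmodType) (s : seq I) (F : I -> V) :
  uniq s -> \sum_(i <- [fset x in s]) F i = \sum_(i <- s) F i.
Proof.
move=> us; apply: perm_big; apply: uniq_perm => [|//|i]; last by rewrite !inE.
exact: fset_uniq.
Qed.

Lemma mem_fset_seq (I : choiceType) (s : seq I) i :
  (i \in [fset x in s]) = (i \in s).
Proof. by rewrite !inE. Qed.

Lemma sum_le_fsetU (I : choiceType) (M : I -> R) (T A B : {fset I}) :
  (forall i, 0 <= M i) -> T `<=` A `|` B ->
  \sum_(i <- T) M i <= \sum_(i <- A) M i + \sum_(i <- B) M i.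
Proof.
move=> M0 h.
have le (U V : {fset I}) : U `<=` V -> \sum_(i <- U) M i <= \sum_(i <- V) M i.
  by move=> UV; rewrite (sum_fset_split _ UV) lerDl sumr_ge0.
apply: le_trans (le _ _ h) _.
rewrite (sum_fset_split _ (fsubsetUl A B)) lerD2l; apply: le.
by rewrite fsetDUl fsetDv fset0U fsubsetDl.
Qed.

Lemma bound_nat (a : nat -> R) (B : R) : (forall k, 0 <= a k) ->
  (forall N, \sum_(k < N) a k <= B) ->
  forall T : {fset nat}, \sum_(k <- T) a k <= B.
Proof.
move=> a0 hB T.
have [N hN] : exists N, forall k, k \in T -> (k < N)%N.
  exists (\max_(k <- T) k).+1 => k kT.
  by rewrite ltnS (big_fsetD1 k) //= leq_maxl.
apply: le_trans (hB N).
have TN : T `<=` [fset k in iota 0 N].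
  by apply/fsubsetP => k kT; rewrite !inE mem_iota add0n hN.
apply: (@le_trans _ _ (\sum_(k <- [fset k in iota 0 N]) a k)).
  by rewrite (sum_fset_split _ TN) lerDl sumr_ge0.
by rewrite big_fset_seq ?iota_uniq // -(big_mkord xpredT a) /index_iota subn0.
Qed.

Lemma bound_int (M : int -> R) (A B : R) : (forall m, 0 <= M m) ->
  (forall N, \sum_(k < N) M (Posz k) <= A) ->
  (forall N, \sum_(k < N) M (Negz k) <= B) ->
  forall T : {fset int}, \sum_(m <- T) M m <= A + B.
Proof.
move=> M0 hA hB T.
pose T1 := [fset `|m|%N | m in T]; pose T2 := [fset `|m|.-1%N | m in T].
have TU : T `<=` [fset Posz k | k in T1] `|` [fset Negz k | k in T2].
  apply/fsubsetP => m mT; rewrite in_fsetU; case: m mT => k kT; apply/orP.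
    by left; apply/imfsetP; exists k => //=; apply/imfsetP; exists (Posz k).
  by right; apply/imfsetP; exists k => //=; apply/imfsetP; exists (Negz k).
apply: le_trans (sum_le_fsetU M0 TU) _; apply: lerD.
- rewrite big_imfset /=; last by move=> ? ? _ _ [].
  exact: (@bound_nat (fun k => M (Posz k))).
- rewrite big_imfset /=; last by move=> ? ? _ _ [].
  exact: (@bound_nat (fun k => M (Negz k))).
Qed.

Lemma bound_abs (a : nat -> R) (B : R) : (forall k, 0 <= a k) ->
  (forall N, \sum_(k < N) a k <= B) ->
  forall T : {fset int}, \sum_(m <- T) a `|m|%N <= B + B.
Proof.
move=> a0 hB; apply: bound_int => // N /=.
apply: le_trans (hB N.+1); rewrite big_ord_recl.
by rewrite ler_wpDl.
Qed.

Definition invsq (k : nat) : R := (k.+1%:R ^+ 2)^-1.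

Lemma invsq_gt0 k : 0 < invsq k.
Proof. by rewrite invr_gt0 exprn_gt0 ?ltr0n. Qed.

Lemma invsq_bound N : \sum_(k < N) invsq k <= 2.
Proof.
case: N => [|N]; first by rewrite big_ord0.
(* The bound 2 - 1 / (N + 1) passes from N to N + 1 by telescoping. *)
apply: (@le_trans _ _ (2 - N.+1%:R^-1)); last by rewrite gerBl invr_ge0.
elim: N => [|N IH].
  by rewrite big_ord_recl big_ord0 /invsq expr1n invr1; lra.
rewrite big_ord_recr /=; apply: le_trans (lerD IH (lexx _)) _.
rewrite /invsq -addrA lerD2l.
have : (N.+2%:R : R) = N.+1%:R + 1 by rewrite -[N.+2]addn1 natrD.
have : (0 : R) < N.+1%:R by rewrite ltr0n.
move: (N.+1%:R : R) (N.+2%:R : R) => a _ a0 ->.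
have a1 : 0 < a + 1 by lra.
rewrite -subr_ge0.
have -> : - (a + 1)^-1 - (- a^-1 + ((a + 1) ^+ 2)^-1) = (a * (a + 1) ^+ 2)^-1.
  by field; rewrite !gt_eqF.
by rewrite invr_ge0 mulr_ge0 ?exprn_ge0 ?ltW.
Qed.

Lemma invsq_sum (T : {fset int}) : \sum_(m <- T) invsq `|m|%N <= 4.
Proof.
have -> : (4 : R) = 2 + 2 by rewrite -natrD.
apply: bound_abs => [k|N]; [exact: ltW (invsq_gt0 k)|exact: invsq_bound].
Qed.

Lemma summ_invsq (f : int -> C) (K : R) :
  (forall m, nm (f m) <= K * invsq `|m|%N) -> summ f.
Proof.
move=> h; have K0 : 0 <= K.
  have := le_trans (nm_ge0 _) (h 0); rewrite pmulr_lge0 //; exact: invsq_gt0.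
by apply: (summ_le h (B := K * 4)) => T; rewrite -mulr_sumr ler_wpM2l ?invsq_sum.
Qed.

Lemma has_sum_parity (f : int -> C) a b : summ f ->
  has_sum (fun m => f (m * 2)) a -> has_sum (fun m => f (m * 2 + 1)) b ->
  has_sum f (a + b).
Proof.
move=> sf ha hb.
pose fe m := if (m %% 2)%Z == 0 then f m else 0.
pose fo m := if (m %% 2)%Z == 0 then 0 else f m.
have sub (g : int -> C) : (forall m, nm (g m) <= nm (f m)) -> summ g.
  by move=> h; case: sf => B; apply: summ_le.
have [le hle] : exists l, has_sum fe l.
  by apply/summ_has_sum/sub => m; rewrite /fe; case: ifP => // _; rewrite nm0 nm_ge0.
have [lo hlo] : exists l, has_sum fo l.
  by apply/summ_has_sum/sub => m; rewrite /fo; case: ifP => // _; rewrite nm0 nm_ge0.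
have -> : a = le.
  apply: has_sum_unique ha _.
  have := @has_sum_reindex _ _ _ fe (fun m => m * 2) (fun m => (m %/ 2)%Z) le.
  move=> /(_ _ _ hle); rewrite /comp /fe => H.
  apply: eq_has_sum (H _ _) => m; first by rewrite modzMl eqxx.
    by rewrite mulzK.
  by case: ifP => [/eqP h _|_]; rewrite ?eqxx // [RHS](divz_eq m 2) h addr0.
have -> : b = lo.
  apply: has_sum_unique hb _.
  have := @has_sum_reindex _ _ _ fo (fun m => m * 2 + 1) (fun m => (m %/ 2)%Z) lo.
  move=> /(_ _ _ hlo); rewrite /comp /fo => H.
  apply: eq_has_sum (H _ _) => m; first by rewrite modzMDl.
    by rewrite divzMDl // addr0.
  case: ifP; rewrite ?eqxx // => h _.
  have : (m %% 2)%Z = 1 by lia.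
  by move=> e1; rewrite [RHS](divz_eq m 2) e1.
apply: eq_has_sum (has_sumD hle hlo) => m.
by rewrite /fe /fo; case: ifP; rewrite ?addr0 ?add0r.
Qed.

Lemma has_sum_sym (f : int -> C) l : has_sum f l ->
  symmetric_sum f @ \oo --> l.
Proof.
move=> hf; apply/cvgrPdist_le => _ /gt0_complex[e e0 ->].
have [S hS] := hf e e0.
near=> N.
pose T := [fset m in [seq k%:Z - N%:Z | k <- iota 0 (N.*2).+1]].
have ST : S `<=` T.
  apply/fsubsetP => m mS; rewrite mem_fset_seq.
  have mN : (`|m| <= N)%N.
    apply: (@leq_trans (\max_(i <- S) `|i|)%N).
      by rewrite (big_fsetD1 m) //= leq_maxl.
    by near: N; exact: nbhs_infty_ge.
  apply/mapP; exists (absz (m + N%:Z)%R); last by lia.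
  by rewrite mem_iota; lia.
have := hS _ ST; rewrite normE lecR nm_distC.
congr (nm (_ - _) <= _).
rewrite /symmetric_sum -(big_mkord xpredT (fun k => f (k%:Z - N%:Z))).
rewrite /index_iota subn0 big_fset_seq ?big_map //.
by rewrite map_inj_uniq ?iota_uniq // => i j; lia.
Unshelve. all: by end_near.
Qed.

Lemma symmetric_sum_odd (f : int -> C) N : (forall m, f (- m) = - f m) ->
  symmetric_sum f N = 0.
Proof.
move=> h; have : symmetric_sum f N = - symmetric_sum f N.
  rewrite {1}/symmetric_sum (reindex_inj rev_ord_inj) -sumrN.
  apply: eq_bigr => k _; rewrite -h; congr f => /=.
  have := ltn_ord k; lia.
move=> /eqP; rewrite -addr_eq0 -mulr2n -mulr_natl mulf_eq0 pnatr_eq0 /=.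
by move/eqP.
Qed.

Lemma fin_min (I : eqType) (s : seq I) (a : I -> R) :
  (forall i, i \in s -> 0 < a i) ->
  exists2 c : R, 0 < c & forall i, i \in s -> c <= a i.
Proof.
elim: s => [|i s IH] h; first by exists 1.
have [|c c0 hc] := IH; first by move=> j js; apply: h; rewrite inE js orbT.
exists (Num.min c (a i)); first by rewrite lt_min c0 h ?mem_head.
move=> j; rewrite inE => /orP[/eqP ->|js]; first by rewrite ge_min lexx orbT.
by rewrite ge_min hc.
Qed.

End IntFamilies.

(** * The sum of (x + m)^-2 over the integers, and Taylor bounds for exp *)

Section RowSums.
Context {R : realType}.
Local Notation C := R[i].
Implicit Types x y : C.

Lemma int_ge_abs x (m : int) : (`|m|%N)%:R - nm x <= nm (x + m%:~R).
Proof.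
have -> : (`|m|%N)%:R = nm (m%:~R : C) by rewrite nm_int -intr_norm.
rewrite [x + _]addrC; apply: le_trans (nm_ge _ _); exact: lexx.
Qed.

(** When [|m|] is large compared with [x], the index bounds the modulus from below; the finitely
    many other terms have a minimum. One [c] is both slope and radius, so the bound is locally
    uniform. *)
Lemma row_lower x : ~ isint x -> exists2 c : R, 0 < c &
  forall h (m : int), nm h < c -> c * (`|m|.+1)%:R <= nm (x + h + m%:~R).
Proof.
move=> hx; have L0 := nm_ge0 x.
have [N hN] : exists N : nat, 2 * nm x + 1 <= N%:R.
  exists (Num.truncn (2 * nm x + 1)).+1; apply: ltW; apply: truncnS_gt.
have /fin_min[c c0 hc] : forall m : int, m \in [seq k%:Z - N%:Z | k <- iota 0 N.*2.+1] ->
    0 < nm (x + m%:~R) / (`|m|.+1)%:R.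
  move=> m _; rewrite divr_gt0 ?ltr0n // nm_gt0; apply/eqP => h; apply: hx.
  exists (- m); apply/eqP; rewrite -subr_eq0 mulrNz opprK; exact/eqP.
have hall (m : int) : Num.min c (1/2) * (`|m|.+1)%:R <= nm (x + m%:~R).
  have [mN|mN] := leqP `|m|%N N.
    apply: (@le_trans _ _ (c * (`|m|.+1)%:R)).
      by rewrite ler_wpM2r // ge_min lexx.
    rewrite -ler_pdivlMr ?ltr0n //; apply: hc; apply/mapP.
    by exists (absz (m + N%:Z)%R); [rewrite mem_iota; lia|lia].
  apply: le_trans (int_ge_abs x m).
  apply: (@le_trans _ _ (1 / 2 * (`|m|.+1)%:R)).
    by rewrite ler_wpM2r // ge_min lexx orbT.
  have : (N%:R : R) <= (`|m|%N)%:R by rewrite ler_nat ltnW.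
  by rewrite -[(`|m|%N.+1)%:R]natr1; lra.
pose c' := Num.min c (1/2).
have c'0 : 0 < c' by rewrite lt_min c0 divr_gt0.
exists (c' / 2); first by rewrite divr_gt0.
move=> h m hh; have := hall m; rewrite -/c' => H.
have := nm_ge (x + m%:~R) h; rewrite addrAC.
have : 1 <= (`|m|.+1)%:R :> R by rewrite ler1n.
nra.
Qed.

Lemma row_bound (c : R) x (m : int) : 0 < c -> c * (`|m|.+1)%:R <= nm (x + m%:~R) ->
  nm ((x + m%:~R) ^+ 2)^-1 <= (c ^+ 2)^-1 * invsq `|m|%N.
Proof.
move=> c0 h; rewrite nmV nmX /invsq -invfM -exprMn lef_pV2 ?posrE; last 2 first.
- by rewrite exprn_gt0 // (lt_le_trans _ h) // mulr_gt0 ?ltr0n.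
- by rewrite exprn_gt0 // mulr_gt0 ?ltr0n.
by rewrite lerXn2r ?nnegrE ?nm_ge0 // mulr_ge0 ?ltW.
Qed.

Lemma row_summ x : ~ isint x -> summ (fun m : int => ((x + m%:~R) ^+ 2)^-1).
Proof.
move=> /row_lower[c c0 hc]; apply: (@summ_invsq _ _ (c ^+ 2)^-1) => m.
by apply: row_bound => //; have := hc 0 m; rewrite nm0 addr0; exact.
Qed.

Lemma isintD x (n : int) : isint (x + n%:~R) <-> isint x.
Proof.
split=> [[k hk]|[k ->]]; last by exists (k + n); rewrite intrD.
by exists (k - n); rewrite intrB -hk addrK.
Qed.

Lemma isint_half x : isint (x / 2) -> isint x.
Proof.
by move=> [k hk]; exists (k * 2); rewrite intrM -hk divfK ?pnatr_eq0.
Qed.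

Lemma isint_half1 x : isint ((x + 1) / 2) -> isint x.
Proof. by move=> /isint_half; rewrite -[1]/(1%:~R) => /isintD. Qed.

(** [xget] makes the sum a total function, used through [T2P] away from the integers. [Q1], [Ser]
    and [Eis1] follow the same pattern. *)
Definition T2 x : C := xget 0 (has_sum (fun m : int => ((x + m%:~R) ^+ 2)^-1)).

Lemma T2P x : ~ isint x -> has_sum (fun m : int => ((x + m%:~R) ^+ 2)^-1) (T2 x).
Proof. by move=> /row_summ/summ_has_sum[l hl]; exact: (xgetI 0 hl). Qed.

Lemma T2Dint x (n : int) : ~ isint x -> T2 (x + n%:~R) = T2 x.
Proof.
move=> hx; have hx' : ~ isint (x + n%:~R) by rewrite isintD.
apply: has_sum_unique (T2P hx') _.
have := @has_sum_bij _ _ _ _ (fun m => m + n) (fun m => m - n) _ (addrK n) (subrK n)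
  (T2P hx).
by apply: eq_has_sum => m /=; rewrite intrD [m%:~R + _]addrC addrA.
Qed.

Lemma T2_double x : ~ isint x -> T2 (x / 2) + T2 ((x + 1) / 2) = 4 * T2 x.
Proof.
move=> hx.
have h1 := T2P (fun h => hx (isint_half h)).
have h2 := T2P (fun h => hx (isint_half1 h)).
have two0 : 2 != 0 :> C by rewrite pnatr_eq0.
have e1 : has_sum (fun m : int => ((x + (m * 2)%:~R) ^+ 2)^-1) (4^-1 * T2 (x / 2)).
  apply: eq_has_sum (has_sumZ _ h1) => m.
  have -> : x + (m * 2)%:~R = 2 * (x / 2 + m%:~R).
    by rewrite intrM -[(2 : int)%:~R]/(2 : C); field.
  rewrite exprMn [RHS]invfM; congr (_^-1 * _); ring.
have e2 : has_sum (fun m : int => ((x + (m * 2 + 1)%:~R) ^+ 2)^-1)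
     (4^-1 * T2 ((x + 1) / 2)).
  apply: eq_has_sum (has_sumZ _ h2) => m.
  have -> : x + (m * 2 + 1)%:~R = 2 * ((x + 1) / 2 + m%:~R).
    by rewrite intrD intrM -[(2 : int)%:~R]/(2 : C) -[1%:~R]/(1 : C); field.
  rewrite exprMn [RHS]invfM; congr (_^-1 * _); ring.
have := has_sum_unique (has_sum_parity (row_summ hx) e1 e2) (T2P hx).
by move=> <-; field.
Qed.

(** For m != 0, |x + m| >= |m| - 1/2 >= (|m| + 1) / 4. This gives the majorant 16 [invsq], of total
    mass at most 16 * 4 = 64. *)
Lemma T2_near x : ~ isint x -> `|complex.Re x| <= 1 / 2 ->
  nm (T2 x - (x ^+ 2)^-1) <= 64.
Proof.
move=> hx hr.
have h0 : has_sum (fun m : int => if m == 0 then (x ^+ 2)^-1 else 0) (x ^+ 2)^-1.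
  by apply: (@has_sum1 _ _ (fun m : int => if m == 0 then (x ^+ 2)^-1 else 0) 0) => j /negPf ->.
have := has_sumB (T2P hx) h0 => /has_sum_le; apply => T.
apply: (@le_trans _ _ (\sum_(m <- T) 16 * invsq `|m|%N)); last first.
  by rewrite -mulr_sumr; have := @invsq_sum R T; lra.
apply: ler_sum => m _; case: eqVneq => [->|m0].
  by rewrite addr0 subrr nm0 mulr_ge0 // ltW ?invsq_gt0.
rewrite subr0; have -> : (16 : R) = ((4^-1) ^+ 2)^-1 by field.
apply: row_bound; first by rewrite invr_gt0.
apply: le_trans (Re_nm _); rewrite ReD Re_int.
have : `|m%:~R : R| - `|complex.Re x| <= `|complex.Re x + m%:~R|.
  by rewrite lerBlDr -{1}[m%:~R](addKr (complex.Re x)) addrC (le_trans (ler_normD _ _)) // normrN.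
have -> : `|m%:~R : R| = (absz m)%:R by rewrite -intr_norm.
have : (1 : R) <= (absz m)%:R by rewrite ler1n absz_gt0.
rewrite -[(`|m|%N.+1)%:R]natr1; lra.
Qed.

(** [f1], [f2], [f3] vanish at 0 and each is a primitive of the previous function, starting from
    exp. Every use of [cderiv_lip] costs a factor 2, and e bounds exp on the unit disc; hence K = 8
    e. *)
Lemma exp_taylor : exists2 K : R, 1 <= K & forall y : C, nm y <= 1 ->
  nm (cexp y - 1 - y) <= K * nm y ^+ 2 /\
  nm (cexp y - 1 - y - y ^+ 2 / 2) <= K * nm y ^+ 3.
Proof.
pose B := expR 1 : R.
have B1 : 1 <= B by have := expR_ge1Dx (1 : R); rewrite -/B; lra.
have hB (y : C) : nm y <= 1 -> nm (cexp y) <= B.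
  move=> hy; rewrite nm_cexp ler_expR; apply: le_trans (ler_norm _) _.
  exact: le_trans (Re_nm y) hy.
have step (f df : C -> C) (K : R) (y : C) : f 0 = 0 -> (forall y, cderiv f y (df y)) ->
    (forall t : R, 0 <= t <= 1 -> nm (df (t%:C * y)) <= K) -> nm (f y) <= 2 * K * nm y.
  move=> f0 hf hK; have := @cderiv_lip _ f df K 0 y.
  rewrite f0 subr0 add0r; apply=> t t01; last by rewrite add0r; exact: hK.
  exact: hf.
have ty (t : R) (y : C) : 0 <= t <= 1 -> nm (t%:C * y) <= nm y.
  by move=> /andP[t0 t1]; rewrite nmM nm_real ger0_norm // ler_piMl ?nm_ge0.
pose f1 (y : C) := cexp y - 1.
pose f2 (y : C) := cexp y - 1 - y.
pose f3 (y : C) := cexp y - 1 - y - y ^+ 2 / 2.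
have d1 y : cderiv f1 y (cexp y).
  by have := cderivD (cexp_deriv y) (cderiv_cst (- 1) y); rewrite addr0.
have d2 y : cderiv f2 y (f1 y).
  have := cderivD (d1 y) (cderivM (cderiv_cst (- 1) y) (cderiv_id y)).
  rewrite mul0r add0r mulr1; apply: (@cderiv_near _ _ _ _ _ 1) => // h _.
  by rewrite mulN1r.
have d3 y : cderiv f3 y (f2 y).
  have := cderivD (d2 y) (cderivM (cderiv_cst (- 2^-1) y)
    (cderivM (cderiv_id y) (cderiv_id y))).
  have -> : f1 y + (0 * (y * y) + - 2^-1 * (1 * y + y * 1)) = f2 y.
    by rewrite /f2 /f1; field.
  by apply: (@cderiv_near _ _ _ _ _ 1) => // h _ /=; rewrite /f3 /f2; field.
have z1 : f1 0 = 0 by rewrite /f1 cexp0 subrr.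
have z2 : f2 0 = 0 by rewrite /f2 cexp0 !subrr.
have z3 : f3 0 = 0 by rewrite /f3 cexp0 !subrr expr0n mul0r subrr.
have b1 y : nm y <= 1 -> nm (f1 y) <= 2 * B * nm y.
  move=> y1; apply: (step _ _ _ _ z1 d1) => t t01.
  by apply: hB; apply: le_trans (ty _ _ t01) y1.
have b2 y : nm y <= 1 -> nm (f2 y) <= 2 * (2 * B * nm y) * nm y.
  move=> y1; apply: (step _ _ _ _ z2 d2) => t t01.
  apply: le_trans (b1 _ (le_trans (ty _ _ t01) y1)) _.
  by rewrite ler_wpM2l ?ty // mulr_ge0 // (le_trans _ B1).
have b3 y : nm y <= 1 -> nm (f3 y) <= 2 * (2 * (2 * B * nm y) * nm y) * nm y.
  move=> y1; apply: (step _ _ _ _ z3 d3) => t t01.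
  apply: le_trans (b2 _ (le_trans (ty _ _ t01) y1)) _.
  have := ty t y t01; have := nm_ge0 (t%:C * y); move: (nm _) (nm y) => a b a0 ab.
  rewrite -!mulrA !(ler_wpM2l, ler_pM) // ?mulr_ge0 // (le_trans _ B1) //.
exists (8 * B) => [|y y1]; first lra.
split.
  apply: le_trans (b2 y y1) _; have := sqr_ge0 (nm y); nra.
apply: le_trans (b3 y y1) _; rewrite le_eqVlt; apply/orP; left; apply/eqP.
by rewrite exprS expr2; ring.
Qed.

End RowSums.

(** * Herglotz's argument: the row sum equals pi^2 / sin^2, and zeta(2) *)

Section Herglotz.
Context {R : realType}.
Local Notation C := R[i].
Implicit Types x y : C.

Lemma sqr_nm (z : C) : nm z ^+ 2 = complex.Re z ^+ 2 + complex.Im z ^+ 2.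
Proof. by case: z => a b; rewrite /nm /= sqr_sqrtr // addr_ge0 ?sqr_ge0. Qed.

(** With y = a + i b and t = e^a, |e^y - 1|^2 = (t - 1)^2 + 2 t (1 - cos b). One of |a|, |b| is at
    least d / 2: in the first case (t - 1)^2 = t (u - 1/u)^2 with u = e^(a/2) yields [M2], in the
    second the cosine yields [M1]. *)
Lemma ratio_far (d : R) : 0 < d -> d <= 1 -> exists2 M : R, 0 < M &
  forall y : C, d <= nm y -> `|complex.Im y| <= pi ->
  nm (cexp y) <= M * nm (cexp y - 1) ^+ 2.
Proof.
move=> d0 d1; pose k := cos (d / 2).
have k1 : k < 1.
  have p2 := pi_ge2 R.
  by rewrite -(@cos0 R) /k ltr_cos ?in_itv /=; try (apply/andP; split); lra.
pose M1 := (2 * (1 - k))^-1; pose M2 := 16 / d ^+ 2.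
have M10 : 0 < M1 by rewrite invr_gt0 mulr_gt0 // subr_gt0.
have M20 : 0 < M2 by rewrite divr_gt0 // exprn_gt0.
exists (M1 + M2); first exact: addr_gt0.
move=> [a b] hy hb; rewrite /= in hb.
have : d / 2 <= `|a| \/ d / 2 <= `|b|.
  have : nm (a +i* b) <= `|a| + `|b| := nm_ReIm _.
  by have [h|h] := lerP (d / 2) `|a|; [left|right; lra].
rewrite nm_cexp sqr_nm /cexp /=; set t := expR a.
have t0 : 0 < t by exact: expR_gt0.
have cs := cos2Dsin2 b.
have -> : (t * cos b - 0 * sin b - 1) ^+ 2 + (t * sin b + 0 * cos b - 0) ^+ 2 =
    (t - 1) ^+ 2 + 2 * t * (1 - cos b).
  have -> : (t * cos b - 0 * sin b - 1) ^+ 2 + (t * sin b + 0 * cos b - 0) ^+ 2 =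
    t ^+ 2 * (cos b ^+ 2 + sin b ^+ 2) + 1 - 2 * t * cos b by ring.
  by rewrite cs; ring.
have c1 := cos_le1 b.
set A := (t - 1) ^+ 2; set B := 2 * t * (1 - cos b).
have A0 : 0 <= A by exact: sqr_ge0.
have B0 : 0 <= B by rewrite !mulr_ge0 ?subr_ge0 // ltW.
have fin (M M' : R) (X Y : R) : 0 < M -> 0 < M' -> 0 <= X -> 0 <= Y -> t <= M * X ->
    t <= (M + M') * (X + Y).
  move=> M0 M'0 X0 Y0 h; apply: le_trans h _.
  apply: le_trans (_ : (M + M') * X <= _).
    by rewrite ler_wpM2r // lerDl ltW.
  by rewrite ler_wpM2l ?lerDl // addr_ge0 // ltW.
case=> [ha|hb'].
  rewrite [M1 + M2]addrC; apply: fin => //.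
  rewrite /M2 mulrAC ler_pdivlMr ?exprn_gt0 //.
  pose u := expR (a / 2).
  have u0 : 0 < u by exact: expR_gt0.
  have tu : t = u ^+ 2 by rewrite /t /u -expRM_natl mulrC divfK ?pnatr_eq0.
  have h1 : 1 + a / 2 <= u by exact: expR_ge1Dx.
  have h2 : 1 - a / 2 <= u^-1 by rewrite /u -expRN expR_ge1Dx.
  have : (d / 2) ^+ 2 <= a ^+ 2.
    by rewrite -(real_normK (num_real a)) lerXn2r ?nnegrE // ltW // divr_gt0.
  have uv : u * u^-1 = 1 by rewrite divff // gt_eqF.
  have v0 : 0 < u^-1 by rewrite invr_gt0.
  have : (a / 2) ^+ 2 <= (u - u^-1) ^+ 2.
    have [a0|a0] := lerP 0 a.
      have : u^-1 <= 1 by rewrite invf_le1 //; lra.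
      by move=> ?; rewrite lerXn2r ?nnegrE; lra.
    have : u <= 1 by rewrite -(@expR0 R) /u ler_expR; lra.
    move=> ?; rewrite -[(a / 2) ^+ 2]sqrrN -[(u - _) ^+ 2]sqrrN.
    by rewrite lerXn2r ?nnegrE; lra.
  have -> : A = t * (u - u^-1) ^+ 2.
    rewrite /A tu; have -> : u^-1 = (u * u^-1) * u^-1 by rewrite uv mul1r.
    by field; rewrite gt_eqF.
  move=> h3 h4; rewrite [leRHS]mulrCA ler_pM2l //.
  have -> : d ^+ 2 = 4 * (d / 2) ^+ 2 by field.
  have e : a ^+ 2 = 4 * (a / 2) ^+ 2 by field.
  lra.
rewrite [A + B]addrC; apply: fin => //.
rewrite /M1 mulrC ler_pdivlMr ?mulr_gt0 ?subr_gt0 //.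
have -> : B = t * (2 * (1 - cos b)) by rewrite /B; ring.
rewrite ler_pM2l // ler_pM2l // lerD2l lerN2 /k -(cos_norm b).
have p2 := pi_ge2 R.
have [e|ne] := eqVneq (d / 2) `|b|; first by rewrite e.
apply: ltW; rewrite ltr_cos ?in_itv /=; try (apply/andP; split) => //; try lra.
Qed.

(** In y = 2 pi i x the difference is a multiple of e^y / (e^y - 1)^2 - 1 / y^2 on the strip |Im y|
    <= pi. Close to 0 the poles cancel by [exp_taylor]; elsewhere both terms are bounded. *)
Lemma ss_near : exists M : R, forall x, ~ isint x -> `|complex.Re x| <= 1 / 2 ->
  nm (ss x - (x ^+ 2)^-1) <= M.
Proof.
have [K K1 hK] := @exp_taylor R.
pose d := (2 * K)^-1.
have K0 : 0 < K by lra.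
have d0 : 0 < d by rewrite invr_gt0 mulr_gt0.
have dK : K * d = 1 / 2 by rewrite /d; field; rewrite gt_eqF.
have d1 : d <= 1 by nra.
have [M M0 hM] := ratio_far d0 d1.
exists (4 * pi ^+ 2 * (1 + 8 * K + 4 * K ^+ 2 + M + (d ^+ 2)^-1)).
move=> x hx hr.
have v1 := vv_neq1 hx.
have x0 : x != 0 by apply/eqP => x0; apply: hx; exists 0.
pose y : C := 2 * 'i * piC * x.
have y0 : y != 0.
  by rewrite !mulf_neq0 ?pnatr_eq0 ?iC_neq0 //; exact: piC_neq0.
have -> : ss x - (x ^+ 2)^-1 = - 4 * piC ^+ 2 * (cexp y / (cexp y - 1) ^+ 2 - (y ^+ 2)^-1).
  rewrite ssE // -[cexp y]/(vv x) /y !exprMn sqr_i.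
  have := @piC_neq0 R; move: (@piC R) (vv x) v1 => p v v1 p0.
  by field; rewrite p0 x0 subr_eq0 v1.
have -> : 4 * pi ^+ 2 = nm (- 4 * piC ^+ 2 : C).
  by rewrite nmM nmN nm_nat nmX nm_real ger0_norm ?pi_ge0.
have hIm : `|complex.Im y| <= pi.
  rewrite Im_2pii normrM ger0_norm ?mulr_ge0 ?pi_ge0 //.
  have := pi_gt0 R; nra.
rewrite nmM ler_wpM2l ?nm_ge0 //.
have vne : cexp y - 1 != 0 by rewrite subr_eq0.
clearbody y d.
have yn : 0 < nm y by rewrite nm_gt0.
have [hd|hd] := lerP (nm y) d.
  have [t1 t2] := hK y (le_trans hd d1).
  set r := cexp y - 1 - y - y ^+ 2 / 2 in t2.
  have lowE : nm y / 2 <= nm (cexp y - 1).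
    have := nm_ge y (cexp y - 1 - y); rewrite [y + _]addrC subrK.
    have : K * nm y ^+ 2 <= nm y / 2.
      rewrite expr2 mulrA -[nm y / 2]mulrC ler_pM2r //.
      by rewrite -[2^-1]mul1r -dK ler_pM2l.
    lra.
  (* With e^y - 1 = y + y^2 / 2 + r, the terms of order 2 and 3 cancel in the numerator y^2 e^y -
     (e^y - 1)^2. *)
  have -> : cexp y / (cexp y - 1) ^+ 2 - (y ^+ 2)^-1 =
      (y ^+ 4 / 4 - 2 * y * r - r ^+ 2) / ((cexp y - 1) ^+ 2 * y ^+ 2).
    by rewrite /r; field; rewrite y0 vne.
  rewrite nmM nmV ler_pdivrMr; last by rewrite nm_gt0 mulf_neq0 ?expf_neq0.
  rewrite nmM !nmX.
  have num : nm (y ^+ 4 / 4 - 2 * y * r - r ^+ 2) <= (1 / 4 + 2 * K + K ^+ 2) * nm y ^+ 4.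
    apply: le_trans (nmB _ _) _; apply: le_trans (lerD (nmB _ _) (lexx _)) _.
    have -> : nm (y ^+ 4 / 4) = nm y ^+ 4 / 4 by rewrite nmM nmV nm_nat nmX.
    have -> : nm (2 * y * r) = 2 * (nm y * nm r) by rewrite !nmM nm_nat mulrA.
    rewrite nmX.
    have s : nm r ^+ 2 <= K ^+ 2 * nm y ^+ 4.
      apply: le_trans (_ : (K * nm y ^+ 3) ^+ 2 <= _).
        by rewrite lerXn2r ?nnegrE ?nm_ge0 // mulr_ge0 ?exprn_ge0 ?ltW.
      rewrite exprMn -exprM ler_wpM2l ?sqr_ge0 //.
      by rewrite ler_wiXn2l ?nm_ge0 // (le_trans hd d1).
    have s' : nm y * nm r <= K * nm y ^+ 4.
      by rewrite exprS mulrCA ler_wpM2l ?nm_ge0.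
    lra.
  have den : nm y ^+ 4 / 4 <= nm (cexp y - 1) ^+ 2 * nm y ^+ 2.
    have -> : nm y ^+ 4 / 4 = (nm y / 2) ^+ 2 * nm y ^+ 2 by field.
    by rewrite ler_wpM2r ?sqr_ge0 // lerXn2r ?nnegrE ?nm_ge0 // divr_ge0 ?nm_ge0.
  apply: le_trans num _.
  apply: le_trans (_ : (1 + 8 * K + 4 * K ^+ 2) * (nm y ^+ 4 / 4) <= _).
    by rewrite le_eqVlt; apply/orP; left; apply/eqP; field.
  apply: ler_pM => //; first by have := sqr_ge0 K; lra.
  - by rewrite divr_ge0 // exprn_ge0 // nm_ge0.
  - have : 0 <= (d ^+ 2)^-1 by rewrite invr_ge0 sqr_ge0.
    lra.
have h1 : nm (cexp y / (cexp y - 1) ^+ 2) <= M.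
  by rewrite nmM nmV nmX ler_pdivrMr ?exprn_gt0 ?nm_gt0 //; apply: hM => //; exact: ltW.
have h2 : nm (y ^+ 2)^-1 <= (d ^+ 2)^-1.
  rewrite nmV nmX lef_pV2 ?posrE ?exprn_gt0 //.
  by rewrite lerXn2r ?nnegrE ?nm_ge0 ?ltW.
apply: le_trans (nmB _ _) _; have := sqr_ge0 K; lra.
Qed.

(* The difference g of the two sides satisfies 4 g(x) = g(x/2) + g((x+1)/2), and
   is bounded, hence it vanishes. *)
Lemma T2E x : ~ isint x -> T2 x = ss x.
Proof.
move=> hx; pose g y := ss y - T2 y.
have [M hM] := ss_near.
have hg y : ~ isint y -> nm (g y) <= M + 64.
  move=> hy; pose n := Num.floor (complex.Re y + 1 / 2).
  pose w := y + (- n)%:~R.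
  have hw : ~ isint w by rewrite isintD.
  have -> : g y = g w by rewrite /g ssDint T2Dint.
  have rw : `|complex.Re w| <= 1 / 2.
    rewrite /w ReD Re_int mulrNz ler_norml.
    have := floor_itv (complex.Re y + 1 / 2); rewrite -/n intrD => /andP[].
    by rewrite -[1%:~R]/(1 : R) => ? ?; apply/andP; split; lra.
  have -> : g w = (ss w - (w ^+ 2)^-1) - (T2 w - (w ^+ 2)^-1) by rewrite /g; ring.
  by apply: le_trans (nmB _ _) _; apply: lerD; [exact: hM|exact: T2_near].
have step B : (forall y, ~ isint y -> nm (g y) <= B) ->
    forall y, ~ isint y -> nm (g y) <= B / 2.
  move=> hB y hy.
  have e : 4 * g y = g (y / 2) + g ((y + 1) / 2).
    by rewrite /g mulrBr -T2_double // -ss_double ?vv_neq1 //; ring.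
  have := nmD (g (y / 2)) (g ((y + 1) / 2)); rewrite -e nmM nm_nat.
  have := hB _ (fun h => hy (isint_half h)).
  have := hB _ (fun h => hy (isint_half1 h)).
  lra.
have iterb k : forall y, ~ isint y -> nm (g y) <= (M + 64) / 2 ^+ k.
  elim: k => [|k IH]; first by rewrite expr0 divr1.
  by rewrite exprSr invfM mulrA; exact: step.
apply/esym/eqP; rewrite -subr_eq0 -/(g x); apply/eqP/nm_eps0 => e e0.
pose k := (Num.truncn ((M + 64) / e)).+1.
apply: le_trans (iterb k x hx) _.
rewrite ler_pdivrMr ?exprn_gt0 // mulrC -ler_pdivrMr //.
apply: ltW; apply: lt_le_trans (truncnS_gt _) _.
by rewrite -natrX ler_nat ltnW // ltn_expl.
Qed.

Lemma row2 x : ~ isint x -> has_sum (fun m : int => ((x + m%:~R) ^+ 2)^-1) (ss x).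
Proof. by move=> hx; rewrite -T2E //; exact: T2P. Qed.

(** By [row2] at 1/2 the odd terms give pi^2 / 4, and the even ones a quarter of the whole. The term
    [m = 0] is 0 since [0^-1 = 0]. *)
Lemma zeta2 : has_sum (fun m : int => ((m%:~R : C) ^+ 2)^-1) (piC ^+ 2 / 3).
Proof.
have hs : summ (fun m : int => ((m%:~R : C) ^+ 2)^-1).
  apply: (@summ_invsq _ _ 4) => m.
  rewrite nmV nmX nm_int.
  have [->|m0] := eqVneq m 0.
    by rewrite normr0 expr0n invr0 mulr_ge0 // ltW ?invsq_gt0.
  have -> : `|m%:~R : R| = (absz m)%:R by rewrite -intr_norm.
  have a1 : (1 : R) <= (absz m)%:R by rewrite ler1n absz_gt0.
  rewrite /invsq -[(`|m|%N.+1)%:R]natr1; move: ((absz m)%:R : R) a1 => a a1.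
  have -> : (4 : R) = (2 ^-1 ^+ 2)^-1 by field.
  rewrite -invfM -exprMn lef_pV2 ?posrE ?exprn_gt0 //; try lra.
  by rewrite lerXn2r ?nnegrE; lra.
have [Z hZ] := summ_has_sum hs.
have nh : ~ isint (2^-1 : C).
  by move=> /vv_eq1; rewrite vv_half => /eqP; rewrite eq_sym -subr_eq0 opprK -mulr2n pnatr_eq0.
have h2 := row2 nh.
have sh : ss (2^-1 : C) = piC ^+ 2.
  by rewrite /ss /cc vv_half addNr mulr0 mul0r expr0n add0r.
rewrite sh in h2.
have e1 : has_sum (fun m : int => (((m * 2)%:~R : C) ^+ 2)^-1) (4^-1 * Z).
  apply: eq_has_sum (has_sumZ _ hZ) => m.
  by rewrite intrM exprMn [RHS]invfM mulrC; congr (_ * _^-1); ring.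
have e2 : has_sum (fun m : int => (((m * 2 + 1)%:~R : C) ^+ 2)^-1) (4^-1 * piC ^+ 2).
  apply: eq_has_sum (has_sumZ _ h2) => m.
  have -> : (m * 2 + 1)%:~R = 2 * (2^-1 + m%:~R) :> C.
    by rewrite intrD intrM -[(2 : int)%:~R]/(2 : C) -[1%:~R]/(1 : C); field.
  by rewrite exprMn [RHS]invfM; congr (_^-1 * _); ring.
have := has_sum_unique (has_sum_parity hs e1 e2) hZ => e.
have -> : piC ^+ 2 / 3 = Z :> C; last by [].
have -> : piC ^+ 2 = 4 * Z - Z :> C by rewrite -{1}e; field.
by field.
Qed.

End Herglotz.

(** * Partial fractions of the cotangent *)

Section Cotangent.
Context {R : realType}.
Local Notation C := R[i].
Implicit Types x y : C.

(** Subtracting 1/m restores absolute convergence; at [m = 0] nothing is subtracted, as [0^-1 = 0].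
    Symmetric summation removes the correction in [row1_lim]. *)
Lemma row1_summ x : ~ isint x -> summ (fun m : int => (x + m%:~R)^-1 - (m%:~R)^-1).
Proof.
move=> hx; have [c c0 hc] := row_lower hx.
apply: (@summ_invsq _ _ (2 * nm x / c + nm x^-1)) => m.
have {}hc : c * (`|m|.+1)%:R <= nm (x + m%:~R).
  by have := hc 0 m; rewrite nm0 addr0; exact.
have [->|m0] := eqVneq m 0.
  rewrite addr0 invr0 subr0 /invsq expr1n invr1 mulr1 lerDr.
  by rewrite !mulr_ge0 ?nm_ge0 // invr_ge0 ltW.
have xm0 : x + m%:~R != 0.
  by rewrite -nm_gt0 (lt_le_trans _ hc) // mulr_gt0 ?ltr0n.
have mC0 : m%:~R != 0 :> C by rewrite intr_eq0.
have -> : (x + m%:~R)^-1 - (m%:~R)^-1 = - x * (x + m%:~R)^-1 * (m%:~R)^-1.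
  by field; rewrite mC0 xm0.
apply: (@le_trans _ _ (2 * nm x / c * invsq `|m|%N)); last first.
  by rewrite ler_wpM2r ?lerDl ?nm_ge0 // ltW ?invsq_gt0.
rewrite !nmM nmN !nmV nm_int.
have -> : `|m%:~R : R| = (absz m)%:R by rewrite -intr_norm.
have a1 : (1 : R) <= (absz m)%:R by rewrite ler1n absz_gt0.
have -> : 2 * nm x / c * invsq `|m| =
   nm x * (c * (`|m|.+1)%:R)^-1 * (2^-1 * (`|m|.+1)%:R)^-1.
  have : (`|m|.+1)%:R != 0 :> R by rewrite pnatr_eq0.
  rewrite /invsq; move: ((`|m|.+1)%:R : R) => n n0.
  by field; rewrite n0 gt_eqF.
apply: ler_pM; rewrite ?mulr_ge0 ?invr_ge0 ?nm_ge0 //.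
  by rewrite ler_wpM2l ?nm_ge0 // lef_pV2 ?posrE ?mulr_gt0 ?ltr0n ?nm_gt0.
rewrite lef_pV2 ?posrE ?mulr_gt0 ?ltr0n ?absz_gt0 ?invr_gt0 //.
by rewrite -[(`|m|%N.+1)%:R]natr1; lra.
Qed.

Definition Q1 x : C :=
  xget 0 (has_sum (fun m : int => (x + m%:~R)^-1 - (m%:~R)^-1)).

Lemma Q1P x : ~ isint x ->
  has_sum (fun m : int => (x + m%:~R)^-1 - (m%:~R)^-1) (Q1 x).
Proof. by move=> /row1_summ/summ_has_sum[l hl]; exact: (xgetI 0 hl). Qed.

Lemma Q1N x : ~ isint x -> Q1 (- x) = - Q1 x.
Proof.
move=> hx; have hx' : ~ isint (- x).
  by move=> [k hk]; apply: hx; exists (- k); rewrite mulrNz -hk opprK.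
apply: has_sum_unique (Q1P hx') _.
have := has_sum_bij (@opprK int) (@opprK int) (has_sumN (Q1P hx)).
apply: eq_has_sum => m /=.
have -> : - x + m%:~R = - (x + (- m)%:~R) by rewrite mulrNz; ring.
by rewrite [in X in - (_ - X)]mulrNz !invrN; ring.
Qed.

Lemma Q1_deriv x : ~ isint x -> cderiv Q1 x (- ss x).
Proof.
move=> hx; have [c c0 hc] := row_lower hx.
have low h (m : int) : nm h < c -> 0 < nm (x + h + m%:~R).
  by move=> hh; apply: lt_le_trans (hc h m hh); rewrite mulr_gt0 ?ltr0n.
apply: (@cderiv_sum R _ (fun (m : int) y => (y + m%:~R)^-1 - (m%:~R)^-1)
   (fun (m : int) y => - ((y + m%:~R) ^+ 2)^-1) _ _
   (fun m => (c ^+ 2)^-1 * invsq `|m|%N) ((c ^+ 2)^-1 * 4) c) => //.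
- move=> m h hh.
  have n0 : x + h + m%:~R != 0 by rewrite -nm_gt0 low.
  have := cderivD (cderivV (f := fun y => y + m%:~R) n0
     (cderivD (cderiv_id (x + h)) (cderiv_cst m%:~R (x + h))))
     (cderiv_cst (- (m%:~R)^-1) (x + h)).
  by congr cderiv; rewrite !addr0 mulN1r.
- by move=> m h hh; rewrite nmN; apply: row_bound => //; exact: hc.
- by move=> T; rewrite -mulr_sumr ler_wpM2l ?invsq_sum // invr_ge0 sqr_ge0.
- move=> h hh; apply: Q1P => -[k hk].
  by have := low h (- k) hh; rewrite hk mulrNz subrr nm0 ltxx.
- exact: has_sumN (row2 hx).
Qed.

Lemma isint_Im x : complex.Im x != 0 -> ~ isint x.
Proof. by move=> h [k hk]; move: h; rewrite hk Im_int eqxx. Qed.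

(** [D] has derivative 0, so it is constant along segments that avoid the integers. Go from a + i b
    to 1/2 + i b, along the line Re = 1/2 to 1/2 - i b, then to -(a + i b): since [D] is odd, it
    vanishes. A real point is first moved up by i. *)
Lemma Q1E x : ~ isint x -> Q1 x = cc x.
Proof.
pose D y := Q1 y - cc y.
have dD y : ~ isint y -> cderiv D y 0.
  move=> hy; have := cderivD (Q1_deriv hy)
    (cderivM (cderiv_cst (- 1) y) (cc_deriv (vv_neq1 hy))).
  have -> : - ss y + (0 * cc y + -1 * - ss y) = 0 by ring.
  by apply: (@cderiv_near _ _ _ _ _ 1) => // h _; rewrite /D; ring.
have move_ y h : (forall t : R, 0 <= t <= 1 -> ~ isint (y + t%:C * h)) ->
    D (y + h) = D y.
  by move=> hy; apply: cderiv0_eq => t t01; apply: dD; exact: hy.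
have DN y : ~ isint y -> D (- y) = - D y.
  by move=> hy; rewrite /D Q1N // ccN opprB opprK addrC.
have half a : ~ isint (2^-1 +i* a : C).
  move=> /vv_eq1 h; have := congr1 (@complex.Re R) h.
  have e : 2 * pi * 2^-1 = pi :> R by field.
  rewrite /vv /cexp Re_2pii Im_2pii /= e cospi mul0r subr0 => h1.
  have := expR_gt0 (- (2 * pi * a)); lra.
have key y : complex.Im y != 0 -> D y = 0.
  case: y => a b /= b0.
  have e1 : D (2^-1 +i* b) = D (a +i* b).
    have -> : 2^-1 +i* b = a +i* b + (2^-1 - a) +i* 0.
      by simpc; rewrite addrC subrK.
    by apply: move_ => t _; apply: isint_Im; rewrite /= mulr0 mul0r !addr0.
  have e2 : D (2^-1 +i* (- b)) = D (2^-1 +i* b).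
    have -> : 2^-1 +i* (- b) = 2^-1 +i* b + 0 +i* (- 2 * b).
      by simpc; congr (_ +i* _); ring.
    apply: move_ => t _.
    have -> : 2^-1 +i* b + t%:C * (0 +i* (- 2 * b)) = 2^-1 +i* (b + t * (-2 * b)).
      by simpc.
    exact: half.
  have e3 : D (- (a +i* b)) = D (2^-1 +i* (- b)).
    have -> : - (a +i* b) = 2^-1 +i* (- b) + (- a - 2^-1) +i* 0.
      by simpc; congr (_ +i* _); ring.
    apply: move_ => t _; apply: isint_Im.
    by rewrite /= mulr0 mul0r !addr0 oppr_eq0.
  have := DN _ (isint_Im (x := a +i* b) b0); rewrite e3 e2 e1 => /eqP.
  by rewrite -addr_eq0 -mulr2n -mulr_natl mulf_eq0 pnatr_eq0 /= => /eqP.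
move=> hx; apply/eqP; rewrite -subr_eq0 -/(D x); apply/eqP.
have [x0|x0] := eqVneq (complex.Im x) 0; last exact: key.
have <- : D (x + 'i) = D x.
  apply: move_ => t _; have [->|t0] := eqVneq t 0; first by rewrite mul0r addr0.
  by apply: isint_Im; rewrite ImD x0 /= mulr1 mul0r addr0 add0r.
by apply: key; rewrite ImD x0 /= add0r oner_eq0.
Qed.

Lemma row1 x : ~ isint x ->
  has_sum (fun m : int => (x + m%:~R)^-1 - (m%:~R)^-1) (cc x).
Proof. by move=> hx; rewrite -Q1E //; exact: Q1P. Qed.

Lemma row1_lim x : ~ isint x ->
  limn (symmetric_sum (fun m : int => (x + m%:~R)^-1)) = cc x.
Proof.
move=> hx; apply: cvg_lim => //.
have := has_sum_sym (row1 hx).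
suff -> : symmetric_sum (fun m : int => (x + m%:~R)^-1 - (m%:~R)^-1) =
          symmetric_sum (fun m : int => (x + m%:~R)^-1) by [].
apply/funext => N; rewrite [LHS]sumrB -/(symmetric_sum _ N).
rewrite [X in _ - X](@symmetric_sum_odd _ (fun m : int => (m%:~R)^-1)) ?subr0 //.
by move=> m; rewrite mulrNz invrN.
Qed.

End Cotangent.

(** * Sums over the rows of the lattice *)

Section Series.
Context {R : realType}.
Local Notation C := R[i].
Implicit Types (z tau w : C) (P : pred int).

(** With x = r / rho < 1 the powers of x decrease, so k x^k is at most the sum of x^i over i < k,
    hence at most 1 / (1 - x). *)
Lemma geo_step (r : R) : 0 <= r -> r < 1 -> exists B rho : R,
  [/\ 0 <= B, 0 <= rho, rho < 1 & forall k : nat, k%:R * r ^+ k <= B * rho ^+ k].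
Proof.
move=> r0 r1; have [->|rn0] := eqVneq r 0.
  exists 0, 0; split => // k; rewrite mul0r; case: k => [|k]; first by rewrite mul0r.
  by rewrite expr0n mulr0.
pose rho := (1 + r) / 2; pose x := r / rho.
have rp : 0 < r by rewrite lt0r rn0.
have rho0 : 0 < rho by rewrite /rho; lra.
have x0 : 0 <= x by rewrite divr_ge0 // ltW.
have x1 : x < 1 by rewrite ltr_pdivrMr // mul1r /rho; lra.
have h1 : 0 < 1 - x by lra.
exists (1 - x)^-1, rho; split; rewrite ?invr_ge0 ?(ltW h1) ?(ltW rho0) //.
  by rewrite /rho; lra.
move=> k; have -> : r ^+ k = x ^+ k * rho ^+ k.
  by rewrite -exprMn divfK // gt_eqF.
rewrite mulrA ler_wpM2r ?exprn_ge0 ?(ltW rho0) //.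
rewrite -[leRHS]mul1r ler_pdivlMr //.
have e : 1 - x ^+ k = (1 - x) * \sum_(i < k) x ^+ i by rewrite -[LHS]opprB subrX1 -mulNr opprB.
have : k%:R * x ^+ k <= \sum_(i < k) x ^+ i.
  rewrite -[k in k%:R]card_ord -sumr_const mulr_suml; apply: ler_sum => i _.
  by rewrite mul1r ler_wiXn2l ?(ltW x1) // ltnW.
have : 0 <= x ^+ k by rewrite exprn_ge0.
by nra.
Qed.

Lemma geo_nat j (r : R) : 0 <= r -> r < 1 ->
  exists B : R, forall N, \sum_(k < N) k%:R ^+ j * r ^+ k <= B.
Proof.
elim: j r => [|j IH] r r0 r1.
  exists (1 - r)^-1 => N; under eq_bigr do rewrite expr0 mul1r.
  have h1 : 0 < 1 - r by lra.
  have e : 1 - r ^+ N = (1 - r) * \sum_(i < N) r ^+ i by rewrite -[LHS]opprB subrX1 -mulNr opprB.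
  rewrite -[leRHS]mul1r ler_pdivlMr //.
  have : 0 <= r ^+ N by rewrite exprn_ge0.
  by nra.
have [B [rho [B0 rho0 rho1 hB]]] := geo_step r0 r1.
have [B' hB'] := IH rho rho0 rho1.
exists (B * B') => N; apply: le_trans (ler_wpM2l B0 (hB' N)).
rewrite mulr_sumr; apply: ler_sum => k _.
by rewrite exprSr -mulrA [leRHS]mulrCA ler_wpM2l ?exprn_ge0.
Qed.

Lemma geo_int j (r : R) : 0 <= r -> r < 1 -> exists B : R,
  forall T : {fset int}, \sum_(n <- T) (`|n|%N)%:R ^+ j * r ^+ `|n|%N <= B.
Proof.
move=> r0 r1; have [B hB] := geo_nat j r0 r1.
exists (B + B); apply: (@bound_abs R (fun k : nat => k%:R ^+ j * r ^+ k)) => // k.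
by rewrite mulr_ge0 ?exprn_ge0.
Qed.

(** [P] selects the rows to be summed: all of them for functions of (tau, z); those with n != 0,
    taken at z = 0, for functions of tau such as [e2]. *)
Definition good P tau z :=
  upper_half_plane tau /\ forall n, P n -> ~ isint (z + n%:~R * tau).

Definition ipi : C := 'i * piC.

Lemma nm_ipi : nm ipi = pi.
Proof. by rewrite nmM nmi mul1r nm_real ger0_norm ?pi_ge0. Qed.

(** With v = [vv w], cc + i pi = 2 i pi v / (v - 1) and ss = -4 pi^2 v / (v - 1)^2; both are of
    order v as soon as |v - 1| >= 1/2. *)
Lemma small_vv w : nm (vv w) <= 1 / 2 ->
  [/\ vv w != 1, nm (cc w) <= 5 * pi, nm (ss w) <= 16 * pi ^+ 2 * nm (vv w)
    & nm (cc w + ipi) <= 4 * pi * nm (vv w)].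
Proof.
move=> h; have p0 := pi_gt0 R.
have v1 : vv w != 1 by apply/eqP => e; move: h; rewrite e nm1; lra.
have v10 : vv w - 1 != 0 by rewrite subr_eq0.
have low : 1 / 2 <= nm (vv w - 1).
  have := nm_ge 1 (- vv w); rewrite nmN nm1 nm_distC; lra.
have low0 : 0 < nm (vv w - 1) by lra.
have b : nm (cc w + ipi) <= 4 * pi * nm (vv w).
  have -> : cc w + ipi = ipi * (2 * vv w) / (vv w - 1).
    rewrite /cc -/ipi; field; exact: v10.
  rewrite nmM nmV nmM nm_ipi nmM nm_nat ler_pdivrMr //.
  have := mulr_ge0 (ltW p0) (nm_ge0 (vv w)); nra.
split=> //.
- rewrite -[cc w](addrK ipi); apply: le_trans (nmB _ _) _; rewrite nm_ipi.
  by have := nm_ge0 (vv w); nra.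
- rewrite ssE // nmM nmV nmX nmM [nm (_ * piC ^+ 2)]nmM nmN nm_nat nmX nm_real.
  rewrite ger0_norm ?(ltW p0) // ler_pdivrMr ?exprn_gt0 //.
  have : 1 / 4 <= nm (vv w - 1) ^+ 2 by nra.
  have : 0 <= pi ^+ 2 * nm (vv w) by rewrite mulr_ge0 ?sqr_ge0 ?nm_ge0.
  nra.
Qed.

(** Locally uniform geometric decay in the row index. Rows with |n| >= n0 fall under [small_vv],
    those with n < 0 after w is replaced by -w. The finitely many others are bounded by continuity,
    and [K] absorbs r^(-n0). *)
Lemma near_bounds P tau0 z0 : good P tau0 z0 -> exists rho K r : R,
  [/\ 0 < rho, 0 <= r, r < 1 & forall tau z, nm (tau - tau0) < rho ->
    nm (z - z0) < rho -> upper_half_plane tau /\ forall n, P n ->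
    let w := z + n%:~R * tau in
    [/\ vv w != 1, nm (cc w) <= K, nm (ss w) <= K * r ^+ `|n|%N &
        nm (cc w + ipi * (sgz n)%:~R) <= K * r ^+ `|n|%N]].
Proof.
move=> [Im0 hP]; rewrite /upper_half_plane /= in Im0.
have p0 := pi_gt0 R.
(* On the neighbourhood Im tau stays above half of Im tau0; this fixes the ratio [r]. *)
pose y1 := complex.Im tau0 / 2.
have y10 : 0 < y1 by rewrite divr_gt0.
pose Y := `|complex.Im z0| + 1.
pose r := expR (- (2 * pi * y1)).
have r0 : 0 < r by exact: expR_gt0.
have r1 : r < 1.
  by rewrite -(@expR0 R) ltr_expR oppr_lt0 !mulr_gt0.
pose A := expR (2 * pi * Y).
have A0 : 0 < A by exact: expR_gt0.
have [n0 hn0] : exists n0 : nat, forall n, (n0 <= n)%N -> A * r ^+ n <= 1 / 2.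
  have [B hB] := geo_nat 1 (ltW r0) r1.
  have Bn n : n%:R * r ^+ n <= B.
    apply: le_trans (hB n.+1); rewrite big_ord_recr /= expr1 lerDr.
    by apply: sumr_ge0 => i _; rewrite mulr_ge0 ?exprn_ge0 // ltW.
  exists (Num.truncn (2 * A * B)).+1 => n hn.
  have hn' : 2 * A * B < n%:R.
    by apply: lt_le_trans (truncnS_gt _) _; rewrite ler_nat.
  have n0 : (0 : R) < n%:R by rewrite ltr0n (leq_trans _ hn).
  have := Bn n; have := exprn_ge0 n (ltW r0); move: (r ^+ n) => x x0 hx.
  have : 2 * A * (n%:R * x) <= 2 * A * B by rewrite ler_wpM2l // mulr_ge0 // ltW.
  rewrite mulrCA => h.
  have : n%:R * (2 * A * x) <= n%:R * 1 by rewrite mulr1; lra.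
  by rewrite ler_pM2l //; lra.
have [d [K1 [d0 K10 hK1]]] : exists d K1 : R, [/\ 0 < d, 0 <= K1 & forall n : int,
    (`|n| < n0)%N -> P n -> forall h, nm h < d ->
    vv (z0 + n%:~R * tau0 + h) != 1 /\ nm (cc (z0 + n%:~R * tau0 + h)) <= K1].
  have : exists d K1 : R, [/\ 0 < d, 0 <= K1 & forall n : int,
    n \in [seq k%:Z - n0%:Z | k <- iota 0 n0.*2.+1] -> P n -> forall h, nm h < d ->
    vv (z0 + n%:~R * tau0 + h) != 1 /\ nm (cc (z0 + n%:~R * tau0 + h)) <= K1].
    elim: [seq _ | _ <- _] => [|n s [d [K1 [d0 K10 IH]]]]; first by exists 1, 0.
    have [Pn|nPn] := boolP (P n); last first.
      exists d, K1; split => // m; rewrite inE => /orP[/eqP ->|]; last exact: IH.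
      by move=> Pn; rewrite Pn in nPn.
    set w := z0 + n%:~R * tau0.
    have v1 : vv w != 1 by apply: vv_neq1; exact: hP.
    have [da da0 ha] := cderiv_cont (cc_deriv v1) ltr01.
    have e0 : 0 < nm (vv w - 1) / 2 by rewrite divr_gt0 // nm_gt0 subr_eq0.
    have [db db0 hb] := cderiv_cont (vv_deriv w) e0.
    exists (Num.min d (Num.min da db)), (Num.max K1 (nm (cc w) + 1)).
    split; rewrite ?lt_min ?d0 ?da0 ?le_max ?K10 // => m.
    rewrite inE => /orP[/eqP -> _|ms Pm] h; rewrite !lt_min => /and3P[h1 h2 h3].
      rewrite -/w; split.
        apply/eqP => e; have := hb h h3; rewrite e nm_distC.
        by have := nm_ge0 (vv w - 1); lra.
      rewrite le_max; apply/orP; right; have H := ha h h2.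
      rewrite -[cc (w + h)](addrNK (cc w)) addrC.
      by apply: le_trans (nmD _ _) _; rewrite lerD2l.
    have [e1 e2] := IH m ms Pm h h1; split => //.
    by rewrite le_max e2.
  move=> [d [K1 [d0 K10 h]]]; exists d, K1; split => // n nn; apply: h.
  by apply/mapP; exists (absz (n + n0%:Z)%R); [rewrite mem_iota; lia|lia].
(* Dividing by n0 + 1 keeps z + n tau within [d] of z0 + n tau0 for |n| < n0. *)
pose rho := Num.min (Num.min y1 1) (d / (n0.+1)%:R).
have rho0 : 0 < rho by rewrite !lt_min y10 ltr01 divr_gt0 ?ltr0n.
have [K [hK5 hKA hKc hKs hKe]] : exists K : R, [/\ 5 * pi <= K, 16 * pi ^+ 2 * A + 4 * pi * A <= K,
    K1 <= K, K1 ^+ 2 + pi ^+ 2 <= K * r ^+ n0 & K1 + pi <= K * r ^+ n0].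
  have rn : 0 < r ^+ n0 by rewrite exprn_gt0.
  pose K2 := (K1 ^+ 2 + pi ^+ 2) / r ^+ n0; pose K3 := (K1 + pi) / r ^+ n0.
  have K20 : 0 <= K2 by rewrite divr_ge0 ?addr_ge0 ?sqr_ge0 // ltW.
  have K30 : 0 <= K3.
    by apply: divr_ge0; [exact: addr_ge0 K10 (pi_ge0 R)|exact: ltW].
  have K40 : 0 <= 16 * pi ^+ 2 * A + 4 * pi * A.
    by rewrite addr_ge0 // !mulr_ge0 ?sqr_ge0 // ltW.
  exists (5 * pi + (16 * pi ^+ 2 * A + 4 * pi * A) + K1 + K2 + K3).
  split; rewrite -?ler_pdivrMr // -/K2 -/K3; lra.
exists rho, K, r; split; rewrite ?(ltW r0) // => tau z.
rewrite !lt_min -andbA => /and3P[ht1 ht2 ht3] /andP[/andP[hz1 hz2] hz3].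
have Imt : y1 < complex.Im tau.
  have := Im_nm (tau - tau0).
  have -> : complex.Im (tau - tau0) = complex.Im tau - complex.Im tau0.
    by case: (tau) (tau0) => ? ? [].
  have : complex.Im tau0 = 2 * y1 by rewrite /y1; field.
  rewrite ler_norml => -> /andP[]; lra.
have Imz : `|complex.Im z| <= Y.
  have := Im_nm (z - z0).
  have -> : complex.Im (z - z0) = complex.Im z - complex.Im z0.
    by case: (z) (z0) => ? ? [].
  move=> h; rewrite -[complex.Im z](addrNK (complex.Im z0)) addrC.
  by apply: le_trans (ler_normD _ _) _; rewrite lerD2l (le_trans h) // ltW.
split; first exact: lt_trans Imt.
move=> n Pn w.
have K0 : 0 <= K by lra.
have [nn|nn] := ltnP `|n|%N n0.
  have hh : nm (z - z0 + n%:~R * (tau - tau0)) < d.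
    apply: le_lt_trans (nmD _ _) _; rewrite nmM nm_int.
    have -> : `|n%:~R : R| = (absz n)%:R by rewrite -intr_norm.
    set D := d / (n0.+1)%:R in ht3 hz3.
    have -> : d = n0%:R * D + D.
      by rewrite -[D in X in _ + X]mul1r -mulrDl natr1 /D mulrCA divff ?mulr1.
    rewrite addrC; apply: ler_ltD => //.
    apply: ler_pM => //; [exact: nm_ge0|by rewrite ler_nat ltnW|exact: ltW].
  have [e1 e2] := hK1 n nn Pn _ hh.
  have we : z0 + n%:~R * tau0 + (z - z0 + n%:~R * (tau - tau0)) = w.
    by rewrite /w; ring.
  rewrite we in e1 e2.
  have rr : r ^+ n0 <= r ^+ `|n|%N by rewrite ler_wiXn2l ?(ltW r0) ?(ltW r1) // ltnW.
  have hr : K * r ^+ n0 <= K * r ^+ `|n|%N by rewrite ler_wpM2l.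
  split => //; first exact: le_trans e2 hKc.
    apply: le_trans hr; apply: le_trans hKs.
    rewrite /ss; apply: le_trans (nmD _ _) _; rewrite !nmX nm_real.
    by rewrite ger0_norm ?pi_ge0 // lerD2r lerXn2r ?nnegrE ?nm_ge0.
  apply: le_trans hr; apply: le_trans hKe.
  apply: le_trans (nmD _ _) _; apply: lerD => //.
  rewrite nmM nm_ipi nm_int -[leRHS]mulr1 ler_wpM2l ?pi_ge0 //.
  by case: sgzP; rewrite ?normr0 ?normr1 ?mulrN1z ?normrN1 ?mulr1z ?normr1.
have Imw : complex.Im w = complex.Im z + n%:~R * complex.Im tau.
  rewrite /w -(rmorph_int (real_complex R)).
  by case: (z) (tau) => ? ? [? ?] /=; ring.
have vle (e : R) : e * e = 1 -> e * n%:~R = (`|n|%N)%:R -> nm (vv (e%:C * w)) <= A * r ^+ `|n|%N.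
  move=> ee en; rewrite nm_vv /A /r -expRM_natl -expRD ler_expR.
  have -> : complex.Im (e%:C * w) = e * complex.Im w by case: (w) => ? ? /=; ring.
  have -> : e * complex.Im w = e * complex.Im z + (`|n|%N)%:R * complex.Im tau.
    by rewrite Imw mulrDr mulrA en.
  have n0' : 0 <= (`|n|%N)%:R :> R by [].
  have : `|e * complex.Im z| <= Y.
    rewrite normrM; have -> : `|e| = 1; last by rewrite mul1r.
    by apply/eqP; rewrite -(@eqrXn2 _ 2) // expr1n -normrX expr2 ee normr1.
  rewrite ler_norml => /andP[h1 h2].
  have h3 : (`|n|%N)%:R * y1 <= (`|n|%N)%:R * complex.Im tau by rewrite ler_wpM2l // ltW.
  have : 2 * pi * ((`|n|%N)%:R * y1 - Y) <=
      2 * pi * (e * complex.Im z + (`|n|%N)%:R * complex.Im tau).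
    by rewrite ler_wpM2l ?mulr_ge0 ?pi_ge0 //; lra.
  lra.
have Ar : A * r ^+ `|n|%N <= 1 / 2 by exact: hn0.
have Pr : 0 <= r ^+ `|n|%N by rewrite exprn_ge0 // ltW.
have fin (v : R) : v <= A * r ^+ `|n|%N -> 16 * pi ^+ 2 * v <= K * r ^+ `|n| /\
    4 * pi * v <= K * r ^+ `|n|.
  move=> hv; split.
    apply: le_trans (_ : 16 * pi ^+ 2 * (A * r ^+ `|n|) <= _).
      by rewrite ler_wpM2l // mulr_ge0 ?sqr_ge0.
    rewrite mulrA ler_wpM2r //; apply: le_trans hKA.
    by rewrite lerDl !mulr_ge0 // ltW.
  apply: le_trans (_ : 4 * pi * (A * r ^+ `|n|) <= _).
    by rewrite ler_wpM2l // mulr_ge0 ?pi_ge0.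
  rewrite mulrA ler_wpM2r //; apply: le_trans hKA.
  by rewrite lerDr !mulr_ge0 ?sqr_ge0 // ltW.
have [n_ge0|n_lt0] := lerP 0 n.
  have hv : nm (vv w) <= A * r ^+ `|n|%N.
    have := vle 1; rewrite !mul1r; apply=> //.
    by rewrite -{1}[n]gez0_abs.
  have [f1 f2] := fin _ hv.
  have [h1 h2 h3 h4] := small_vv (le_trans hv Ar).
  split=> //; [exact: le_trans h2 hK5|exact: le_trans h3 f1|].
  have [n_0|n_n0] := eqVneq n 0.
    by rewrite n_0 sgz0 mulr0 addr0 expr0 mulr1 (le_trans h2).
  by rewrite gtr0_sgz ?lt0r ?n_n0 // mulr1; exact: le_trans h4 f2.
have hv : nm (vv (- w)) <= A * r ^+ `|n|%N.
  have := vle (- 1); rewrite mulrNN mul1r !mulN1r rmorphN mulN1r; apply=> //.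
  by rewrite -{1}[n]opprK mulrNz opprK -[- n]gez0_abs ?abszN // oppr_ge0 ltW.
have [f1 f2] := fin _ hv.
have [h1 h2 h3 h4] := small_vv (le_trans hv Ar).
rewrite ltr0_sgz //.
have -> : nm (cc w + ipi * (-1)%:~R) = nm (cc (- w) + ipi).
  by rewrite ccN -nmN mulrN1z mulrN1 opprB addrC.
have -> : nm (cc w) = nm (cc (- w)) by rewrite ccN nmN.
rewrite -(ssN w).
split=> //; [|exact: le_trans h2 hK5|exact: le_trans h3 f1|exact: le_trans h4 f2].
by move: h1; rewrite vvN invr_eq1.
Qed.

End Series.

(** * Row sums and their derivatives in z and tau *)

Section TermwiseDerivatives.
Context {R : realType}.
Local Notation C := R[i].
Implicit Types (z tau w : C) (P : pred int) (p : {poly C}).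

Lemma cderiv_horner p (f : C -> C) x d : cderiv f x d ->
  cderiv (fun y => p.[f y]) x (p^`().[f x] * d).
Proof.
move=> hf; elim/poly_ind: p => [|p a IH].
  rewrite deriv0 horner0 mul0r.
  by apply: (@cderiv_near _ _ _ _ _ 1 ltr01 _ (cderiv_cst 0 x)) => h _; rewrite horner0.
have -> : (p * 'X + a%:P)^`().[f x] * d = p^`().[f x] * d * f x + p.[f x] * d + 0.
  by rewrite derivD derivM derivX derivC mulr1 !addr0 !hornerE; ring.
apply: (@cderiv_near _ _ _ _ _ 1 ltr01 _ (cderivD (cderivM IH hf) (cderiv_cst a x))).
by move=> h _; rewrite !hornerE.
Qed.

(* ss p(cc) has derivative ss (cot_deriv p)(cc) *)
Definition cot_deriv p : {poly C} :=
  - (('X^2 + (piC ^+ 2)%:P) * p^`() + 2%:P * 'X * p).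

Lemma cot_derivE p c :
  (cot_deriv p).[c] = - ((c ^+ 2 + piC ^+ 2) * p^`().[c] + 2 * c * p.[c]).
Proof. by rewrite /cot_deriv !hornerE. Qed.

Lemma ss_horner_deriv p x : vv x != 1 ->
  cderiv (fun y => ss y * p.[cc y]) x (ss x * (cot_deriv p).[cc x]).
Proof.
move=> v1; have hc := cc_deriv v1.
have hs := cderivD (cderivM hc hc) (cderiv_cst (piC ^+ 2) x).
have -> : ss x * (cot_deriv p).[cc x] =
    (- ss x * cc x + cc x * - ss x + 0) * p.[cc x] +
    (cc x * cc x + piC ^+ 2) * (p^`().[cc x] * - ss x).
  by rewrite cot_derivE /ss; ring.
apply: (@cderiv_near _ _ _ _ _ 1 ltr01 _ (cderivM hs (cderiv_horner p hc))).
by move=> h _; rewrite /ss expr2.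
Qed.

Lemma horner_bound p (K : R) : exists B : R, 0 <= B /\
  forall c, nm c <= K -> nm p.[c] <= B.
Proof.
elim/poly_ind: p => [|p a [B [B0 hB]]].
  by exists 0; split=> // c _; rewrite horner0 nm0.
exists (B * `|K| + nm a); split; first by rewrite addr_ge0 ?mulr_ge0 ?nm_ge0.
move=> c hc; rewrite !hornerE; apply: le_trans (nmD _ _) _; rewrite lerD2r nmM.
by apply: ler_pM; rewrite ?nm_ge0 ?hB // (le_trans hc) // ler_norm.
Qed.

(** [ss] times a polynomial in [cc], weighted by n^j: a shape stable under differentiation. A
    z-derivative replaces [p] by [cot_deriv p]; a tau-derivative does so too and raises [j] by 1. *)
Definition term P p j tau z (n : int) : C :=
  (P n)%:R * (n%:~R ^+ j * (ss (z + n%:~R * tau) * p.[cc (z + n%:~R * tau)])).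

Definition Ser P p j tau z : C := xget 0 (has_sum (term P p j tau z)).

(** One summable majorant for a whole neighbourhood, as [cderiv_sum] requires. *)
Lemma near_term P p j tau0 z0 : good P tau0 z0 -> exists rho (M : int -> R) (B : R),
  [/\ 0 < rho, forall n, 0 <= M n, forall T : {fset int}, \sum_(n <- T) M n <= B &
    forall tau z, nm (tau - tau0) < rho -> nm (z - z0) < rho ->
      good P tau z /\ forall n, nm (term P p j tau z n) <= M n].
Proof.
move=> hg; have [rho [K [r [rho0 r0 r1 h]]]] := near_bounds hg.
have [D [D0 hD]] := horner_bound p K.
have [B hB] := geo_int j r0 r1.
pose M (n : int) := `|K| * D * ((`|n|%N)%:R ^+ j * r ^+ `|n|%N).
exists rho, M, (`|K| * D * B); split => // [n|T|tau z ht hz].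
- by rewrite /M !mulr_ge0 ?exprn_ge0.
- by rewrite -mulr_sumr ler_wpM2l // mulr_ge0.
have [Im0 hn] := h tau z ht hz; split.
  split=> // n Pn; have [v1 _ _ _] := hn n Pn.
  by move=> /vv_eq1 e; rewrite e eqxx in v1.
move=> n; rewrite /term; case: (boolP (P n)) => Pn; last first.
  by rewrite mul0r nm0 /M !mulr_ge0 ?exprn_ge0.
have [_ hc hs _] := hn n Pn.
rewrite mul1r !nmM nmX nm_int.
have -> : `|n%:~R : R| = (absz n)%:R by rewrite -intr_norm.
rewrite /M [leRHS]mulrCA ler_wpM2l ?exprn_ge0 //.
rewrite [leRHS]mulrAC; apply: ler_pM; rewrite ?nm_ge0 ?hD //.
by apply: le_trans hs _; rewrite ler_wpM2r ?exprn_ge0 // ler_norm.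
Qed.

Lemma Ser_summ P p j tau z : good P tau z -> summ (term P p j tau z).
Proof.
move=> hg; have [rho [M [B [rho0 _ hB h]]]] := near_term p j hg.
have h0 x : nm (x - x : C) < rho by rewrite subrr nm0.
have [_ hM] := h tau z (h0 _) (h0 _).
exact: summ_le hM hB.
Qed.

Lemma SerP P p j tau z : good P tau z -> has_sum (term P p j tau z) (Ser P p j tau z).
Proof. by move=> /(Ser_summ p j)/summ_has_sum[l hl]; exact: (xgetI 0 hl). Qed.

(** On the line in direction (a, b) the point z + n tau moves with speed b + n a, which produces the
    two series; the partial derivatives are the directions (0, 1) and (1, 0). The bounds on [a] and
    [b] keep the line inside the neighbourhood of [near_term]. *)
Lemma line_deriv P tau z (a b : C) (phi : int -> C -> C) (F : C -> C -> C) p j :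
  good P tau z -> nm a <= 1 -> nm b <= 1 ->
  (forall n w, P n -> vv w != 1 ->
     cderiv (phi n) w (n%:~R ^+ j * (ss w * p.[cc w]))) ->
  (forall tau z, good P tau z ->
     has_sum (fun n => (P n)%:R * phi n (z + n%:~R * tau)) (F tau z)) ->
  cderiv (fun x => F (tau + a * x) (z + b * x)) 0
    (b * Ser P p j tau z + a * Ser P p j.+1 tau z).
Proof.
move=> hg a1 b1 hphi hF.
have [rho [M [B [rho0 M0 hB h]]]] := near_term p j hg.
have [rho' [M' [B' [rho0' M0' hB' h']]]] := near_term p j.+1 hg.
pose r := Num.min rho rho'.
have r0 : 0 < r by rewrite lt_min rho0.
have small (x c : C) : nm x < r -> nm c <= 1 -> nm (c * x) < r.
  move=> xr c1; apply: le_lt_trans xr.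
  by rewrite nmM ler_piMl ?nm_ge0.
have near x : nm x < r -> [/\ nm (tau + a * x - tau) < rho, nm (z + b * x - z) < rho,
     nm (tau + a * x - tau) < rho' & nm (z + b * x - z) < rho'].
  move=> xr; rewrite ![_ + _ * x]addrC !addrK.
  have := small _ _ xr a1; have := small _ _ xr b1.
  by rewrite !lt_min => /andP[-> ->] /andP[-> ->].
have key n x : (z + b * x) + n%:~R * (tau + a * x) =
   (z + n%:~R * tau) + (b + n%:~R * a) * x by ring.
apply: (@cderiv_sum R _
   (fun n x => (P n)%:R * phi n ((z + b * x) + n%:~R * (tau + a * x)))
   (fun n x => b * term P p j (tau + a * x) (z + b * x) n
             + a * term P p j.+1 (tau + a * x) (z + b * x) n)
   _ _ (fun n => M n + M' n) (B + B') r) => //.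
- move=> n x xr; rewrite add0r.
  have [h1 h2 _ _] := near x xr; have [[Im0 hw] _] := h _ _ h1 h2.
  rewrite /term; case: (boolP (P n)) => Pn; last first.
    rewrite !mul0r !mulr0 addr0.
    apply: (@cderiv_near _ _ _ _ _ 1 ltr01 _ (cderiv_cst 0 x)) => k _.
    by rewrite mul0r.
  have v1 := vv_neq1 (hw n Pn).
  have := hphi n _ Pn v1; rewrite {1}key => /cderiv_affine.
  move=> hd; rewrite !mul1r.
  have : cderiv (fun x0 => phi n (z + n%:~R * tau + (b + n%:~R * a) * x0)) x
     (b * (n%:~R ^+ j * (ss (z + b * x + n%:~R * (tau + a * x)) *
       p.[cc (z + b * x + n%:~R * (tau + a * x))])) +
      a * (n%:~R ^+ j.+1 * (ss (z + b * x + n%:~R * (tau + a * x)) *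
       p.[cc (z + b * x + n%:~R * (tau + a * x))]))).
    by move: hd; congr cderiv; rewrite exprS; ring.
  by apply: (@cderiv_near _ _ _ _ _ 1 ltr01) => k _; rewrite mul1r key.
- move=> n x xr; rewrite add0r.
  have [h1 h2 h3 h4] := near x xr.
  have [_ /(_ n) k1] := h _ _ h1 h2; have [_ /(_ n) k2] := h' _ _ h3 h4.
  apply: le_trans (nmD _ _) _.
  rewrite [nm (b * _)]nmM [nm (a * _)]nmM; apply: lerD.
    by apply: le_trans k1; rewrite ler_piMl ?nm_ge0.
  by apply: le_trans k2; rewrite ler_piMl ?nm_ge0.
- by move=> T; rewrite big_split; apply: lerD.
- move=> x xr; rewrite add0r; apply: hF.
  by have [h1 h2 _ _] := near x xr; have [] := h _ _ h1 h2.
- rewrite !mulr0 !addr0.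
  by apply: has_sumD; apply: has_sumZ; exact: SerP.
Qed.

Lemma cderiv_shift (f : C -> C) x d : cderiv (fun y => f (x + 1 * y)) 0 d -> cderiv f x d.
Proof.
move=> h e /h[r r0 hr]; exists r => // k /hr.
by rewrite mulr0 addr0 add0r mul1r.
Qed.

Lemma line_deriv_z P tau z phi (F : C -> C -> C) p j :
  good P tau z ->
  (forall n w, P n -> vv w != 1 ->
     cderiv (phi n) w (n%:~R ^+ j * (ss w * p.[cc w]))) ->
  (forall tau z, good P tau z ->
     has_sum (fun n => (P n)%:R * phi n (z + n%:~R * tau)) (F tau z)) ->
  cderiv (F tau) z (Ser P p j tau z).
Proof.
move=> hg h1 h2; apply: cderiv_shift.
have := @line_deriv P tau z 0 1 phi F p j hg _ _ h1 h2.
rewrite nm0 nm1 mul1r mul0r addr0 => /(_ ler01 (lexx _)).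
by apply: (@cderiv_near _ _ _ _ _ 1 ltr01) => k _; rewrite mul0r addr0.
Qed.

Lemma line_deriv_tau P tau z phi (F : C -> C -> C) p j :
  good P tau z ->
  (forall n w, P n -> vv w != 1 ->
     cderiv (phi n) w (n%:~R ^+ j * (ss w * p.[cc w]))) ->
  (forall tau z, good P tau z ->
     has_sum (fun n => (P n)%:R * phi n (z + n%:~R * tau)) (F tau z)) ->
  cderiv (fun t => F t z) tau (Ser P p j.+1 tau z).
Proof.
move=> hg h1 h2; apply: cderiv_shift.
have := @line_deriv P tau z 1 0 phi F p j hg _ _ h1 h2.
rewrite nm0 nm1 mul1r mul0r add0r => /(_ (lexx _) ler01).
by apply: (@cderiv_near _ _ _ _ _ 1 ltr01) => k _; rewrite mul0r addr0.
Qed.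

Lemma ser_phi p j n w : vv w != 1 ->
  cderiv (fun w => n%:~R ^+ j * (ss w * p.[cc w])) w
    (n%:~R ^+ j * (ss w * (cot_deriv p).[cc w])).
Proof.
move=> v1; have := cderivM (cderiv_cst (n%:~R ^+ j) w) (ss_horner_deriv p v1).
by rewrite mul0r add0r.
Qed.

Lemma Ser_dz P p j tau z : good P tau z ->
  cderiv (Ser P p j tau) z (Ser P (cot_deriv p) j tau z).
Proof.
move=> hg; apply: (line_deriv_z hg (phi := fun n w => n%:~R ^+ j * (ss w * p.[cc w]))).
  by move=> n w _; exact: ser_phi.
by move=> t w; exact: SerP.
Qed.

Lemma Ser_dtau P p j tau z : good P tau z ->
  cderiv (fun t => Ser P p j t z) tau (Ser P (cot_deriv p) j.+1 tau z).
Proof.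
move=> hg; apply: (line_deriv_tau hg (phi := fun n w => n%:~R ^+ j * (ss w * p.[cc w]))
   (F := Ser P p j)).
  by move=> n w _; exact: ser_phi.
by move=> t w; exact: SerP.
Qed.

(* The cotangent terms tend to -+ i pi as n -> +-oo; the constants restore
   absolute convergence. *)
Definition eterm tau z (n : int) : C := cc (z + n%:~R * tau) + ipi * (sgz n)%:~R.

Definition Eis1 tau z : C := xget 0 (has_sum (eterm tau z)).

Lemma eterm_summ tau z : good xpredT tau z -> summ (eterm tau z).
Proof.
move=> hg; have [rho [K [r [rho0 r0 r1 h]]]] := near_bounds hg.
have h0 x : nm (x - x : C) < rho by rewrite subrr nm0.
have [_ hM] := h tau z (h0 _) (h0 _).
have [B hB] := geo_int 0 r0 r1.
apply: (@summ_le _ _ _ (fun n => `|K| * r ^+ `|n|%N) (`|K| * B)) => [n|T].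
  have [_ _ _ h4] := hM n isT; apply: le_trans h4 _.
  by rewrite ler_wpM2r ?exprn_ge0 // ler_norm.
rewrite -mulr_sumr ler_wpM2l //; apply: le_trans (hB T).
by apply: ler_sum => n _; rewrite expr0 mul1r.
Qed.

Lemma Eis1P tau z : good xpredT tau z -> has_sum (eterm tau z) (Eis1 tau z).
Proof. by move=> /eterm_summ/summ_has_sum[l hl]; exact: (xgetI 0 hl). Qed.

Lemma eis_phi (n : int) w : vv w != 1 ->
  cderiv (fun w => cc w + ipi * (sgz n)%:~R) w
    (n%:~R ^+ 0 * (ss w * (- 1%:P).[cc w])).
Proof.
move=> v1; rewrite expr0 mul1r hornerN hornerC mulrN1 -[- ss w]addr0.
exact: cderivD (cc_deriv v1) (cderiv_cst _ w).
Qed.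

Lemma Eis1_dz tau z : good xpredT tau z ->
  cderiv (Eis1 tau) z (Ser xpredT (- 1%:P) 0 tau z).
Proof.
move=> hg; apply: (line_deriv_z hg (phi := fun n w => cc w + ipi * (sgz n)%:~R)).
  by move=> n w _; exact: eis_phi.
by move=> t w ht; apply: eq_has_sum (Eis1P ht) => n; rewrite mul1r.
Qed.

Lemma Eis1_dtau tau z : good xpredT tau z ->
  cderiv (fun t => Eis1 t z) tau (Ser xpredT (- 1%:P) 1 tau z).
Proof.
move=> hg; apply: (line_deriv_tau hg (phi := fun n w => cc w + ipi * (sgz n)%:~R)
  (F := Eis1)).
  by move=> n w _; exact: eis_phi.
by move=> t w ht; apply: eq_has_sum (Eis1P ht) => n; rewrite mul1r.
Qed.

End TermwiseDerivatives.

(** * Products of row sums, regrouped along diagonals *)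

Section DoubleSums.
Context {R : realType}.
Local Notation C := R[i].
Implicit Types (z tau w : C) (P : pred int) (p : {poly C}).

Lemma has_sum0 (I : choiceType) (f : I -> C) : (forall i, f i = 0) -> has_sum f 0.
Proof.
by move=> h; have := @has_sum_fin R I f fset0; rewrite big_seq_fset0; exact.
Qed.

(** For k = 1 only m = -1 and m = 0 contribute, 1 each; the general case telescopes. This is the
    origin of the constant 2 i pi in the quasi-period of [E1]. *)
Lemma has_sum_sgz (k : int) :
  has_sum (fun m : int => (sgz (m + k) - sgz m)%:~R : C) (2 * k%:~R).
Proof.
have h1 : has_sum (fun m : int => (sgz (m + 1) - sgz m)%:~R : C) 2.
  pose f a m : C := if m == a :> int then 1 else 0.
  have hf (a : int) : has_sum (f a) 1.
    have := @has_sum1 R _ (f a) a; rewrite /f eqxx; apply => j /negPf -> //.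
  apply: eq_has_sum (has_sumD (hf (- 1)) (hf 0)) => m; rewrite /f.
  case: (ltrgtP m 0) => [m0|m0|->].
  - have [->|m1] := eqVneq m (-1); first by rewrite addr0.
    rewrite add0r [sgz (m + 1)]ltr0_sgz ?[sgz m]ltr0_sgz ?subrr //; lia.
  - have -> : (m == -1) = false by lia.
    by rewrite add0r !gtr0_sgz ?subrr // ltr_wpDr.
  - by rewrite !add0r sgz0 subr0.
have hn (n : nat) : has_sum (fun m : int => (sgz (m + n%:Z) - sgz m)%:~R : C) (2 * n%:R).
  elim: n => [|n IH].
    rewrite mulr0; apply: has_sum0 => m; by rewrite addr0 subrr.
  have := has_sumD (has_sum_bij (addrK n%:Z) (subrK n%:Z) h1) IH.
  rewrite -[n.+1]add1n natrD mulrDr mulr1; apply: eq_has_sum => m /=.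
  rewrite -intrD addrA subrK; congr (sgz _ - _)%:~R.
  by rewrite -addrA -PoszD addn1 add1n.
case: k => n; first exact: hn.
rewrite NegzE; have := has_sum_bij (subrK n.+1%:Z) (addrK n.+1%:Z) (has_sumN (hn n.+1)).
rewrite mulrNz -mulrN; apply: eq_has_sum => m /=.
by rewrite -mulrNz opprB subrK.
Qed.

Lemma goodT tau z n : good xpredT tau z -> ~ isint (z + n%:~R * tau).
Proof. by move=> [_ /(_ n isT)]. Qed.

Definition nz : pred int := fun n => n != 0.

Lemma good_nz tau : upper_half_plane tau -> good nz tau (0 : C).
Proof.
rewrite /upper_half_plane /= => h; split => // n n0; apply: isint_Im.
rewrite add0r -(rmorph_int (real_complex R)).
have -> : complex.Im ((n%:~R : R)%:C * tau) = n%:~R * complex.Im tau.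
  by case: (tau) => ? ? /=; ring.
by rewrite mulf_neq0 ?intr_eq0 // gt_eqF.
Qed.

Lemma vv_neq x y : ~ isint (x - y) -> vv x != vv y :> C.
Proof.
move=> h; apply/eqP => e; apply: h; apply/vv_eq1.
by rewrite vvB e divff // vv_neq0.
Qed.

Section Fixed.
Variables (tau z : C).
Hypothesis hg : good xpredT tau z.
Let c (n : int) := cc (z + n%:~R * tau).
Let s (n : int) := ss (z + n%:~R * tau).
Let ka (k : int) := cc (k%:~R * tau).
Let si (k : int) := ss (k%:~R * tau).
Let S := Ser xpredT 1%:P 0 tau z.
Let E := Eis1 tau z.

Let hs : has_sum s S.
Proof.
by apply: eq_has_sum (SerP _ _ hg) => n; rewrite /term hornerC expr0 !mul1r mulr1.
Qed.

Let ss_summ : summ s.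
Proof.
have [B hB] := Ser_summ 1%:P 0 hg; exists B => T; apply: le_trans (hB T).
by apply: ler_sum => n _; rewrite /term hornerC expr0 !mul1r mulr1.
Qed.

(** Shifting the index leaves the sum of [eterm] unchanged, so that only the sign corrections
    remain. *)
Let tele k : has_sum (fun m => c (m + k) - c m) (- 2 * ipi * k%:~R).
Proof.
have h := has_sumB (has_sum_bij (addrK k) (subrK k) (Eis1P hg)) (Eis1P hg).
rewrite subrr in h.
have := has_sumB h (has_sumZ ipi (has_sum_sgz k)).
have -> : 0 - ipi * (2 * k%:~R) = - 2 * ipi * k%:~R :> C by ring.
by apply: eq_has_sum => m /=; rewrite /eterm intrB /c; ring.
Qed.

Let im_pos : upper_half_plane tau. Proof. by case: hg. Qed.

Let addn_sub m k : z + (m + k)%:~R * tau - (z + m%:~R * tau) = k%:~R * tau.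
Proof. by rewrite intrD; ring. Qed.

Let vneq m k : k != 0 -> vv (z + (m + k)%:~R * tau) != vv (z + m%:~R * tau).
Proof.
move=> k0; apply: vv_neq; rewrite addn_sub.
by have [_ /(_ k k0)] := good_nz im_pos; rewrite add0r.
Qed.

Let v1 n : vv (z + n%:~R * tau) != 1.
Proof. by apply: vv_neq1; exact: goodT. Qed.

Let cs_mul m k : k != 0 -> c (m + k) * s m = si k * (c (m + k) - c m) + ka k * s m.
Proof.
by move=> k0; rewrite /c /s cc_ss_mul; rewrite ?v1 ?vneq // addn_sub.
Qed.

(** Coordinates (k, m) on pairs of rows, where k is the difference of the row indices. *)
Let psi (p : int * int) : int * int := (p.2 + p.1, p.2).
Let psi' (p : int * int) : int * int := (p.1 - p.2, p.2).
Let psiK : cancel psi psi'.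
Proof. by move=> [k m]; rewrite /psi' /psi /= addrAC subrr add0r. Qed.
Let psi'K : cancel psi' psi.
Proof. by move=> [n m]; rewrite /psi' /psi /= addrC subrK. Qed.

(** The diagonal k = 0 gives the sum of the squares of [ss]. For k != 0 [ss_mul] makes the summand
    linear, [hs] and [tele] sum it over m, and the coefficients in [si k] and [ka k] add up to
    series at z = 0. *)
Lemma Ser_sqr : S ^+ 2 = Ser xpredT ('X^2 + (piC ^+ 2)%:P) 0 tau z
   + 2 * S * Ser nz 1%:P 0 tau 0 - 4 * ipi * Ser nz 'X 1 tau 0.
Proof.
set S4 := Ser xpredT _ 0 tau z.
have h := has_sum_bij psiK psi'K (has_sum_prod ss_summ ss_summ hs hs).
pose A k := (if k == 0 then S4 else 0) + 2 * S * term nz 1%:P 0 tau 0 k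
   - 4 * ipi * term nz 'X 1 tau 0 k.
have hA k : has_sum (fun m => s (m + k) * s m) (A k).
  rewrite /A /term /nz add0r; have [->|k0] := eqVneq k 0.
    rewrite !mul0r !mulr0 addr0 subr0; apply: eq_has_sum (SerP _ _ hg) => m.
    by rewrite /term addr0 hornerD hornerXn hornerC expr0 !mul1r.
  have := has_sumD (has_sumZ (si k) (has_sumD (has_sum_bij (addrK k) (subrK k) hs) hs))
     (has_sumZ (2 * ka k * si k) (tele k)).
  rewrite hornerC hornerX expr0 expr1 -/(ka k) -/(si k).
  have -> : si k * (S + S) + 2 * ka k * si k * (- 2 * ipi * k%:~R) =
    0 + 2 * S * (1 * (1 * (si k * 1))) - 4 * ipi * (1 * (k%:~R * (si k * ka k))) by ring.
  apply: eq_has_sum => m /=.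
  by rewrite {3}/s {3}/s ss_mul ?v1 ?vneq // addn_sub.
have hA2 : has_sum A (S4 + 2 * S * Ser nz 1%:P 0 tau 0 - 4 * ipi * Ser nz 'X 1 tau 0).
  apply: has_sumB; last by apply: has_sumZ; exact: SerP (good_nz im_pos).
  apply: has_sumD; last by apply: has_sumZ; exact: SerP (good_nz im_pos).
  have := @has_sum1 R _ (fun k : int => if k == 0 then S4 else 0) 0.
  by rewrite eqxx; apply => j /negPf ->.
by rewrite expr2; apply: has_sum_unique hA2; apply: has_sum_sigma h _ => k; exact: hA.
Qed.

(** The sign corrections of [eterm], symmetrised in k. For |k| > |m| the two signs cancel, which
    makes the family absolutely summable over all pairs, as neither half is by itself. *)
Let W (p : int * int) : C := ipi * (sgz (p.2 + p.1) + sgz (p.2 - p.1))%:~R * s p.2.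

Let W_summ : summ W.
Proof.
have [rho [K [r [rho0 r0 r1 h]]]] := near_bounds hg.
have h0 x : nm (x - x : C) < rho by rewrite subrr nm0.
have [_ hM] := h tau z (h0 _) (h0 _).
(* [W] vanishes unless |k| <= |m|, and then r^|m| <= q^|k| q^|m|, a product majorant. *)
pose q := Num.sqrt r.
have q0 : 0 <= q by exact: sqrtr_ge0.
have qr : q ^+ 2 = r by rewrite sqr_sqrtr.
have q1 : q < 1 by rewrite -(@ltr_pXn2r _ 2) // ?nnegrE // qr expr1n.
have [B hB] := geo_int 0 q0 q1.
pose f (n : int) : C := (q ^+ `|n|%N)%:C.
have fs : summ f.
  exists B => T; apply: le_trans (hB T); apply: ler_sum => n _.
  by rewrite expr0 mul1r nm_real ger0_norm ?exprn_ge0.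
have fs2 := summZ (2 * pi * `|K|)%:C fs.
have [D hD] := summ_prod fs fs2.
exists D => T; apply: le_trans (hD T); apply: ler_sum => -[k m] _ /=.
rewrite /W /=; have [km|km] := leqP `|k|%N `|m|%N; last first.
  have -> : sgz (m + k) + sgz (m - k) = 0.
    have [k0|k0] := lerP 0 k.
      have h1 : 0 < m + k by lia.
      have h2 : m - k < 0 by lia.
      by rewrite gtr0_sgz // ltr0_sgz.
    have h1 : m + k < 0 by lia.
    have h2 : 0 < m - k by lia.
    by rewrite ltr0_sgz // gtr0_sgz.
  by rewrite mulr0 mul0r nm0 nm_ge0.
have [_ _ hsm _] := hM m isT.
have -> : nm (f k * ((2 * pi * `|K|)%:C * f m)) =
    q ^+ `|k|%N * (2 * pi * `|K| * q ^+ `|m|%N).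
  have K0 : 0 <= 2 * pi * `|K| by rewrite !mulr_ge0 ?pi_ge0.
  by rewrite !nmM !nm_real (ger0_norm K0) !(ger0_norm (exprn_ge0 _ q0)).
rewrite [nm (_ * s m)]nmM [nm (ipi * _)]nmM nm_ipi nm_int.
have sg : `|(sgz (m + k) + sgz (m - k))%:~R : R| <= 2.
  rewrite intrD; apply: le_trans (ler_normD _ _) _.
  have sgb (a : int) : `|(sgz a)%:~R : R| <= 1.
    by case: sgzP; rewrite ?mulrN1z ?normrN ?normr1 // normr0.
  have := sgb (m + k); have := sgb (m - k); lra.
have hq : r ^+ `|m|%N <= q ^+ `|k|%N * q ^+ `|m|%N.
  rewrite -qr -exprM mul2n -addnn exprD ler_wpM2r ?exprn_ge0 //.
  by rewrite ler_wiXn2l // ltW.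
have e1 : pi * `|(sgz (m + k) + sgz (m - k))%:~R : R| <= pi * 2.
  by rewrite ler_wpM2l ?pi_ge0.
apply: le_trans (_ : pi * 2 * (`|K| * r ^+ `|m|%N) <= _).
  apply: ler_pM; rewrite ?nm_ge0 ?mulr_ge0 ?pi_ge0 ?normr_ge0 //.
  by apply: le_trans hsm _; rewrite ler_wpM2r ?exprn_ge0 // ler_norm.
have -> : pi * 2 * (`|K| * r ^+ `|m|%N) = 2 * pi * `|K| * r ^+ `|m|%N by ring.
by rewrite [leRHS]mulrCA ler_wpM2l ?mulr_ge0 ?pi_ge0.
Qed.

(** By [cc_ss_mul] the diagonal k sums to [Q k + U k], with [U] coming from the sign corrections.
    [Q] is odd except for its value [X0] at 0, so adding the diagonals k and -k leaves the sum of
    [W] and twice [X0]. The last series is, up to sign, the tau-derivative of [Eis1]. *)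
Lemma Ser_mul_Eis1 : E * S = Ser xpredT 'X 0 tau z + 2 * ipi * Ser xpredT 1%:P 1 tau z.
Proof.
set X0 := Ser xpredT 'X 0 tau z; set S1 := Ser xpredT 1%:P 1 tau z.
have h := has_sum_bij psiK psi'K (has_sum_prod (eterm_summ hg) ss_summ (Eis1P hg) hs).
have sg_summ k : summ (fun m => ipi * (sgz (m + k))%:~R * s m).
  have [B hB] := summZ ipi ss_summ; exists B => T; apply: le_trans (hB T).
  apply: ler_sum => m _; rewrite !nmM mulrAC ler_piMr ?mulr_ge0 ?nm_ge0 // nm_int.
  by case: sgzP; rewrite ?mulrN1z ?normrN ?normr1 // normr0.
have /choice[U hU] : forall k, exists u, has_sum (fun m => ipi * (sgz (m + k))%:~R * s m) u.
  by move=> k; apply: summ_has_sum; exact: sg_summ.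
pose Q k : C := (if k == 0 then X0 else 0) - 2 * ipi * k%:~R * si k + ka k * S.
have ka0 : ka 0 = 0 by rewrite /ka mul0r /cc vv0 subrr invr0 mulr0.
have hB k : has_sum (fun m => eterm tau z (m + k) * s m) (Q k + U k).
  have : has_sum (fun m => c (m + k) * s m) (Q k).
    rewrite /Q; have [->|k0] := eqVneq k 0.
      rewrite mulr0 mul0r subr0 ka0 mul0r addr0.
      apply: eq_has_sum (SerP _ _ hg) => m.
      by rewrite /term addr0 hornerX expr0 !mul1r mulrC.
    have := has_sumD (has_sumZ (si k) (tele k)) (has_sumZ (ka k) hs).
    have -> : si k * (- 2 * ipi * k%:~R) + ka k * S =
      0 - 2 * ipi * k%:~R * si k + ka k * S by ring.
    by apply: eq_has_sum => m; exact: esym (cs_mul m k0).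
  move=> /has_sumD/(_ (hU k)); apply: eq_has_sum => m.
  by rewrite /eterm /c; ring.
have hBs : has_sum (fun k => Q k + U k) (E * S) by apply: has_sum_sigma h _ => k; exact: hB.
have hBN := has_sum_bij (@opprK int) (@opprK int) hBs.
have hX : has_sum (fun k : int => if k == 0 then X0 else 0) X0.
  have := @has_sum1 R _ (fun k : int => if k == 0 then X0 else 0) 0.
  by rewrite eqxx; apply => j /negPf ->.
have hV : has_sum (fun k => U k + U (- k)) (E * S + E * S - (X0 + X0)).
  apply: eq_has_sum (has_sumB (has_sumD hBs hBN) (has_sumD hX hX)) => k /=.
  have -> : U k + U (- k) = (Q k + U k + (Q (- k) + U (- k))) - (Q k + Q (- k)).
    by ring.
  congr (_ - _); rewrite /Q oppr_eq0 /ka /si mulrNz mulNr ccN ssN.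
  have aux (a d b u v w : C) :
    a + a = a - 2 * d * b * u + v * w + (a - 2 * d * - b * u + - v * w) by ring.
  exact: aux.
have [L hL] := summ_has_sum W_summ.
have hVL : has_sum (fun k => U k + U (- k)) L.
  apply: has_sum_sigma hL _ => k.
  by apply: eq_has_sum (has_sumD (hU k) (hU (- k))) => m; rewrite /W /= intrD; ring.
pose sw (p : int * int) : int * int := (p.2, p.1).
have swK : cancel sw sw by case.
(* [W] is now summed over k first: sgn(m + k) + sgn(m - k) has sum 4 m, by [has_sum_sgz] for 2 m
   after replacing k by k - m. *)
have hM : has_sum (fun m : int => 4 * ipi * (m%:~R * s m)) L.
  apply: has_sum_sigma (has_sum_bij swK swK hL) _ => m /=.
  have := has_sumZ (ipi * s m)
     (has_sum_bij (subrK m) (addrK m) (has_sum_sgz (2 * m))).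
  rewrite intrM; have -> : ipi * s m * (2 * ((2 : int)%:~R * m%:~R)) =
     4 * ipi * (m%:~R * s m) by rewrite -[(2 : int)%:~R]/(2 : C); ring.
  apply: eq_has_sum => k; rewrite /W /=.
  have -> : k - m + 2 * m = m + k by ring.
  by rewrite -[k - m]opprB sgzN opprK; ring.
have hS1 : has_sum (fun m : int => 4 * ipi * (m%:~R * s m)) (4 * ipi * S1).
  apply: eq_has_sum (has_sumZ (4 * ipi) (SerP 1%:P 1 hg)) => m.
  by rewrite /term hornerC expr1 mul1r mulr1.
have e := has_sum_unique hV hVL; rewrite (has_sum_unique hM hS1) in e.
have -> : E * S = (E * S + E * S - (X0 + X0)) / 2 + X0 by field.
by rewrite e; field.
Qed.

End Fixed.

End DoubleSums.

(** * [e2] and [E1] as row sums *)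

Section EisensteinSeries.
Context {R : realType}.
Local Notation C := R[i].
Implicit Types (z tau w : C).

Lemma has_sum_nat_cvg (f : nat -> C) l : has_sum f l ->
  (fun N => \sum_(0 <= n < N) f n) @ \oo --> l.
Proof.
move=> hf; apply/cvgrPdist_le => _ /gt0_complex[e e0 ->].
have [S hS] := hf e e0.
near=> N.
pose T := [fset n in iota 0 N].
have ST : S `<=` T.
  apply/fsubsetP => n nS; rewrite mem_fset_seq mem_iota add0n /=.
  apply: (@leq_ltn_trans (\max_(i <- S) i)%N).
    by rewrite (big_fsetD1 n) //= leq_maxl.
  by near: N; exact: nbhs_infty_gt.
have := hS _ ST; rewrite normE lecR nm_distC.
by rewrite big_fset_seq ?iota_uniq // /index_iota subn0.
Unshelve. all: by end_near.
Qed.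

Lemma has_sum_nat_series (f : nat -> C) l : f 0%N = 0 -> has_sum f l ->
  \big[+%R/0]_(1 <= n <oo) f n = l.
Proof.
move=> f0 hf; apply: cvg_lim => //.
suff -> : (fun N => \sum_(1 <= n < N) f n) = (fun N => \sum_(0 <= n < N) f n).
  exact: has_sum_nat_cvg.
apply/funext => -[|N]; first by rewrite !big_geq.
by rewrite [RHS]big_nat_recl // f0 add0r big_add1.
Qed.

Lemma has_sum_succ (f : nat -> C) l : has_sum f l ->
  has_sum (fun n => f n.+1) (l - f 0%N).
Proof.
move=> hf; pose g n := if n == 0%N then f 0%N else 0.
have hg : has_sum g (f 0%N).
  by have := @has_sum1 R _ g 0%N; rewrite /g eqxx; apply => j /negPf ->.
have := @has_sum_reindex _ _ _ _ succn predn _ _ _ (has_sumB hf hg).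
move=> H; apply: eq_has_sum (H _ _) => // [n|[|n]]; rewrite /g /= ?subr0 //.
by rewrite subrr eqxx.
Qed.

Lemma summ_geo_nat (f : nat -> C) (K r : R) j : 0 <= r -> r < 1 ->
  (forall n, nm (f n) <= K * (n%:R ^+ j * r ^+ n)) -> summ f.
Proof.
move=> r0 r1 hf; have [B hB] := geo_nat j r0 r1.
apply: (@summ_le _ _ _ (fun n => `|K| * (n%:R ^+ j * r ^+ n)) (`|K| * B)) => [n|T].
  apply: le_trans (hf n) _; rewrite ler_wpM2r ?ler_norm //.
  by rewrite mulr_ge0 ?exprn_ge0.
rewrite -mulr_sumr ler_wpM2l //.
apply: (@bound_nat R (fun n => n%:R ^+ j * r ^+ n)) => // n.
by rewrite mulr_ge0 ?exprn_ge0.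
Qed.

(** An index shift gives linear equations for the geometric sum G and for D, the sum of the d v^d: G
    - 1 = v G and D = v D + v G. *)
Lemma has_sum_dgeo (v : C) : nm v < 1 ->
  has_sum (fun d : nat => d.+1%:R * v ^+ d.+1) (v / (v - 1) ^+ 2).
Proof.
move=> v1.
have v10 : v - 1 != 0.
  by rewrite subr_eq0; apply/eqP => e; rewrite e nm1 ltxx in v1.
have sG : summ (fun d : nat => v ^+ d).
  apply: (@summ_geo_nat _ 1 (nm v) 0) => // [|n]; first exact: nm_ge0.
  by rewrite expr0 !mul1r nmX.
have sD : summ (fun d : nat => d%:R * v ^+ d).
  apply: (@summ_geo_nat _ 1 (nm v) 1) => // [|n]; first exact: nm_ge0.
  by rewrite expr1 !mul1r nmM nm_nat nmX.
have [G hG] := summ_has_sum sG; have [D hD] := summ_has_sum sD.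
have e1 : G - 1 = v * G.
  have := has_sum_succ hG; rewrite expr0 => h.
  by apply: has_sum_unique h _; apply: eq_has_sum (has_sumZ v hG) => n; rewrite exprS.
have hD1 := has_sum_succ hD; rewrite mul0r subr0 in hD1.
have e2 : D = v * D + v * G.
  apply: has_sum_unique hD1 _.
  apply: eq_has_sum (has_sumD (has_sumZ v hD) (has_sumZ v hG)) => n.
  by rewrite -[n.+1]addn1 natrD exprD expr1; ring.
have -> : v / (v - 1) ^+ 2 = D; last exact: hD1.
have G1 : G = - (v - 1)^-1.
  apply: (mulfI v10); rewrite mulrN divff //.
  have -> : (v - 1) * G = v * G - G by ring.
  by rewrite -e1; ring.
have D1 : (v - 1) * D = - (v * G).
  have -> : (v - 1) * D = v * D - D by ring.
  by rewrite {2}e2; ring.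
apply: (mulfI v10); rewrite D1 G1; field; exact: v10.
Qed.

Lemma sum_divisors N : (0 < N)%N ->
  sigma1 N = (\sum_(d < N | d.+1 %| N) d.+1)%N.
Proof.
move=> N0; rewrite /sigma1 -(big_mkord (fun d => (d.+1 %| N)%N) succn).
rewrite -(big_add1 _ _ 0%N N.+1 (fun d => (d %| N)%N) id) -[RHS]big_filter; apply: perm_big.
apply: uniq_perm; rewrite ?divisors_uniq ?filter_uniq ?iota_uniq // => d.
rewrite -dvdn_divisors // mem_filter mem_index_iota; case: (boolP (d %| N)%N) => //= dN.
by rewrite (dvdn_gt0 N0 dN) ltnS dvdn_leq.
Qed.

(** Lambert series: both are the sum of (d + 1) q^N over N >= 1 and d + 1 dividing N, grouped by N
    in one case and by k = N / (d + 1) in the other. *)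
Lemma q_series (q : C) : nm q < 1 -> exists L,
  has_sum (fun N : nat => if N == 0%N then 0 else (sigma1 N)%:R * q ^+ N) L /\
  has_sum (fun k : nat => if k == 0%N then 0 else q ^+ k / (q ^+ k - 1) ^+ 2) L.
Proof.
move=> q1.
pose G (p : nat * nat) : C :=
  if (p.1 != 0%N) && (p.2.+1 %| p.1)%N then p.2.+1%:R * q ^+ p.1 else 0.
(* As d < N, |q|^N = rho^N rho^N is at most rho^N rho^d, a product majorant. *)
pose rho := Num.sqrt (nm q).
have r0 : 0 <= rho by exact: sqrtr_ge0.
have rq : rho ^+ 2 = nm q by rewrite sqr_sqrtr ?nm_ge0.
have r1 : rho < 1 by rewrite -(@ltr_pXn2r _ 2) // ?nnegrE // rq expr1n.
pose g (N : nat) : C := (rho ^+ N)%:C.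
pose h (d : nat) : C := (d.+1%:R * rho ^+ d)%:C.
have sg : summ g.
  apply: (@summ_geo_nat _ 1 rho 0) => // n.
  by rewrite /g nm_real ger0_norm ?exprn_ge0 // expr0 !mul1r.
have sh : summ h.
  pose h1 (d : nat) : C := (d%:R * rho ^+ d)%:C.
  have s1 : summ h1.
    apply: (@summ_geo_nat _ 1 rho 1) => // n.
    by rewrite /h1 nm_real ger0_norm ?mulr_ge0 ?exprn_ge0 // expr1 !mul1r.
  have [B hB] := summD s1 sg; exists B => T; apply: le_trans (hB T).
  apply: ler_sum => n _; rewrite /h /h1 /g -rmorphD /= -[X in _ + X]mul1r -mulrDl.
  by rewrite natr1.
have [B hB] := summ_prod sg sh.
have sG : summ G.
  exists B => T; apply: le_trans (hB T); apply: ler_sum => -[N d] _ /=.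
  rewrite /G /=; case: ifP => [/andP[N0 dN]|_]; last by rewrite nm0 nm_ge0.
  have dlN : (d < N)%N by rewrite dvdn_leq // lt0n.
  rewrite nmM nm_nat nmX -rq -exprM mul2n -addnn exprD /g /h nmM !nm_real.
  rewrite !ger0_norm ?mulr_ge0 ?exprn_ge0 //.
  rewrite [leRHS]mulrCA ler_wpM2l // ler_wpM2l ?exprn_ge0 //.
  by rewrite ler_wiXn2l ?(ltW r1) // ltnW.
have [L hL] := summ_has_sum sG; exists L; split.
  apply: has_sum_sigma hL _ => N.
  have [->|N0] := eqVneq N 0%N; first by apply: has_sum0 => d; rewrite /G.
  have -> : (sigma1 N)%:R * q ^+ N = \sum_(d <- [fset d in iota 0 N]) G (N, d).
    rewrite big_fset_seq ?iota_uniq // sum_divisors ?lt0n // natr_sum mulr_suml.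
    rewrite -(big_mkord (fun d => (d.+1 %| N)%N) (fun d => d.+1%:R * q ^+ N)).
    by rewrite /index_iota subn0 big_mkcond; apply: eq_bigr => d _; rewrite /G /= N0.
  apply: has_sum_fin => d; rewrite mem_fset_seq mem_iota add0n -leqNgt /G /= => hd.
  by case: ifP => // /andP[_ /dvdn_leq]; rewrite lt0n N0 => /(_ isT); lia.
pose j (p : nat * nat) := ((p.1 * p.2.+1)%N, p.2).
pose j' (p : nat * nat) := ((p.1 %/ p.2.+1)%N, p.2).
have := @has_sum_reindex _ _ _ G j j' L.
move=> /(_ _ _ hL) H.
apply: has_sum_sigma (H _ _) _ => [[k d]|[N d]|k]; rewrite /j /j' /=.
- by rewrite mulnK.
- by rewrite /G /=; case: ifP => [/andP[_ dN] _|_]; rewrite ?eqxx // divnK.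
have [->|k0] := eqVneq k 0%N; first by apply: has_sum0 => d; rewrite /G /= ?mul0n.
have vk : nm (q ^+ k) < 1 by rewrite nmX exprn_ilt1 ?nm_ge0.
apply: eq_has_sum (has_sum_dgeo vk) => d.
by rewrite /G /= muln_eq0 (negPf k0) /= dvdn_mull // exprM.
Qed.

Lemma has_sum_int_even (f : int -> C) l : summ f -> f 0 = 0 ->
  (forall n, f (- n) = f n) -> has_sum (fun k : nat => f k%:Z) l ->
  has_sum f (2 * l).
Proof.
move=> sf f0 fN hl.
pose fp n := if 0 < n then f n else 0.
have [a ha] : exists a, has_sum fp a.
  apply: summ_has_sum; case: sf => B; apply: summ_le => n.
  by rewrite /fp; case: ifP => // _; rewrite nm0 nm_ge0.
have -> : l = a.
  apply: has_sum_unique hl _.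
  have h1 (i : nat) : absz (Posz i) = i by [].
  have h2 (y : int) : fp y != 0 -> Posz (absz y) = y.
    by rewrite /fp; case: ifP => [n0 _|_]; [rewrite gtz0_abs|rewrite eqxx].
  have := has_sum_reindex h1 h2 ha; apply: eq_has_sum => k.
  by rewrite /comp /fp; case: k => [|k] //; rewrite ltxx f0.
have -> : 2 * a = a + a by ring.
apply: eq_has_sum (has_sumD ha (has_sum_bij (@opprK int) (@opprK int) ha)) => n /=.
rewrite /fp oppr_gt0 fN; case: (ltrgtP n 0) => [||->]; rewrite ?add0r ?addr0 //.
Qed.

(** A row n != 0 contributes -4 pi^2 v / (v - 1)^2 with v = q^|n|; the rows n and -n agree, and
    [q_series] turns their total into the defining q-series. The term pi^2 / 3 is the row n = 0, see
    [zeta2]. *)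
Lemma e2E tau : upper_half_plane tau ->
  e2 tau = piC ^+ 2 / 3 + Ser nz 1%:P 0 tau 0.
Proof.
move=> ht; have hg := good_nz ht.
have q1 : nm (vv tau) < 1.
  rewrite nm_vv -(@expR0 R) ltr_expR oppr_lt0 !mulr_gt0 ?pi_gt0 //.
have [L [hN hk]] := q_series q1.
rewrite /e2.
have -> : \big[+%R/0]_(1 <= n <oo) ((sigma1 n)%:R * cexp (2 * 'i * pi%:C * n%:R * tau)) = L.
  pose f (N : nat) : C := if N == 0%N then 0 else (sigma1 N)%:R * vv tau ^+ N.
  rewrite -(@has_sum_nat_series f L) //; congr (limn _); apply/funext => N.
  apply: eq_big_nat => n /andP[n0 _].
  rewrite /f (negPf (lt0n_neq0 n0)); congr (_ * _).
  by rewrite -vvMn /vv mulrA.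
have -> : Ser nz 1%:P 0 tau 0 = 2 * (- 4 * piC ^+ 2 * L).
  apply: has_sum_unique (SerP _ _ hg) _.
  apply: has_sum_int_even; first exact: Ser_summ.
  - by rewrite /term /nz eqxx mul0r.
  - by move=> n; rewrite /term /nz oppr_eq0 !add0r mulrNz mulNr !expr0 !hornerC ssN.
  apply: eq_has_sum (has_sumZ (- 4 * piC ^+ 2) hk) => k.
  rewrite /term /nz; have [->|k0] := eqVneq k 0%N; first by rewrite eqxx mul0r mulr0.
  have -> : (k%:Z != 0) by [].
  rewrite hornerC expr0 !mul1r mulr1 add0r -[k%:Z%:~R]/(k%:R).
  have v1 : vv (k%:R * tau) != 1.
    apply: vv_neq1; have [_ /(_ k%:Z)] := hg; rewrite add0r; apply.
    by rewrite /nz.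
  by rewrite ssE // vvMn mulrA.
have -> : (pi ^+ 2 / 3)%:C = piC ^+ 2 / 3 :> C.
  by rewrite rmorphM rmorphXn fmorphV rmorph_nat.
by field.
Qed.

(** The inner limit is [cc] by [row1_lim]; the odd sign corrections cancel in the symmetric outer
    sums. *)
Lemma E1E tau z : good xpredT tau z -> E1 tau z = Eis1 tau z.
Proof.
move=> hg; rewrite /E1.
have -> : (fun n : int => limn (symmetric_sum (fun m : int => (z + m%:~R + n%:~R * tau)^-1))) =
  (fun n : int => cc (z + n%:~R * tau)).
  apply/funext => n; rewrite -row1_lim; last exact: goodT.
  congr (limn (symmetric_sum _)); apply/funext => m.
  by rewrite addrAC.
apply: cvg_lim => //.
suff <- : symmetric_sum (eterm tau z) = symmetric_sum (fun n : int => cc (z + n%:~R * tau)).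
  exact: has_sum_sym (Eis1P hg).
apply/funext => N; rewrite [LHS]big_split /= -/(symmetric_sum _ N).
rewrite [X in _ + X](@symmetric_sum_odd _ (fun n : int => ipi * (sgz n)%:~R)) ?addr0 //.
by move=> m; rewrite sgzN mulrNz mulrN.
Qed.

End EisensteinSeries.

(** * Lattice sums *)

Section Lattice.
Context {R : realType}.
Local Notation C := R[i].
Implicit Types (z tau w : C).

Lemma has_sum_lim (I : choiceType) (f : I -> C) l : has_sum f l ->
  summability.sum f = l.
Proof.
move=> hf; have FF : ProperFilter (@summability.totally I).
  exact: summability.totally_filter.
apply: cvg_lim => //.
apply/cvgrPdist_le => _ /gt0_complex[e e0 ->].
have [S hS] := hf e e0; exists S => // T ST.
rewrite normE lecR nm_distC; have := hS T ST.
by rewrite big_seq_fsetE.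
Qed.

(** The exponent 3/2 is such that |m + n tau|^-3 is dominated by a function of m times a function of
    n, since the geometric mean of |m| + 1 and |n| + 1 is O(|m + n tau|) off the origin. *)
Definition invsq3 (k : nat) : R := (k.+1%:R * Num.sqrt k.+1%:R)^-1.

Lemma invsq3_ge0 k : 0 <= invsq3 k.
Proof. by rewrite invr_ge0 mulr_ge0 ?sqrtr_ge0. Qed.

Lemma invsq3_bound N : \sum_(k < N) invsq3 k <= 3.
Proof.
case: N => [|N]; first by rewrite big_ord0.
(* A telescoping bound again, now by 3 - 2 / sqrt(N + 1). *)
apply: (@le_trans _ _ (3 - 2 / Num.sqrt N.+1%:R)); last first.
  by rewrite gerBl divr_ge0 ?sqrtr_ge0.
elim: N => [|N IH].
  by rewrite big_ord_recl big_ord0 /invsq3 sqrtr1 mulr1 invr1; lra.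
rewrite big_ord_recr /=; apply: le_trans (lerD IH (lexx _)) _.
rewrite /invsq3; set a := Num.sqrt N.+1%:R; set b := Num.sqrt N.+2%:R.
have a0 : 0 < a by rewrite sqrtr_gt0 ltr0n.
have b0 : 0 < b by rewrite sqrtr_gt0 ltr0n.
have ea : a ^+ 2 = N.+1%:R by rewrite sqr_sqrtr.
have eb : b ^+ 2 = N.+2%:R by rewrite sqr_sqrtr.
have ab : b ^+ 2 = a ^+ 2 + 1 by rewrite ea eb -[N.+2]addn1 natrD.
have lab : a <= b by rewrite ler_sqrt // ler_nat.
rewrite -eb -subr_ge0.
have -> : 3 - 2 / b - (3 - 2 / a + (b ^+ 2 * b)^-1) =
   (2 * b ^+ 2 * (b - a) - a) / (a * b ^+ 3).
  by field; rewrite !gt_eqF.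
apply: divr_ge0; last by rewrite mulr_ge0 ?exprn_ge0 ?ltW.
have : (b - a) * (b + a) = 1 by rewrite -subr_sqr ab; ring.
nra.
Qed.

(** The imaginary part n Im tau controls n; the triangle inequality then controls m. *)
Lemma lattice_lower tau : upper_half_plane tau -> exists2 c : R, 0 < c &
  forall m n : int, c * ((`|m|%N)%:R + (`|n|%N)%:R) <= nm (m%:~R + n%:~R * tau).
Proof.
rewrite /upper_half_plane /= => y0; set y := complex.Im tau in y0.
pose D := 1 + (nm tau + 1) / y.
have D0 : 0 < D by rewrite addr_gt0 // divr_gt0 // ltr_wpDl ?nm_ge0.
exists D^-1; first by rewrite invr_gt0.
move=> m n; rewrite mulrC ler_pdivrMr //.
set w := m%:~R + n%:~R * tau.
have absE (k : int) : (`|k|%N)%:R = nm (k%:~R : C) by rewrite nm_int -intr_norm.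
have hn : (`|n|%N)%:R * y <= nm w.
  apply: le_trans (Im_nm w).
  have -> : complex.Im w = n%:~R * y.
    rewrite /w /y -!(rmorph_int (real_complex R)).
    by case: (tau) => ? ? /=; ring.
  by rewrite normrM absE nm_int ler_wpM2l // ler_norm.
have hm : (`|m|%N)%:R <= nm w + (`|n|%N)%:R * nm tau.
  rewrite !absE -nmM -[m%:~R](addrK (n%:~R * tau)).
  exact: nmB.
have w0 := nm_ge0 w; have t0 := nm_ge0 tau.
have e : (`|n|%N)%:R <= nm w / y by rewrite ler_pdivlMr.
have : (`|n|%N)%:R * (nm tau + 1) <= nm w / y * (nm tau + 1).
  by rewrite ler_wpM2r // addr_ge0.
have -> : nm w * D = nm w + nm w / y * (nm tau + 1).
  by rewrite /D; field; rewrite gt_eqF.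
lra.
Qed.

Section Fixed.
Variable tau : C.
Hypothesis htau : upper_half_plane tau.

Definition omega (p : int * int) : C := p.2%:~R + p.1%:~R * tau.

Lemma omega_inj : injective omega.
Proof.
have [c c0 hc] := lattice_lower htau.
move=> [n m] [n' m'] e.
have := hc (m - m') (n - n').
have -> : (m - m')%:~R + (n - n')%:~R * tau = 0.
  have -> : (m - m')%:~R + (n - n')%:~R * tau = omega (n, m) - omega (n', m').
    by rewrite /omega /= !intrB; ring.
  by rewrite e subrr.
rewrite nm0 pmulr_rle0 // -natrD lern0 addn_eq0 !absz_eq0 !subr_eq0.
by move=> /andP[/eqP -> /eqP ->].
Qed.

Lemma omega0 : omega (0, 0) = 0. Proof. by rewrite /omega /= mul0r addr0. Qed.

Lemma omega_eq0 p : (omega p == 0) = (p == (0, 0)).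
Proof. by rewrite -omega0 (inj_eq omega_inj). Qed.

Local Notation LL := (lattice tau `\ 0)%classic.

Lemma lattice_sumE (f : C -> C) l :
  has_sum (fun p : int * int => if p == (0, 0) then 0 else f (omega p)) l ->
  lattice_sum tau f = l.
Proof.
move=> hf; apply: has_sum_lim.
have hl1 : LL 1.
  by split; [exists 1, 0; rewrite mul0r addr0|apply/eqP; exact: oner_neq0].
have /choice[j hj] : forall w : set_type LL, exists p, omega p = val w.
  move=> [w /= hw]; have /set_mem[[m [n ->]] _] := hw; by exists (n, m).
have hk p : p != (0, 0) -> omega p \in LL.
  move=> p0; apply/mem_set; split; last by apply/eqP; rewrite omega_eq0.
  by exists p.2, p.1.
(* The lattice point 1 is a default value, taken at (0, 0) only, where the family vanishes. *)
pose k p : set_type LL := insubd (exist _ 1 (mem_set hl1)) (omega p).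
have h1 x : k (j x) = x.
  by rewrite /k hj; apply: val_inj; rewrite val_insubd; case: ifP => //; rewrite (valP x).
have h2 p : (if p == (0, 0) then 0 else f (omega p)) != 0 -> j (k p) = p.
  case: (eqVneq p (0, 0)) => [->|p0 _]; first by rewrite eqxx.
  by apply: omega_inj; rewrite hj /k val_insubd hk.
have := has_sum_reindex h1 h2 hf; apply: eq_has_sum => w /=.
rewrite hj; case: eqVneq => // e.
have := hj w; rewrite e omega0 => e0.
by have /set_mem[_] := valP w; rewrite /= -e0; case.
Qed.

Lemma lattice_summ : exists c K : R, [/\ 0 < c,
   forall p : int * int, p != (0, 0) -> c <= nm (omega p) &
   exists M : int * int -> R, [/\ forall p, 0 <= M p,
     forall T : {fset int * int}, \sum_(p <- T) M p <= K &
     forall p : int * int, p != (0, 0) -> (nm (omega p) ^+ 3)^-1 <= M p]].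
Proof.
have [c c0 hc] := lattice_lower htau.
pose u (n : int) : C := (invsq3 `|n|%N)%:C.
have su : summ u.
  exists (3 + 3) => T.
  have -> : \sum_(i <- T) nm (u i) = \sum_(i <- T) invsq3 `|i|%N.
    by apply: eq_bigr => i _; rewrite nm_real ger0_norm ?invsq3_ge0.
  by apply: bound_abs => *; [exact: invsq3_ge0|exact: invsq3_bound].
have [B hB] := summ_prod su su.
(* With t = |m| + |n|, both |m| + 1 and |n| + 1 are at most 2 t, so the product of their 3/2-th
   powers is at most 8 t^3, while c t <= |m + n tau|. *)
pose L := 8 / c ^+ 3.
have L0 : 0 <= L by rewrite divr_ge0 // exprn_ge0 // ltW.
exists c, (L * B); split => // [p p0|].
  apply: le_trans (hc p.2 p.1); rewrite -{1}[c]mulr1 ler_pM2l // -natrD ler1n.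
  by move: p0; case: p => a b; rewrite xpair_eqE /= => ?; lia.
exists (fun p => L * nm (u p.1 * u p.2)); split => [p|T|[n m] p0].
- by rewrite mulr_ge0 ?nm_ge0.
- by rewrite -mulr_sumr ler_wpM2l.
have s1 : (1 : R) <= (`|m|%N)%:R + (`|n|%N)%:R.
  by rewrite -natrD ler1n; move: p0; rewrite xpair_eqE /= => ?; lia.
have lo := hc m n; rewrite /= -/(omega (n, m)) in lo *.
rewrite /u nmM !nm_real !ger0_norm ?invsq3_ge0 // /invsq3.
set a : R := (`|n|.+1)%:R; set b : R := (`|m|.+1)%:R.
have ea : a = (`|n|%N)%:R + 1 by rewrite natr1.
have eb : b = (`|m|%N)%:R + 1 by rewrite natr1.
have m0 : 0 <= (`|m|%N)%:R :> R by [].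
have n0 : 0 <= (`|n|%N)%:R :> R by [].
set t := (`|m|%N)%:R + (`|n|%N)%:R in lo s1.
have et : t = (`|m|%N)%:R + (`|n|%N)%:R by [].
clearbody t.
have at2 : a <= 2 * t by lra.
have bt2 : b <= 2 * t by lra.
have a0 : 0 < a by rewrite ltr0n.
have b0 : 0 < b by rewrite ltr0n.
have ct : 0 < c * t by rewrite mulr_gt0 //; lra.
have sa : Num.sqrt a * Num.sqrt b <= 2 * t.
  rewrite -sqrtrM ?(ltW a0) // -[leRHS]ger0_norm; last by lra.
  by rewrite -sqrtr_sqr ler_sqrt ?sqr_ge0 // expr2; apply: ler_pM => //; exact: ltW.
have ab : a * Num.sqrt a * (b * Num.sqrt b) <= 8 * t ^+ 3.
  have -> : a * Num.sqrt a * (b * Num.sqrt b) = a * b * (Num.sqrt a * Num.sqrt b) by ring.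
  have -> : 8 * t ^+ 3 = (2 * t) * (2 * t) * (2 * t) by ring.
  have p1 : 0 <= a * b by rewrite mulr_ge0 // ltW.
  have p2 : 0 <= Num.sqrt a * Num.sqrt b by rewrite mulr_ge0 ?sqrtr_ge0.
  have p3 : a * b <= 2 * t * (2 * t) by apply: ler_pM => //; exact: ltW.
  exact: ler_pM.
have X0 : 0 < a * Num.sqrt a * (b * Num.sqrt b).
  by rewrite !mulr_gt0 // sqrtr_gt0.
rewrite -invfM.
apply: (@le_trans _ _ ((c * t) ^+ 3)^-1).
  by rewrite lef_pV2 ?posrE ?exprn_gt0 ?lerXn2r ?nnegrE ?nm_ge0 ?(ltW ct) // (lt_le_trans ct).
rewrite ler_pdivlMr // mulrC ler_pdivrMr ?exprn_gt0 //.
have -> : L * (c * t) ^+ 3 = 8 * t ^+ 3 by rewrite /L; field; rewrite gt_eqF.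
exact: ab.
Qed.

End Fixed.
End Lattice.

(** * The Weierstrass function as a row sum *)

Section Weierstrass.
Context {R : realType}.
Local Notation C := R[i].
Implicit Types (z tau w : C).

Lemma good_off tau z : off_lattice (tau, z) <-> good xpredT tau z.
Proof.
split=> -[ht hz]; split=> //=.
  move=> n _ [k hk]; apply: hz; exists k, (- n).
  by rewrite /= -hk mulrNz; ring.
move=> [m [n e]]; apply: (hz (- n) isT); exists m.
by rewrite e mulrNz; ring.
Qed.

Lemma summ1 (I : choiceType) (f : I -> C) i : (forall j, j != i -> f j = 0) -> summ f.
Proof.
move=> h; exists (nm (f i)) => T.
have [iT|iT] := boolP (i \in T).
  by rewrite (big_fsetD1 i) //= big_seq big1 ?addr0 // => j; rewrite !inE => /andP[ji _]; rewrite h ?nm0.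
rewrite big_seq big1 ?nm_ge0 // => j jT; rewrite h ?nm0 //.
by apply: contraNneq iT => <-.
Qed.

Lemma cderivX (f : C -> C) x d n : cderiv f x d ->
  cderiv (fun y => f y ^+ n) x (n%:R * f x ^+ n.-1 * d).
Proof.
move=> hf; have := cderiv_horner 'X^n hf.
rewrite derivXn hornerMn hornerXn mulr_natl.
by apply: (@cderiv_near _ _ _ _ _ 1 ltr01) => h _; rewrite hornerXn.
Qed.

(** Stands for letting z tend to 0 in an identity that holds on a punctured disc. *)
Lemma cderiv_const_near (G : C -> C) d A r : 0 < r -> cderiv G 0 d ->
  (forall x, x != 0 -> nm x < r -> G x = A) -> G 0 = A.
Proof.
move=> r0 hG hA; apply/eqP; rewrite -subr_eq0; apply/eqP/nm_eps0 => e e0.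
have [r1 r10 h1] := cderiv_cont hG e0.
pose h : R := Num.min r r1 / 2.
have h0 : 0 < h by rewrite divr_gt0 // lt_min r0.
have hn : nm (h%:C : C) = h by rewrite nm_real ger0_norm // ltW.
have hlt : h < Num.min r r1 by rewrite ltr_pdivrMr // ltr_pMr ?lt_min ?r0 // ltr1n.
move: hlt; rewrite lt_min => /andP[hr hr1].
have := h1 h%:C; rewrite hn add0r => /(_ hr1).
have hz : h%:C != 0 :> C by rewrite -nm_gt0 hn.
have hm : nm (h%:C : C) < r by rewrite hn.
by rewrite (hA _ hz hm) nm_distC.
Qed.

Section FixedTau.
Variable tau : C.
Hypothesis htau : upper_half_plane tau.
Local Notation om := (omega tau).

(** Points w of the lattice with |w| >= 2 |z| satisfy the bound with 1/2, and the others are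
    finitely many. The quotient by |w| + 1 in the proof allows for w = 0. *)
Lemma lattice_far z : good xpredT tau z ->
  exists2 d : R, 0 < d & forall p : int * int, d * nm (om p) <= nm (z - om p).
Proof.
move=> hg; have [c c0 hc] := lattice_lower htau.
have z0 p : 0 < nm (z - om p).
  rewrite nm_gt0; apply/eqP => e.
  have [_] := (good_off tau z).2 hg; apply; exists p.2, p.1.
  by apply/eqP; rewrite -subr_eq0; exact/eqP.
have [N hN] : exists N : nat, 2 * nm z / c <= N%:R.
  by exists (Num.truncn (2 * nm z / c)).+1; apply: ltW; exact: truncnS_gt.
pose s := [seq (i%:Z - N%:Z, j%:Z - N%:Z) | i <- iota 0 N.*2.+1, j <- iota 0 N.*2.+1].
have /fin_min[d d0 hd] : forall p : int * int, p \in s -> 0 < nm (z - om p) / (nm (om p) + 1).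
  by move=> p _; rewrite divr_gt0 // ltr_wpDl ?nm_ge0.
exists (Num.min d (1 / 2)); first by rewrite lt_min d0 divr_gt0.
move=> [n m]; have [small|big] := ltP (nm (om (n, m))) (2 * nm z).
  apply: (@le_trans _ _ (d * (nm (om (n, m)) + 1))).
    by apply: ler_pM; rewrite ?nm_ge0 ?ge_min ?lexx ?lerDl // le_min ltW // divr_ge0.
  rewrite -ler_pdivlMr; last by rewrite ltr_wpDl ?nm_ge0.
  apply: hd.
  have : c * ((`|m|%N)%:R + (`|n|%N)%:R) < 2 * nm z by apply: le_lt_trans (hc m n) small.
  rewrite mulrC -ltr_pdivlMr // -natrD => h.
  have := lt_le_trans h hN; rewrite ltr_nat => {}h.
  have n1 : absz (n + N%:Z)%R \in iota 0 N.*2.+1 by rewrite mem_iota; lia.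
  have m1 : absz (m + N%:Z)%R \in iota 0 N.*2.+1 by rewrite mem_iota; lia.
  apply/allpairsP; exists (absz (n + N%:Z)%R, absz (m + N%:Z)%R).
  by split=> //=; congr (_, _); lia.
apply: (@le_trans _ _ (1 / 2 * nm (om (n, m)))).
  by rewrite ler_wpM2r ?nm_ge0 // ge_min lexx orbT.
have := nm_ge (om (n, m)) (- z); rewrite nmN => H.
rewrite nm_distC; lra.
Qed.

Let V (p : int * int) : C := (om p)^-1.

Lemma wp_term z p : om p != 0 -> z - om p != 0 ->
  ((z - om p) ^+ 2)^-1 - (om p ^+ 2)^-1 =
  z * (z - om p)^-1 * (om p)^-1 * ((z - om p)^-1 - (om p)^-1).
Proof. by move=> h1 h2; field; rewrite h1 h2. Qed.

(** [wp_term] factors the difference so that its order |w|^-3 is visible; the origin, whose term is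
    1 / z^2, is split off. *)
Lemma wp_summ z : good xpredT tau z ->
  summ (fun p : int * int => ((z - om p) ^+ 2)^-1 - (om p ^+ 2)^-1).
Proof.
move=> hg; have [d d0 hd] := lattice_far hg.
have [c [K [c0 hc [M [M0 hM hV]]]]] := lattice_summ htau.
pose g p := ((z - om p) ^+ 2)^-1 - (om p ^+ 2)^-1.
change (summ g).
have -> : g = fun p => (if p == (0, 0) then g p else 0) + (if p == (0, 0) then 0 else g p).
  by apply/funext => p; case: eqP; rewrite ?addr0 ?add0r.
apply: summD; first by apply: (@summ1 _ _ (0, 0)) => p /negPf ->.
pose L := nm z * d^-1 * (d^-1 + 1).
have di : 0 <= d^-1 by rewrite invr_ge0 ltW.
have L0 : 0 <= L by rewrite !mulr_ge0 ?nm_ge0 // addr_ge0.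
apply: (@summ_le _ _ _ (fun p => L * M p) (L * K)) => [p|T]; last first.
  by rewrite -mulr_sumr ler_wpM2l.
case: (eqVneq p (0, 0)) => [->|p0]; first by rewrite nm0 mulr_ge0.
have o0 : 0 < nm (om p) := lt_le_trans c0 (hc p p0).
have oc : om p != 0 by rewrite -nm_gt0.
have zo : 0 < nm (z - om p) by apply: lt_le_trans (hd p); rewrite mulr_gt0.
have zc : z - om p != 0 by rewrite -nm_gt0.
rewrite /g wp_term // !nmM !nmV.
apply: le_trans (_ : L * (nm (om p) ^+ 3)^-1 <= _); last by rewrite ler_wpM2l ?hV.
have b1 : (nm (z - om p))^-1 <= d^-1 * (nm (om p))^-1.
  by rewrite -invfM lef_pV2 ?posrE // mulr_gt0.
have b2 : nm ((z - om p)^-1 - (om p)^-1) <= (d^-1 + 1) * (nm (om p))^-1.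
  by apply: le_trans (nmB _ _) _; rewrite mulrDl mul1r !nmV lerD2r.
have i0 : 0 <= (nm (om p))^-1 by rewrite invr_ge0 ltW.
have -> : L * (nm (om p) ^+ 3)^-1 = nm z * (d^-1 * (nm (om p))^-1) * (nm (om p))^-1 *
   ((d^-1 + 1) * (nm (om p))^-1).
  by rewrite /L; field; rewrite !gt_eqF.
apply: ler_pM; rewrite ?nm_ge0 ?mulr_ge0 ?invr_ge0 ?nm_ge0 //.
by rewrite ler_wpM2r // ler_wpM2l ?nm_ge0.
Qed.

Lemma wpP z : good xpredT tau z ->
  has_sum (fun p : int * int => ((z - om p) ^+ 2)^-1 - (om p ^+ 2)^-1) (wp tau z).
Proof.
move=> hg; have [l hl] := summ_has_sum (wp_summ hg).
suff -> : wp tau z = l by [].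
rewrite /wp (@lattice_sumE _ _ htau _ (l - (z ^+ 2)^-1)); first by rewrite addrC subrK.
have h0 : has_sum (fun p : int * int => if p == (0, 0) then (z ^+ 2)^-1 else 0) (z ^+ 2)^-1.
  have := @has_sum1 R _ (fun p : int * int => if p == (0, 0) then (z ^+ 2)^-1 else 0) (0, 0).
  by rewrite eqxx; apply => j /negPf ->.
apply: eq_has_sum (has_sumB hl h0) => p /=.
case: (eqVneq p (0, 0)) => [->|_]; last by rewrite subr0.
by rewrite omega0 // subr0 expr0n invr0 subr0 subrr.
Qed.

(** The double sum is taken row by row. By [row2], row n of 1 / (z - w)^2 is ss(z - n tau), and row
    n of 1 / w^2 is ss(n tau), or pi^2 / 3 for n = 0 by [zeta2]; the latter add up to [e2]. *)
Lemma wpE z : good xpredT tau z -> wp tau z = Ser xpredT 1%:P 0 tau z - e2 tau.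
Proof.
move=> hg.
pose r n := ss (z - n%:~R * tau) - (if n == 0 then piC ^+ 2 / 3 else ss (n%:~R * tau)).
have hr : has_sum r (wp tau z).
  apply: has_sum_sigma (wpP hg) _ => n; apply: has_sumB.
    have hn : ~ isint (z - n%:~R * tau).
      by have := goodT (n := - n) hg; rewrite mulrNz mulNr.
    have := has_sum_bij (@opprK int) (@opprK int) (row2 hn).
    by apply: eq_has_sum => m /=; rewrite /omega /= mulrNz opprD addrA addrAC.
  have [->|n0] := eqVneq n 0.
    by apply: eq_has_sum zeta2 => m; rewrite /omega /= mul0r addr0.
  have hn : ~ isint (n%:~R * tau).
    by have [_ /(_ n n0)] := good_nz htau; rewrite add0r.
  by apply: eq_has_sum (row2 hn) => m; rewrite /omega /= addrC.
apply: has_sum_unique hr _.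
have h1 := has_sum_bij (@opprK int) (@opprK int) (SerP 1%:P 0 hg).
have h2 : has_sum (fun n : int => if n == 0 then piC ^+ 2 / 3 else 0 : C) (piC ^+ 2 / 3).
  have := @has_sum1 R _ (fun n : int => if n == 0 then piC ^+ 2 / 3 else 0) 0.
  by rewrite eqxx; apply => j /negPf ->.
rewrite e2E //.
apply: eq_has_sum (has_sumB h1 (has_sumD h2 (SerP 1%:P 0 (good_nz htau)))) => n.
rewrite /r /term /= !hornerC !expr0 !mul1r !mulr1 mulrNz mulNr; congr (_ - _).
rewrite /nz add0r; case: eqVneq => [_|_] /=; first by rewrite mul0r addr0.
by rewrite mul1r add0r.
Qed.

End FixedTau.
End Weierstrass.

(** * The differential equation of wp and its constant term at z = 0 *)

Section NearZero.
Context {R : realType}.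
Local Notation C := R[i].
Variable tau : C.
Hypothesis htau : upper_half_plane tau.
Local Notation om := (omega tau).
Implicit Types (z w : C) (p : int * int).

Lemma cot_deriv1 : cot_deriv (1%:P : {poly C}) = - (2%:P * 'X).
Proof. by rewrite /cot_deriv derivC mulr0 add0r mulr1. Qed.

Lemma cot_deriv1E c : (cot_deriv (1%:P : {poly C})).[c] = - 2 * c.
Proof. by rewrite cot_deriv1 hornerN hornerM hornerC hornerX; ring. Qed.

Lemma cot_deriv11E c : (cot_deriv (cot_deriv (1%:P : {poly C}))).[c] =
  6 * (c ^+ 2 + piC ^+ 2) - 4 * piC ^+ 2.
Proof.
rewrite cot_derivE cot_deriv1E cot_deriv1 derivN derivM derivC derivX mul0r add0r.
by rewrite mulr1 hornerN hornerC; ring.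
Qed.

Lemma Ser_comb P (a b : C) (f g h : {poly C}) j z : good P tau z ->
  (forall c, f.[c] = a * g.[c] + b * h.[c]) ->
  Ser P f j tau z = a * Ser P g j tau z + b * Ser P h j tau z.
Proof.
move=> hg e; apply: has_sum_unique (SerP _ _ hg) _.
apply: eq_has_sum (has_sumD (has_sumZ a (SerP g j hg)) (has_sumZ b (SerP h j hg))) => n.
by rewrite /term e; ring.
Qed.

(** As [S] is wp + e2, this is wp'' = 6 wp^2 + constant, with the constant still in terms of e2 and
    its tau-derivative. It follows from [Ser_sqr] because the second derivative of [ss] is 6 ss^2 -
    4 pi^2 ss. *)
Lemma Ser_ode z : good xpredT tau z ->
  let S := Ser xpredT 1%:P 0 tau z in
  Ser xpredT (cot_deriv (cot_deriv 1%:P)) 0 tau z =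
  6 * S ^+ 2 - 12 * S * e2 tau - 12 * ipi * Ser nz (cot_deriv 1%:P) 1 tau 0.
Proof.
move=> hg S; have h := Ser_sqr hg; rewrite -/S in h.
have hn := good_nz htau.
have e1 : Ser nz (cot_deriv 1%:P) 1 tau 0 = - 2 * Ser nz 'X 1 tau 0 + 0 * Ser nz 'X 1 tau 0.
  by apply: Ser_comb => // c; rewrite cot_deriv1E hornerX; ring.
have e2' : Ser xpredT (cot_deriv (cot_deriv 1%:P)) 0 tau z =
   6 * Ser xpredT ('X^2 + (piC ^+ 2)%:P) 0 tau z + - 4 * piC ^+ 2 * S.
  apply: Ser_comb => // c.
  by rewrite cot_deriv11E hornerD hornerXn !hornerC; ring.
rewrite e2' e1 e2E // h.
move: (Ser xpredT _ _ _ _) (Ser nz _ _ _ _) (Ser nz _ _ _ _) => s0 s1 s2.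
by field.
Qed.

Definition ifom (f : int * int -> C) p : C := if p == (0, 0) then 0 else f p.

Lemma ifom_has (f : int * int -> C) (K : R) : 0 <= K ->
  (forall p, p != (0, 0) -> nm (f p) <= K * (nm (om p) ^+ 3)^-1) ->
  has_sum (ifom f) (xget 0 (has_sum (ifom f))).
Proof.
move=> K0 h; have [c [B [c0 hc [M [M0 hM hV]]]]] := lattice_summ htau.
have [l hl] : exists l, has_sum (ifom f) l; last exact: (xgetI 0 hl).
apply: summ_has_sum.
apply: (@summ_le _ _ _ (fun p => K * M p) (K * B)) => [p|T]; last first.
  by rewrite -mulr_sumr ler_wpM2l.
rewrite /ifom; case: eqVneq => [_|p0]; first by rewrite nm0 mulr_ge0.
by apply: le_trans (h p p0) _; rewrite ler_wpM2l ?hV.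
Qed.

(** [cderiv_sum] with the majorant |w|^-3 of [lattice_summ]. *)
Lemma ifom_deriv (phi dphi : int * int -> C -> C) (F : C -> C) D (rho K : R) x :
  0 <= K -> nm x < rho ->
  (forall p z, p != (0, 0) -> nm z < rho -> cderiv (phi p) z (dphi p z)) ->
  (forall p z, p != (0, 0) -> nm z < rho ->
    nm (dphi p z) <= K * (nm (om p) ^+ 3)^-1) ->
  (forall z, nm z < rho -> has_sum (ifom (phi^~ z)) (F z)) ->
  has_sum (ifom (dphi^~ x)) D -> cderiv F x D.
Proof.
move=> K0 xr hd hb hF hD.
have [c [B [c0 hc [M [M0 hM hV]]]]] := lattice_summ htau.
have sm h : nm h < rho - nm x -> nm (x + h) < rho.
  by move=> hh; apply: le_lt_trans (nmD _ _) _; lra.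
apply: (@cderiv_sum R _ (fun p z => ifom (phi^~ z) p) (fun p z => ifom (dphi^~ z) p)
   F D (fun p => K * M p) (K * B) (rho - nm x)) => //.
- lra.
- move=> p h hh; rewrite /ifom; case: eqVneq => [_|p0]; first exact: cderiv_cst.
  by apply: hd => //; exact: sm.
- move=> p h hh; rewrite /ifom; case: eqVneq => [_|p0]; first by rewrite nm0 mulr_ge0.
  by apply: le_trans (hb p _ p0 (sm _ hh)) _; rewrite ler_wpM2l ?hV.
- by move=> T; rewrite -mulr_sumr ler_wpM2l.
- by move=> h hh; apply: hF; exact: sm.
Qed.

Definition uu p z : C := (z - om p)^-1.
Definition v0 p : C := (om p)^-1.

Lemma near_lattice : exists c : R, 0 < c /\ forall p z, p != (0, 0) -> nm z < c / 2 ->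
  [/\ om p != 0, z - om p != 0, nm (uu p z) <= 2 * nm (v0 p) & nm (v0 p) <= c^-1].
Proof.
have [c [B [c0 hc _]]] := lattice_summ htau.
exists c; split=> // p z p0 hz; have h := hc p p0.
have o0 : 0 < nm (om p) by exact: lt_le_trans h.
have lo : nm (om p) / 2 <= nm (z - om p).
  have := nm_ge (om p) (- z); rewrite nmN nm_distC; lra.
have z0 : 0 < nm (z - om p) by apply: lt_le_trans lo; rewrite divr_gt0.
split; rewrite -?nm_gt0 //.
  by rewrite /uu /v0 !nmV -[2 * _]invf_div lef_pV2 ?posrE // divr_gt0.
by rewrite /v0 nmV lef_pV2 ?posrE.
Qed.

Lemma uu_deriv p z : z - om p != 0 -> cderiv (uu p) z (- uu p z ^+ 2).
Proof.
move=> h; have := cderivV (f := fun z => z - om p) h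
  (cderivD (cderiv_id z) (cderiv_cst (- om p) z)).
by rewrite addr0 mulN1r -exprVn.
Qed.

Lemma uuX_deriv p z n : z - om p != 0 ->
  cderiv (fun y => uu p y ^+ n.+1) z (- n.+1%:R * uu p z ^+ n.+2).
Proof.
move=> h; have := cderivX n.+1 (uu_deriv h).
by congr cderiv; rewrite /= !exprS expr0 mulr1; ring.
Qed.

(** The constant terms of [Ser_ode] at z = 0. There wp = z^-2 + F2 and wp'' = 6 z^-4 + 6 F4, where
    F2 = z^2 Fk, Fk(0) = 3 e4 and F4(0) = e4. The poles cancel, so 12 Fk + 6 z^4 Fk^2 - 6 F4 is
    constant off 0, and its value at 0 is 36 e4 - 6 e4. *)
Lemma e4E : 30 * e4 tau =
  6 * e2 tau ^+ 2 + 12 * ipi * Ser nz (cot_deriv 1%:P) 1 tau 0.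
Proof.
have [c [c0 hc]] := near_lattice.
pose rho := c / 2.
have rho0 : 0 < rho by rewrite divr_gt0.
pose i p := nm (v0 p).
have i0 p : 0 <= i p by exact: nm_ge0.
have i3 p : (nm (om p) ^+ 3)^-1 = i p ^+ 3 by rewrite /i /v0 nmV exprVn.
have c1 : 0 <= c^-1 by rewrite invr_ge0 ltW.
have ule p z : p != (0, 0) -> nm z < rho -> forall n, nm (uu p z ^+ n) <= 2 ^+ n * i p ^+ n.
  move=> p0 hz n; have [_ _ h _] := hc p z p0 hz.
  by rewrite nmX -exprMn lerXn2r ?nnegrE ?nm_ge0 ?mulr_ge0.
have ic p : p != (0, 0) -> i p <= c^-1.
  by move=> p0; have [|_ _ _] := hc p 0 p0; rewrite ?nm0.
have ipow p k : p != (0, 0) -> i p ^+ (3 + k) <= c^-1 ^+ k * i p ^+ 3.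
  move=> p0; rewrite exprD mulrC ler_wpM2r ?exprn_ge0 // lerXn2r ?nnegrE // ic //.
pose F2 z := xget 0 (has_sum (ifom (fun p => uu p z ^+ 2 - v0 p ^+ 2))).
pose F3 z := xget 0 (has_sum (ifom (fun p => uu p z ^+ 3))).
pose F4 z := xget 0 (has_sum (ifom (fun p => uu p z ^+ 4))).
(* Here uu^2 - v0^2 = 2 z v0^3 + z^2 (v0^2 uu^2 - 2 v0^3 uu), and the sum of the v0^3 vanishes by
   parity. *)
pose Fk z := xget 0 (has_sum (ifom (fun p => v0 p ^+ 2 * uu p z ^+ 2 - 2 * v0 p ^+ 3 * uu p z))).
have bu p z n (K : R) : p != (0, 0) -> nm z < rho ->
    nm (uu p z ^+ (3 + n)) <= 2 ^+ (3 + n) * c^-1 ^+ n * (nm (om p) ^+ 3)^-1.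
  move=> p0 hz; apply: le_trans (ule p z p0 hz _) _.
  by rewrite -mulrA ler_wpM2l ?exprn_ge0 // i3 ipow.
have ci k : 0 <= c^-1 ^+ k by rewrite exprn_ge0.
have h2 z : nm z < rho -> has_sum (ifom (fun p => uu p z ^+ 2 - v0 p ^+ 2)) (F2 z).
  move=> hz; apply: (@ifom_has _ (rho * 6)); first by rewrite mulr_ge0 // ltW.
  move=> p p0; have [n1 n2 _ _] := hc p z p0 hz.
  have -> : uu p z ^+ 2 - v0 p ^+ 2 = z * uu p z * v0 p * (uu p z - v0 p).
    by rewrite /uu /v0; field; rewrite n1 n2.
  have b1 := ule p z p0 hz 1; rewrite !expr1 in b1.
  have b2 : nm (uu p z - v0 p) <= 3 * i p.
    by apply: le_trans (nmB _ _) _; rewrite -/(i p); lra.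
  rewrite !nmM i3.
  have -> : rho * 6 * i p ^+ 3 = rho * (2 * i p) * i p * (3 * i p) by ring.
  by apply: ler_pM; rewrite ?mulr_ge0 ?nm_ge0 //; apply: ler_pM;
    rewrite ?mulr_ge0 ?nm_ge0 //; apply: ler_pM; rewrite ?nm_ge0 // ltW.
have h3 z : nm z < rho -> has_sum (ifom (fun p => uu p z ^+ 3)) (F3 z).
  move=> hz; apply: (@ifom_has _ (2 ^+ (3 + 0) * c^-1 ^+ 0)).
    by rewrite mulr_ge0 ?exprn_ge0.
  by move=> p p0; exact: (bu p z 0%N 0).
have h4 z : nm z < rho -> has_sum (ifom (fun p => uu p z ^+ 4)) (F4 z).
  move=> hz; apply: (@ifom_has _ (2 ^+ (3 + 1) * c^-1 ^+ 1)).
    by rewrite mulr_ge0 ?exprn_ge0.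
  by move=> p p0; exact: (bu p z 1%N 0).
have h5 z : nm z < rho -> has_sum (ifom (fun p => uu p z ^+ 5))
    (xget 0 (has_sum (ifom (fun p => uu p z ^+ 5)))).
  move=> hz; apply: (@ifom_has _ (2 ^+ (3 + 2) * c^-1 ^+ 2)).
    by rewrite mulr_ge0 ?exprn_ge0.
  by move=> p p0; exact: (bu p z 2%N 0).
have hk z : nm z < rho ->
    has_sum (ifom (fun p => v0 p ^+ 2 * uu p z ^+ 2 - 2 * v0 p ^+ 3 * uu p z)) (Fk z).
  move=> hz; apply: (@ifom_has _ (8 * c^-1)); first by rewrite mulr_ge0.
  move=> p p0; have b1 := ule p z p0 hz 1; have b2 := ule p z p0 hz 2.
  rewrite !expr1 in b1; apply: le_trans (nmB _ _) _; rewrite i3.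
  have -> : nm (2 * v0 p ^+ 3 * uu p z) = 2 * i p ^+ 3 * nm (uu p z).
    by rewrite [LHS]nmM [nm (2 * _)]nmM nm_nat nmX.
  have -> : nm (v0 p ^+ 2 * uu p z ^+ 2) = i p ^+ 2 * nm (uu p z ^+ 2).
    by rewrite [LHS]nmM [nm (v0 p ^+ 2)]nmX.
  have t1 : i p ^+ 2 * nm (uu p z ^+ 2) <= i p ^+ 2 * (2 ^+ 2 * i p ^+ 2).
    by rewrite ler_wpM2l ?exprn_ge0.
  have t2 : 2 * i p ^+ 3 * nm (uu p z) <= 2 * i p ^+ 3 * (2 * i p).
    by rewrite ler_wpM2l ?mulr_ge0 ?exprn_ge0.
  have := ipow p 1%N p0; rewrite expr1 => t3.
  have e1 : i p ^+ 2 * (2 ^+ 2 * i p ^+ 2) = 4 * i p ^+ (3 + 1) by ring.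
  have e2 : 2 * i p ^+ 3 * (2 * i p) = 4 * i p ^+ (3 + 1) by ring.
  lra.
have n2 p z : p != (0, 0) -> nm z < rho -> z - om p != 0.
  by move=> p0 hz; have [] := hc p z p0 hz.
have d2 z : nm z < rho -> cderiv F2 z (- 2 * F3 z).
  move=> hz; apply: (@ifom_deriv (fun p z => uu p z ^+ 2 - v0 p ^+ 2)
    (fun p z => - 2 * uu p z ^+ 3 + 0) _ _ rho (2 * 8) _ _ hz) => // [p y p0 hy|p y p0 hy|].
  - by have := cderivD (uuX_deriv 1 (n2 p y p0 hy)) (cderiv_cst (- v0 p ^+ 2) y).
  - rewrite addr0 nmM nmN nm_nat -mulrA ler_wpM2l //.
    by have := bu p y 0%N 0 p0 hy; rewrite expr0 mulr1; congr (_ <= _ * _); ring.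
  - apply: eq_has_sum (has_sumZ (- 2) (h3 z hz)) => p.
    by rewrite /ifom; case: eqP; rewrite ?mulr0 ?addr0.
have d3 z : nm z < rho -> cderiv F3 z (- 3 * F4 z).
  move=> hz; apply: (@ifom_deriv (fun p z => uu p z ^+ 3)
    (fun p z => - 3 * uu p z ^+ 4) _ _ rho (3 * (2 ^+ (3 + 1) * c^-1 ^+ 1)) _ _ hz) => //
    [|p y p0 hy|p y p0 hy|].
  - by rewrite !mulr_ge0 ?exprn_ge0.
  - exact: uuX_deriv (n2 p y p0 hy).
  - rewrite nmM nmN nm_nat -[leRHS]mulrA ler_wpM2l //.
    exact: (bu p y 1%N 0).
  - apply: eq_has_sum (has_sumZ (- 3) (h4 z hz)) => p.
    by rewrite /ifom; case: eqP; rewrite ?mulr0.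
have d4 : exists D, cderiv F4 0 D.
  have z0 : nm (0 : C) < rho by rewrite nm0.
  exists (- 4 * xget 0 (has_sum (ifom (fun p => uu p 0 ^+ 5)))).
  apply: (@ifom_deriv (fun p z => uu p z ^+ 4)
    (fun p z => - 4 * uu p z ^+ 5) _ _ rho (4 * (2 ^+ (3 + 2) * c^-1 ^+ 2)) _ _ z0) => //
    [|p y p0 hy|p y p0 hy|].
  - by rewrite !mulr_ge0 ?exprn_ge0.
  - exact: uuX_deriv (n2 p y p0 hy).
  - rewrite nmM nmN nm_nat -[leRHS]mulrA ler_wpM2l //.
    exact: (bu p y 2%N 0).
  - apply: eq_has_sum (has_sumZ (- 4) (h5 0 z0)) => p.
    by rewrite /ifom; case: eqP; rewrite ?mulr0.
have dk : exists D, cderiv Fk 0 D.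
  have z0 : nm (0 : C) < rho by rewrite nm0.
  pose dphi p z := - 2 * v0 p ^+ 2 * uu p z ^+ 3 + 2 * v0 p ^+ 3 * uu p z ^+ 2.
  have bd p y : p != (0, 0) -> nm y < rho ->
      nm (dphi p y) <= 24 * c^-1 ^+ 2 * (nm (om p) ^+ 3)^-1.
    move=> p0 hy; have b3 := ule p y p0 hy 3; have b2 := ule p y p0 hy 2.
    apply: le_trans (nmD _ _) _; rewrite i3.
    have -> : nm (2 * v0 p ^+ 3 * uu p y ^+ 2) = 2 * i p ^+ 3 * nm (uu p y ^+ 2).
      by rewrite [LHS]nmM [nm (2 * _)]nmM nm_nat nmX.
    have -> : nm (- 2 * v0 p ^+ 2 * uu p y ^+ 3) = 2 * i p ^+ 2 * nm (uu p y ^+ 3).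
      by rewrite [LHS]nmM [nm (- 2 * _)]nmM nmN nm_nat [nm (v0 p ^+ 2)]nmX.
    have t1 : 2 * i p ^+ 2 * nm (uu p y ^+ 3) <= 2 * i p ^+ 2 * (2 ^+ 3 * i p ^+ 3).
      by rewrite ler_wpM2l ?mulr_ge0 ?exprn_ge0.
    have t2 : 2 * i p ^+ 3 * nm (uu p y ^+ 2) <= 2 * i p ^+ 3 * (2 ^+ 2 * i p ^+ 2).
      by rewrite ler_wpM2l ?mulr_ge0 ?exprn_ge0.
    have t3 := ipow p 2%N p0.
    have e1 : 2 * i p ^+ 2 * (2 ^+ 3 * i p ^+ 3) = 16 * i p ^+ (3 + 2) by ring.
    have e2 : 2 * i p ^+ 3 * (2 ^+ 2 * i p ^+ 2) = 8 * i p ^+ (3 + 2) by ring.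
    lra.
  have K0 : 0 <= 24 * c^-1 ^+ 2 by rewrite mulr_ge0 ?exprn_ge0.
  exists (xget 0 (has_sum (ifom (dphi^~ 0)))).
  apply: (@ifom_deriv (fun p z => v0 p ^+ 2 * uu p z ^+ 2 - 2 * v0 p ^+ 3 * uu p z)
    dphi _ _ rho _ _ K0 z0 _ bd hk); last first.
    by apply: (ifom_has K0) => p p0; exact: bd.
  move=> p y p0 hy; have n0 := n2 p y p0 hy.
  have := cderivD (cderivM (cderiv_cst (v0 p ^+ 2) y) (uuX_deriv 1 n0))
     (cderivM (cderiv_cst (- (2 * v0 p ^+ 3)) y) (uu_deriv n0)).
  have -> : 0 * uu p y ^+ 2 + v0 p ^+ 2 * (- 2 * uu p y ^+ 3) +
     (0 * uu p y + - (2 * v0 p ^+ 3) * - uu p y ^+ 2) = dphi p y by rewrite /dphi; ring.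
  by apply: (@cderiv_near _ _ _ _ _ 1 ltr01) => h _; rewrite mulNr.
have z0 : nm (0 : C) < rho by rewrite nm0.
have F40 : F4 0 = e4 tau.
  rewrite /e4; apply/esym/lattice_sumE => //.
  apply: eq_has_sum (h4 0 z0) => p; rewrite /ifom; case: eqP => // _.
  by rewrite /uu sub0r invrN -[4%N]/(2 * 2)%N exprM sqrrN -exprM exprVn.
have Fk0 : Fk 0 = 3 * e4 tau.
  rewrite -F40; apply: has_sum_unique (hk 0 z0) _.
  apply: eq_has_sum (has_sumZ 3 (h4 0 z0)) => p.
  rewrite /ifom; case: eqP; rewrite ?mulr0 // => _.
  by rewrite /uu /v0 sub0r invrN; ring.
have v3 : has_sum (ifom (fun p => v0 p ^+ 3)) 0.
  have h := h3 0 z0.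
  have hN : has_sum (ifom (fun p => v0 p ^+ 3)) (- F3 0).
    apply: eq_has_sum (has_sumN h) => p.
    rewrite /ifom; case: eqP => _; rewrite ?oppr0 // /uu /v0 sub0r invrN.
    by ring.
  pose neg p : int * int := (- p.1, - p.2).
  have negK : cancel neg neg by move=> [a b]; rewrite /neg /= !opprK.
  have e : - F3 0 = F3 0.
    apply: has_sum_unique (has_sum_bij negK negK hN) _; apply: eq_has_sum h => -[a b].
    rewrite /ifom /= /neg /= !xpair_eqE !oppr_eq0; case: andP => // _.
    rewrite /uu /v0 sub0r /omega /= !mulrNz; congr (_^-1 ^+ 3); ring.
  have -> : 0 = - F3 0; last exact: hN.
  by apply/esym/eqP; move/eqP: e; rewrite oppr_eq0 eq_sym -addr_eq0 -mulr2n mulrn_eq0.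
have Fk2 z : nm z < rho -> F2 z = z ^+ 2 * Fk z.
  move=> hz; rewrite -[RHS]addr0 -(mulr0 (2 * z)).
  apply: has_sum_unique (h2 z hz) _.
  apply: eq_has_sum (has_sumD (has_sumZ (z ^+ 2) (hk z hz)) (has_sumZ (2 * z) v3)) => p.
  rewrite /ifom; case: eqVneq => [|p0]; rewrite ?mulr0 ?addr0 //.
  have [n1 n3 _ _] := hc p z p0 hz.
  by rewrite /uu /v0; field; rewrite n1 n3.
have hgood z : z != 0 -> nm z < rho -> good xpredT tau z.
  move=> zn0 hz; apply/good_off; split => //= -[m [n e]].
  have [p0|p0] := eqVneq (n, m) (0, 0).
    by move: p0 zn0 => [n0 m0]; rewrite e n0 m0 mul0r addr0 eqxx.
  by have := n2 (n, m) z p0 hz; rewrite e /omega /= subrr eqxx.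
pose S z := Ser xpredT 1%:P 0 tau z.
have SE z : z != 0 -> nm z < rho -> S z = z^-1 ^+ 2 + F2 z + e2 tau.
  move=> zn0 hz; have hg := hgood z zn0 hz.
  have := wpE htau hg; rewrite -/(S z).
  have -> : wp tau z = z^-1 ^+ 2 + F2 z.
    rewrite /wp exprVn; congr (_ + _); apply: lattice_sumE => //.
    apply: eq_has_sum (h2 z hz) => p; rewrite /ifom; case: eqP => // _.
    by rewrite /uu /v0 !exprVn.
  by move=> ->; rewrite subrK.
have dinv n z : z != 0 -> cderiv (fun y : C => y^-1 ^+ n.+1) z (- n.+1%:R * z^-1 ^+ n.+2).
  move=> zn0; have := cderivX n.+1 (cderivV (f := id) zn0 (cderiv_id z)).
  by congr cderiv; rewrite /= mulN1r -exprVn !exprS expr0 mulr1; ring.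
have near0 (z : C) : z != 0 -> nm z < rho -> exists2 r : R, 0 < r &
    forall h, nm h < r -> z + h != 0 /\ nm (z + h) < rho.
  move=> zn0 hz; exists (Num.min (nm z) (rho - nm z)).
    by rewrite lt_min nm_gt0 zn0 subr_gt0.
  move=> h; rewrite lt_min => /andP[a b]; split.
    by rewrite -nm_gt0; apply: lt_le_trans (nm_ge _ _); rewrite subr_gt0.
  by apply: le_lt_trans (nmD _ _) _; rewrite -ltrBrDl.
have S1E z : z != 0 -> nm z < rho ->
    Ser xpredT (cot_deriv 1%:P) 0 tau z = - 2 * z^-1 ^+ 3 - 2 * F3 z.
  move=> zn0 hz; have [r r0 hr] := near0 z zn0 hz.
  apply: cderiv_unique (Ser_dz _ _ (hgood z zn0 hz)) _.
  have -> : - 2 * z^-1 ^+ 3 - 2 * F3 z = - 2 * z^-1 ^+ 3 + - 2 * F3 z + 0 by ring.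
  apply: (cderiv_near r0 _
    (cderivD (cderivD (dinv 1%N z zn0) (d2 z hz)) (cderiv_cst (e2 tau) z))) => h hh.
  by have [a b] := hr h hh; rewrite -SE.
have S2E z : z != 0 -> nm z < rho ->
    Ser xpredT (cot_deriv (cot_deriv 1%:P)) 0 tau z = 6 * z^-1 ^+ 4 + 6 * F4 z.
  move=> zn0 hz; have [r r0 hr] := near0 z zn0 hz.
  apply: cderiv_unique (Ser_dz _ _ (hgood z zn0 hz)) _.
  have -> : 6 * z^-1 ^+ 4 + 6 * F4 z =
    0 * z^-1 ^+ 3 + -2 * (- 3 * z^-1 ^+ 4) + (0 * F3 z + -2 * (-3 * F4 z)) by ring.
  apply: (cderiv_near r0 _ (cderivD (cderivM (cderiv_cst (- 2) z) (dinv 2%N z zn0))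
     (cderivM (cderiv_cst (- 2) z) (d3 z hz)))) => h hh.
  by have [a b] := hr h hh; rewrite S1E // [- 2 * F3 _]mulNr.
set A := 6 * e2 tau ^+ 2 + _.
pose G z := 12 * Fk z + 6 * z ^+ 4 * Fk z ^+ 2 - 6 * F4 z.
have -> : 30 * e4 tau = G 0 by rewrite /G Fk0 F40; ring.
have [Dk hDk] := dk; have [D4 hD4] := d4.
have hG := cderivD (cderivD (cderivM (cderiv_cst 12 0) hDk)
  (cderivM (cderivM (cderiv_cst 6 0) (cderivX 4 (cderiv_id 0))) (cderivX 2 hDk)))
  (cderivM (cderiv_cst (- 6) 0) hD4).
apply: (cderiv_const_near rho0 _ (d := _)).
  by apply: (@cderiv_near _ _ _ _ _ 1 ltr01 _ hG) => h _; rewrite /G mulNr.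
move=> z zn0 hz; have := Ser_ode (hgood z zn0 hz); rewrite /= -/(S z).
rewrite S2E // SE // Fk2 // /G /A; move: (Fk z) (F4 z) (e2 tau) (Ser nz _ _ _ _) => a b d f.
move=> e.
have -> : 12 * a + 6 * z ^+ 4 * a ^+ 2 - 6 * b =
  12 * a + 6 * z ^+ 4 * a ^+ 2 + 6 * z^-1 ^+ 4 - (6 * z^-1 ^+ 4 + 6 * b) by ring.
by rewrite e; field.
Qed.

End NearZero.

(** * Heat equations and the derivatives of e2 and e4 *)

Section Formulas.
Context {R : realType}.
Local Notation C := R[i].
Implicit Types (tau z : C).

Lemma upper_near tau : upper_half_plane tau -> exists2 r : R, 0 < r &
  forall h, nm h < r -> upper_half_plane (tau + h).
Proof.
rewrite /upper_half_plane /= => h0; exists (complex.Im tau) => // h hh.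
have := Im_nm h; rewrite ImD ler_norml => /andP[]; lra.
Qed.

Lemma good_near tau z : good xpredT tau z -> exists2 r : R, 0 < r &
  forall h, nm h < r -> good xpredT tau (z + h) /\ good xpredT (tau + h) z.
Proof.
move=> hg; have [rho [M [B [r0 _ _ h]]]] := near_term 0 0 hg.
exists rho => // k hk.
have k0 (x : C) : nm (x - x) < rho by rewrite subrr nm0.
have kk (x : C) : nm (x + k - x) < rho by rewrite addrC addKr.
by have [h1 _] := h _ _ (k0 tau) (kk z); have [h2 _] := h _ _ (kk tau) (k0 z).
Qed.

Local Notation De2 tau := (Ser nz (cot_deriv 1%:P) 1 tau 0).
Local Notation cd := (@cot_deriv R).

Lemma e2_deriv tau : upper_half_plane tau -> cderiv e2 tau (De2 tau).
Proof.
move=> ht; have [r r0 hr] := upper_near ht.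
have := cderivD (cderiv_cst (piC ^+ 2 / 3) tau) (Ser_dtau 1%:P 0 (good_nz ht)).
rewrite add0r; apply: (cderiv_near r0) => h hh.
by rewrite e2E //; exact: hr.
Qed.

(** Ramanujan's formula, as [e4E] solved for the derivative of e2. *)
Lemma De2E tau : upper_half_plane tau ->
  2 * ipi * De2 tau = 5 * e4 tau - e2 tau ^+ 2.
Proof.
move=> ht; have := e4E ht; move: (De2 tau) (e4 tau) (e2 tau) => a b c e.
have -> : 5 * b - c ^+ 2 = (30 * b - 6 * c ^+ 2) / 6 by field.
by rewrite e; field.
Qed.

Section Point.
Variables tau z : C.
Hypothesis hg : good xpredT tau z.
Let ht : upper_half_plane tau. Proof. by case: hg. Qed.
Local Notation S := (Ser xpredT 1%:P 0 tau z).
Local Notation W := (wp tau z).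
Local Notation W1 := (Ser xpredT (cd 1%:P) 0 tau z).
Local Notation E := (Eis1 tau z).

Lemma wp_dz : cderiv (wp tau) z W1.
Proof.
have [r r0 hr] := good_near hg.
have := cderivD (Ser_dz 1%:P 0 hg) (cderiv_cst (- e2 tau) z).
rewrite addr0; apply: (cderiv_near r0) => h hh.
by rewrite wpE //; have [] := hr h hh.
Qed.

Lemma wp1_dz : cderiv (Ser xpredT (cd 1%:P) 0 tau) z (6 * W ^+ 2 - 30 * e4 tau).
Proof.
have := Ser_dz (cd 1%:P) 0 hg; congr cderiv.
rewrite (Ser_ode ht hg) /= wpE // e4E //; ring.
Qed.

Lemma E1_dz : cderiv (E1 tau) z (- (W + e2 tau)).
Proof.
have [r r0 hr] := good_near hg.
have -> : - (W + e2 tau) = Ser xpredT (- 1%:P) 0 tau z.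
  rewrite wpE // subrK.
  have -> : - S = - 1 * S + 0 * S by ring.
  by apply/esym/Ser_comb => // c; rewrite hornerN !hornerC; ring.
apply: (cderiv_near r0 _ (Eis1_dz hg)) => h hh.
by rewrite E1E //; have [] := hr h hh.
Qed.

Lemma Ser_m1 j : Ser xpredT (- 1%:P) j tau z = - Ser xpredT 1%:P j tau z.
Proof.
have -> : - Ser xpredT 1%:P j tau z = - 1 * Ser xpredT 1%:P j tau z + 0 * Ser xpredT 1%:P j tau z.
  by ring.
by apply: Ser_comb => // c; rewrite hornerN !hornerC; ring.
Qed.

Lemma Ser_X : Ser xpredT 'X 0 tau z = - 2^-1 * W1.
Proof.
have -> : - 2^-1 * W1 = - 2^-1 * W1 + 0 * W1 by ring.
by apply: Ser_comb => // c; rewrite hornerX cot_deriv1E; field.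
Qed.

Lemma Ser_dX : Ser xpredT (cd 'X) 0 tau z = - 2^-1 * Ser xpredT (cd (cd 1%:P)) 0 tau z.
Proof.
set A := Ser xpredT (cd (cd 1%:P)) 0 tau z.
have -> : - 2^-1 * A = - 2^-1 * A + 0 * A by ring.
by apply: Ser_comb => // c; rewrite cot_deriv11E cot_derivE derivX hornerX hornerC; field.
Qed.

Lemma E1_dtau : cderiv (E1^~ z) tau (- (E * S + 2^-1 * W1) / (2 * ipi)).
Proof.
have [r r0 hr] := good_near hg.
have -> : - (E * S + 2^-1 * W1) / (2 * ipi) = Ser xpredT (- 1%:P) 1 tau z.
  rewrite Ser_m1 Ser_mul_Eis1 // Ser_X.
  have ipi0 : ipi != 0 :> C by rewrite mulf_neq0 ?iC_neq0 ?piC_neq0.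
  move: ipi ipi0 => a a0; by field.
apply: (cderiv_near r0 _ (Eis1_dtau hg)) => h hh.
by rewrite E1E //; have [] := hr h hh.
Qed.

(* z-derivative of Ser_mul_Eis1 *)
Lemma heat1 : 2 * ipi * Ser xpredT (cd 1%:P) 1 tau z =
  - S ^+ 2 + E * W1 + 2^-1 * (6 * W ^+ 2 - 30 * e4 tau).
Proof.
have [r r0 hr] := good_near hg.
have h1 := cderivM (Eis1_dz hg) (Ser_dz 1%:P 0 hg).
have h2 := cderivD (Ser_dz 'X 0 hg) (cderivM (cderiv_cst (2 * ipi) z) (Ser_dz 1%:P 1 hg)).
have h3 : cderiv (fun y => Eis1 tau y * Ser xpredT 1%:P 0 tau y) z
    (Ser xpredT (cd 'X) 0 tau z + (0 * Ser xpredT 1%:P 1 tau z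
      + 2 * ipi * Ser xpredT (cd 1%:P) 1 tau z)).
  apply: (cderiv_near r0 _ h2) => h hh.
  by rewrite Ser_mul_Eis1 //; have [] := hr h hh.
have := cderiv_unique h1 h3; rewrite Ser_m1 Ser_dX.
rewrite (cderiv_unique (Ser_dz (cd 1%:P) 0 hg) wp1_dz).
move: (Ser xpredT (cd 1%:P) 1 tau z) => X e.
have -> : 2 * ipi * X = (- 2^-1 * (6 * W ^+ 2 - 30 * e4 tau) + (0 * Ser xpredT 1%:P 1 tau z + 2 * ipi * X))
   + 2^-1 * (6 * W ^+ 2 - 30 * e4 tau) by ring.
by rewrite -e; ring.
Qed.

Lemma wp_dtau : cderiv (wp^~ z) tau (Ser xpredT (cd 1%:P) 1 tau z - De2 tau).
Proof.
have [r r0 hr] := good_near hg.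
have -> : Ser xpredT (cd 1%:P) 1 tau z - De2 tau =
  Ser xpredT (cd 1%:P) 1 tau z + (0 * e2 tau + - 1 * De2 tau) by ring.
apply: (cderiv_near r0 _ (cderivD (Ser_dtau 1%:P 0 hg)
   (cderivM (cderiv_cst (- 1) tau) (e2_deriv ht)))) => h hh.
by rewrite mulN1r wpE //; have [_ []] := hr h hh.
Qed.

End Point.

Section Point2.
Variables tau z : C.
Hypothesis hg : good xpredT tau z.
Let ht : upper_half_plane tau. Proof. by case: hg. Qed.
Local Notation S := (Ser xpredT 1%:P 0 tau z).
Local Notation W := (wp tau z).
Local Notation W1 := (Ser xpredT (cd 1%:P) 0 tau z).
Local Notation W2 := (6 * W ^+ 2 - 30 * e4 tau).
Local Notation E := (Eis1 tau z).

Lemma Eis1_dzE : cderiv (Eis1 tau) z (- S).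
Proof. by rewrite -Ser_m1 //; exact: Eis1_dz. Qed.

Lemma W2_dz : cderiv (fun y => 6 * wp tau y ^+ 2 - 30 * e4 tau) z (12 * W * W1).
Proof.
have := cderivD (cderivM (cderiv_cst 6 z) (cderivX 2 (wp_dz hg))) (cderiv_cst (- (30 * e4 tau)) z).
by congr cderiv; rewrite /= expr1; ring.
Qed.

(* z-derivative of heat1 *)
Lemma heat2 : 2 * ipi * Ser xpredT (cd (cd 1%:P)) 1 tau z =
  - 3 * S * W1 + E * W2 + 6 * W * W1.
Proof.
have [r r0 hr] := good_near hg.
have h2 := cderivM (cderiv_cst (2 * ipi) z) (Ser_dz (cd 1%:P) 1 hg).
have h1 := cderivD (cderivD (cderivM (cderiv_cst (- 1) z) (cderivX 2 (Ser_dz 1%:P 0 hg)))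
   (cderivM Eis1_dzE (wp1_dz hg))) (cderivM (cderiv_cst 2^-1 z) W2_dz).
have h3 := cderiv_near r0 _ h1.
have := cderiv_unique h2 (h3 _ _); rewrite mul0r add0r => -> //.
  by rewrite /= expr1; field.
move=> h hh; rewrite heat1; last by have [] := hr h hh.
by rewrite mulN1r.
Qed.

End Point2.

Section Point3.
Variables tau z : C.
Hypothesis hg : good xpredT tau z.
Let ht : upper_half_plane tau. Proof. by case: hg. Qed.
Local Notation S := (Ser xpredT 1%:P 0 tau z).
Local Notation W := (wp tau z).
Local Notation W1 := (Ser xpredT (cd 1%:P) 0 tau z).
Local Notation W2 := (6 * W ^+ 2 - 30 * e4 tau).
Local Notation E := (Eis1 tau z).

(* z-derivative of heat2 *)
Lemma heat3 : 2 * ipi * Ser xpredT (cd (cd (cd 1%:P))) 1 tau z =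
  3 * W1 ^+ 2 - 4 * S * W2 + 12 * E * W * W1 + 6 * W * W2.
Proof.
have [r r0 hr] := good_near hg.
have h2 := cderivM (cderiv_cst (2 * ipi) z) (Ser_dz (cd (cd 1%:P)) 1 hg).
have h1 := cderivD (cderivD
   (cderivM (cderivM (cderiv_cst (- 3) z) (Ser_dz 1%:P 0 hg)) (wp1_dz hg))
   (cderivM (Eis1_dzE hg) (W2_dz hg)))
   (cderivM (cderivM (cderiv_cst 6 z) (wp_dz hg)) (wp1_dz hg)).
have h3 := cderiv_near r0 _ h1.
have := cderiv_unique h2 (h3 _ _); rewrite mul0r add0r => -> //.
  by ring.
by move=> h hh; rewrite heat2 //; have [] := hr h hh.
Qed.

Lemma wp1_dtau : cderiv (fun t => Ser xpredT (cd 1%:P) 0 t z) tau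
  (Ser xpredT (cd (cd 1%:P)) 1 tau z).
Proof. exact: Ser_dtau. Qed.

(** Differentiates 30 e4 = 6 wp^2 - wp'' in tau at a fixed z; hence an expression in wp and its
    derivatives for a function of tau alone. *)
Lemma e4_deriv : cderiv e4 tau ((12 * W * (Ser xpredT (cd 1%:P) 1 tau z - De2 tau)
   - Ser xpredT (cd (cd (cd 1%:P))) 1 tau z) / 30).
Proof.
have [r r0 hr] := good_near hg.
have h1 := cderivM (cderivD (cderivM (cderiv_cst 6 tau) (cderivX 2 (wp_dtau hg)))
   (cderivM (cderiv_cst (- 1) tau) (Ser_dtau (cd (cd 1%:P)) 0 hg))) (cderiv_cst 30^-1 tau).
have h2 := cderiv_near r0 _ h1.
have -> : (12 * W * (Ser xpredT (cd 1%:P) 1 tau z - De2 tau)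
   - Ser xpredT (cd (cd (cd 1%:P))) 1 tau z) / 30 =
   (0 * W ^+ 2 + 6 * (2%:R * W ^+ 2.-1 * (Ser xpredT (cd 1%:P) 1 tau z - De2 tau)) +
  (0 * Ser xpredT (cd (cd 1%:P)) 0 tau z + - 1 * Ser xpredT (cd (cd (cd 1%:P))) 1 tau z)) / 30 +
  (6 * W ^+ 2 + - 1 * Ser xpredT (cd (cd 1%:P)) 0 tau z) * 0.
  by rewrite /= expr1; field.
apply: h2 => h hh; have [_ hg'] := hr h hh.
by rewrite (cderiv_unique (Ser_dz (cd 1%:P) 0 hg') (wp1_dz hg')); field.
Qed.

End Point3.
End Formulas.

(** * Partial derivatives of the generators *)

Section DomainFunctions.
Context {R : realType}.
Local Notation C := R[i].
Local Notation D := (@dfun R).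
Implicit Types (tau z : C) (f g : D).

Definition kap : C := pi%:C / (2 * 'i).

Lemma kapE : kap = - ipi / 2.
Proof.
rewrite /kap /ipi -/(@piC R); apply: (mulfI iC_neq0).
have -> : 'i * (- ('i * piC) / 2) = - ('i ^+ 2) * piC / 2 :> C by rewrite expr2; ring.
by rewrite sqr_i opprK mul1r; field; exact: iC_neq0.
Qed.

Lemma ipi_neq0 : ipi != 0 :> C.
Proof. by rewrite mulf_neq0 ?iC_neq0 ?piC_neq0. Qed.

Lemma kap_neq0 : kap != 0.
Proof. by rewrite kapE mulf_neq0 ?oppr_eq0 ?ipi_neq0 // invr_eq0 pnatr_eq0. Qed.

Lemma domain_good (p : @domain R) : good xpredT (val p).1 (val p).2.
Proof. by apply/good_off; rewrite -surjective_pairing; exact: set_mem (valP p). Qed.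

Lemma ext0E f (p : @domain R) : ext0 f (val p).1 (val p).2 = f p.
Proof. by rewrite /ext0 -surjective_pairing valK. Qed.

Lemma ext0_restr (F : C -> C -> C) tau z : good xpredT tau z -> ext0 (restr F) tau z = F tau z.
Proof.
move=> /good_off/mem_set hg; rewrite /ext0; case: insubP => [p _ hp|]; last by rewrite hg.
by rewrite /= /restr hp.
Qed.

Lemma ext0D f g tau z : ext0 (f + g) tau z = ext0 f tau z + ext0 g tau z.
Proof. by rewrite /ext0; case: insubP => [p _ _|_] //=; rewrite addr0. Qed.

Lemma ext0M f g tau z : ext0 (f * g) tau z = ext0 f tau z * ext0 g tau z.
Proof. by rewrite /ext0; case: insubP => [p _ _|_] //=; rewrite mulr0. Qed.

Lemma ext0Z a f tau z : ext0 (a *: f) tau z = a * ext0 f tau z.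
Proof. by rewrite /ext0; case: insubP => [p _ _|_] //=; rewrite mulr0. Qed.

(** Differentiability together with the values. [dz] and [dtau] are total, so the rules of calculus
    are proved for this relation and then transferred to them. Dividing by [kap] undoes the
    normalisation of [dtau]. *)
Definition has_partials f (fz ft : D) := forall p : @domain R,
  cderiv (ext0 f (val p).1) (val p).2 (fz p) /\
  cderiv (ext0 f ^~ (val p).2) (val p).1 (ft p / kap).

Lemma has_partials_dz f fz ft : has_partials f fz ft -> dz f = fz.
Proof.
move=> h; apply/funext => p; rewrite /dz /restr derive1E.
by have [/cderiv_is_derive[_ ->] _] := h p.
Qed.

Lemma has_partials_dtau f fz ft : has_partials f fz ft -> dtau f = ft.
Proof.
move=> h; apply/funext => p.
rewrite /dtau -/kap -[LHS]/(kap * (derive1 (ext0 f ^~ (val p).2) (val p).1)) derive1E.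
have [_ /cderiv_is_derive[_ ->]] := h p.
by rewrite mulrC divfK // kap_neq0.
Qed.

Lemma has_partials_restr (F Fz Ft : C -> C -> C) :
  (forall tau z, good xpredT tau z -> cderiv (F tau) z (Fz tau z)) ->
  (forall tau z, good xpredT tau z -> cderiv (F ^~ z) tau (Ft tau z / kap)) ->
  has_partials (restr F) (restr Fz) (restr Ft).
Proof.
move=> hz ht p; have hg := domain_good p; have [r r0 hr] := good_near hg.
split.
  apply: (cderiv_near r0 _ (hz _ _ hg)) => h hh.
  by rewrite ext0_restr //; have [] := hr h hh.
apply: (cderiv_near r0 _ (ht _ _ hg)) => h hh.
by rewrite ext0_restr //; have [] := hr h hh.
Qed.

Lemma has_partials1 : has_partials 1 0 0.
Proof.
have := @has_partials_restr (fun _ _ => 1) (fun _ _ => 0) (fun _ _ => 0).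
apply=> t z _; first exact: cderiv_cst.
by rewrite mul0r; exact: cderiv_cst.
Qed.

Lemma has_partialsD f g fz ft gz gt : has_partials f fz ft -> has_partials g gz gt ->
  has_partials (f + g) (fz + gz) (ft + gt).
Proof.
move=> hf hg p; have [f1 f2] := hf p; have [g1 g2] := hg p; split.
  apply: (cderiv_near ltr01 _ (cderivD f1 g1)) => h _; exact/esym/ext0D.
have -> : (ft + gt) p / kap = ft p / kap + gt p / kap by rewrite -mulrDl.
apply: (cderiv_near ltr01 _ (cderivD f2 g2)) => h _; exact/esym/ext0D.
Qed.

Lemma has_partialsZ a f fz ft : has_partials f fz ft ->
  has_partials (a *: f) (a *: fz) (a *: ft).
Proof.
move=> hf p; have [f1 f2] := hf p; split.
  have := cderivM (cderiv_cst a (val p).2) f1; rewrite mul0r add0r.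
  apply: (cderiv_near ltr01) => h _; exact/esym/ext0Z.
have -> : (a *: ft) p / kap = a * (ft p / kap) by rewrite mulrA.
have := cderivM (cderiv_cst a (val p).1) f2; rewrite mul0r add0r.
apply: (cderiv_near ltr01) => h _; exact/esym/ext0Z.
Qed.

Lemma has_partialsM f g fz ft gz gt : has_partials f fz ft -> has_partials g gz gt ->
  has_partials (f * g) (fz * g + f * gz) (ft * g + f * gt).
Proof.
move=> hf hg p; have [f1 f2] := hf p; have [g1 g2] := hg p; split.
  have := cderivM f1 g1; rewrite !ext0E.
  apply: (cderiv_near ltr01) => h _; exact/esym/ext0M.
have -> : (ft * g + f * gt) p / kap = ft p / kap * g p + f p * (gt p / kap).
  rewrite mulrAC mulrA -mulrDl.
  by [].
have := cderivM f2 g2; rewrite !ext0E.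
apply: (cderiv_near ltr01) => h _; exact/esym/ext0M.
Qed.

Local Notation P := (@wpf R).
Local Notation P1 := (dz (@wpf R)).
Local Notation Q := (@e4f R).
Local Notation E := (@E1f R).
Local Notation G := (@e2f R).

(** The heat equations carry 2 i pi and [dtau] carries [kap]; their ratio [kap / (2 * ipi)] is
    -1/4. *)
Lemma kap_ipi (x : C) : x / (2 * ipi) = (- 4^-1 * x) / kap.
Proof. by rewrite kapE; field; exact: ipi_neq0. Qed.

Lemma mul_ipi (x y : C) : 2 * ipi * x = y -> x = (- 4^-1 * y) / kap.
Proof. by move=> <-; rewrite kapE; field; exact: ipi_neq0. Qed.

Lemma dz_wpf_restr : P1 = restr (fun tau z => Ser xpredT (cot_deriv 1%:P) 0 tau z).
Proof.
apply/funext => p; rewrite /dz /restr derive1E.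
have hg := domain_good p; have [r r0 hr] := good_near hg.
have : cderiv (ext0 P (val p).1) (val p).2
    (Ser xpredT (cot_deriv 1%:P) 0 (val p).1 (val p).2).
  apply: (cderiv_near r0 _ (wp_dz hg)) => h hh.
  by rewrite /wpf ext0_restr //; have [] := hr h hh.
by move=> /cderiv_is_derive[_ ->].
Qed.

Lemma P_partials : has_partials P P1
  (- 4^-1 *: (2 *: (P * P) - 2 *: (P * G) + E * P1 - 20 *: Q)).
Proof.
rewrite dz_wpf_restr.
have := @has_partials_restr wp (fun tau z => Ser xpredT (cot_deriv 1%:P) 0 tau z)
  (fun tau z => - 4^-1 * (2 * (wp tau z * wp tau z) - 2 * (wp tau z * e2 tau)
    + E1 tau z * Ser xpredT (cot_deriv 1%:P) 0 tau z - 20 * e4 tau)).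
apply=> tau z hg; first exact: wp_dz.
have := wp_dtau hg; congr cderiv; apply: mul_ipi.
rewrite mulrBr (heat1 hg) De2E; last by case: hg.
rewrite E1E // wpE //; last by case: hg.
by field.
Qed.

Lemma P1_partials : has_partials P1 (6 *: (P * P) - 30 *: Q)
  (- 4^-1 *: (3 *: (P * P1) - 3 *: (G * P1) + E * (6 *: (P * P) - 30 *: Q))).
Proof.
rewrite dz_wpf_restr.
have := @has_partials_restr (fun tau z => Ser xpredT (cot_deriv 1%:P) 0 tau z)
  (fun tau z => 6 * (wp tau z * wp tau z) - 30 * e4 tau)
  (fun tau z => - 4^-1 * (3 * (wp tau z * Ser xpredT (cot_deriv 1%:P) 0 tau z)
    - 3 * (e2 tau * Ser xpredT (cot_deriv 1%:P) 0 tau z)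
    + E1 tau z * (6 * (wp tau z * wp tau z) - 30 * e4 tau))).
apply=> tau z hg; first by rewrite -expr2; exact: wp1_dz.
have := wp1_dtau hg; congr cderiv; apply: mul_ipi.
rewrite (heat2 hg) E1E // wpE //; last by case: hg.
by ring.
Qed.

Lemma E_partials : has_partials E (- 1 *: (P + G))
  (4^-1 *: (E * (P + G) + 2^-1 *: P1)).
Proof.
rewrite dz_wpf_restr.
have := @has_partials_restr E1 (fun tau z => - 1 * (wp tau z + e2 tau))
  (fun tau z => 4^-1 * (E1 tau z * (wp tau z + e2 tau)
    + 2^-1 * Ser xpredT (cot_deriv 1%:P) 0 tau z)).
apply=> tau z hg; first by rewrite mulN1r; exact: E1_dz.
have := E1_dtau hg; congr cderiv.
rewrite kap_ipi E1E // wpE ?subrK //; last by case: hg.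
by congr (_ / _); ring.
Qed.

Lemma G_partials : has_partials G 0 (4^-1 *: (G * G - 5 *: Q)).
Proof.
have := @has_partials_restr (fun tau _ => e2 tau) (fun _ _ => 0)
  (fun tau _ => 4^-1 * (e2 tau * e2 tau - 5 * e4 tau)).
apply=> tau z hg; first exact: cderiv_cst.
have ht : upper_half_plane tau by case: hg.
have := e2_deriv ht; congr cderiv.
rewrite (mul_ipi (De2E ht)); congr (_ / _); ring.
Qed.

(** The combination 4 P^3 - 60 Q P - P1^2 is 140 times the Eisenstein series of weight 6, by the
    cubic equation of wp; left as a polynomial in the generators, it visibly lies in the algebra. *)
Lemma Q_partials : has_partials Q 0
  (- 240^-1 *: (24 *: (P * P * P) - 360 *: (Q * P) - 6 *: (P1 * P1) - 240 *: (G * Q))).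
Proof.
rewrite dz_wpf_restr.
have := @has_partials_restr (fun tau _ => e4 tau) (fun _ _ => 0)
  (fun tau z => - 240^-1 * (24 * (wp tau z * wp tau z * wp tau z) - 360 * (e4 tau * wp tau z)
    - 6 * (Ser xpredT (cot_deriv 1%:P) 0 tau z * Ser xpredT (cot_deriv 1%:P) 0 tau z)
    - 240 * (e2 tau * e4 tau))).
apply=> tau z hg; first exact: cderiv_cst.
have ht : upper_half_plane tau by case: hg.
have := e4_deriv hg; congr cderiv.
set lhs := _ / 30.
have : 2 * ipi * lhs = (12 * wp tau z * (2 * ipi * Ser xpredT (cot_deriv 1%:P) 1 tau z
   - 2 * ipi * Ser nz (cot_deriv 1%:P) 1 tau 0)
   - 2 * ipi * Ser xpredT (cot_deriv (cot_deriv (cot_deriv 1%:P))) 1 tau z) / 30.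
  by rewrite /lhs; ring.
rewrite (heat1 hg) (heat3 hg) De2E // => /mul_ipi ->; congr (_ / _).
have -> : Ser xpredT 1%:P 0 tau z = wp tau z + e2 tau by rewrite wpE // subrK.
by field.
Qed.

End DomainFunctions.

(** * Moyal products *)

Section Moyal.
Context {K : numFieldType} {A : comAlgType K}.
Variables (T Z : A -> A).
Hypothesis T_lin : linear T.
Hypothesis Z_lin : linear Z.
Hypothesis T_mul : forall f g, T (f * g) = T f * g + f * T g.
Hypothesis Z_mul : forall f g, Z (f * g) = Z f * g + f * Z g.
Hypothesis TZ_comm : forall f, T (Z f) = Z (T f).
Implicit Types f g h : A.

Let TB f g : T (f - g) = T f - T g.
Proof. by have := T_lin (-1) g f; rewrite !scaleN1r [in RHS]addrC => <-; rewrite addrC. Qed.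
Let ZB f g : Z (f - g) = Z f - Z g.
Proof. by have := Z_lin (-1) g f; rewrite !scaleN1r [in RHS]addrC => <-; rewrite addrC. Qed.
(** One factor T (x) Z - Z (x) T is applied to the arguments per step, which suits induction;
    [moyalE] recovers the binomial form. *)
Fixpoint moyal n f g : A :=
  if n is n'.+1 then moyal n' (T f) (Z g) - moyal n' (Z f) (T g) else f * g.

Lemma moyal_linl n a f f' g : moyal n (a *: f + f') g = a *: moyal n f g + moyal n f' g.
Proof.
elim: n f f' g => [|n IH] f f' g /=; first by rewrite mulrDl scalerAl.
by rewrite T_lin Z_lin !IH scalerBr opprD addrACA.
Qed.

Lemma moyal_linr n a f g g' : moyal n f (a *: g + g') = a *: moyal n f g + moyal n f g'.
Proof.
elim: n f g g' => [|n IH] f g g' /=; first by rewrite mulrDr scalerAr.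
by rewrite T_lin Z_lin !IH scalerBr opprD addrACA.
Qed.

Lemma moyalBl n f f' g : moyal n (f - f') g = moyal n f g - moyal n f' g.
Proof. by rewrite -scaleN1r addrC moyal_linl scaleN1r addrC. Qed.
Lemma moyalBr n f g g' : moyal n f (g - g') = moyal n f g - moyal n f g'.
Proof. by rewrite -scaleN1r addrC moyal_linr scaleN1r addrC. Qed.
Lemma moyalDl n f f' g : moyal n (f + f') g = moyal n f g + moyal n f' g.
Proof. by rewrite -{1}[f]scale1r moyal_linl scale1r. Qed.
Lemma moyalDr n f g g' : moyal n f (g + g') = moyal n f g + moyal n f g'.
Proof. by rewrite -{1}[g]scale1r moyal_linr scale1r. Qed.
Lemma moyal0l n g : moyal n 0 g = 0.
Proof. by have := moyalBl n 0 0 g; rewrite !subrr. Qed.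
Lemma moyal0r n f : moyal n f 0 = 0.
Proof. by have := moyalBr n f 0 0; rewrite !subrr. Qed.
Lemma moyalZl n a f g : moyal n (a *: f) g = a *: moyal n f g.
Proof. by rewrite -[a *: f]addr0 moyal_linl moyal0l addr0. Qed.
Lemma moyalZr n a f g : moyal n f (a *: g) = a *: moyal n f g.
Proof. by rewrite -[a *: g]addr0 moyal_linr moyal0r addr0. Qed.
Lemma moyal_T n f g : T (moyal n f g) = moyal n (T f) g + moyal n f (T g).
Proof.
elim: n f g => [|n IH] f g /=; first exact: T_mul.
by rewrite TB !IH !TZ_comm; ring.
Qed.

Lemma moyal_Z n f g : Z (moyal n f g) = moyal n (Z f) g + moyal n f (Z g).
Proof.
elim: n f g => [|n IH] f g /=; first exact: Z_mul.
by rewrite ZB !IH -!TZ_comm; ring.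
Qed.

(** Pascal's rule, as the induction step of a binomial theorem for commuting operators. *)
Lemma pascal_sum (V : zmodType) (F G : nat -> nat -> V) n :
  (forall k l, (k + l)%N = n -> F k.+1 l + F k l.+1 = G k l) ->
  \sum_(k < n.+2) F k (n.+1 - k)%N *+ 'C(n.+1, k) =
  \sum_(k < n.+1) G k (n - k)%N *+ 'C(n, k).
Proof.
move=> h.
rewrite big_ord_recl /= bin0 mulr1n subn0.
under eq_bigr => k _ do rewrite /bump leq0n add1n subSS binS mulrnDr.
rewrite big_split /= big_ord_recr /= bin_small // mulr0n addr0.
have -> : \sum_(k < n.+1) G k (n - k)%N *+ 'C(n, k) =
   \sum_(k < n.+1) F k.+1 (n - k)%N *+ 'C(n, k) +
   \sum_(k < n.+1) F k (n - k).+1 *+ 'C(n, k).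
  rewrite -big_split; apply: eq_bigr => k _ /=.
  by rewrite -mulrnDl h // subnKC // -ltnS.
rewrite addrA addrC; congr (_ + _).
rewrite [in RHS]big_ord_recl /= bin0 mulr1n subn0; congr (_ + _).
apply: eq_bigr => k _; rewrite /bump leq0n add1n.
by rewrite -subSn ?subSS // ltn_ord.
Qed.

Lemma moyalE n f g : moyal n f g =
  \sum_(r < n.+1) ((-1) ^+ r * 'C(n, r)%:R : K) *:
    (iter (n - r) T (iter r Z f) * iter r T (iter (n - r) Z g)).
Proof.
pose F r s f g : A := (-1) ^+ r *: (iter s T (iter r Z f) * iter r T (iter s Z g)).
suff -> : moyal n f g = \sum_(r < n.+1) F r (n - r)%N f g *+ 'C(n, r).
  by apply: eq_bigr => r _; rewrite /F -scaler_nat scalerA mulrC.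
have ZT k x : iter k Z (T x) = T (iter k Z x).
  by elim: k => //= k ->; rewrite TZ_comm.
elim: n f g => [|n IH] f g.
  by rewrite big_ord_recl big_ord0 /F /= bin0 scale1r addr0.
rewrite /= !IH -sumrB.
rewrite (@pascal_sum _ (fun k l => F k l f g)
  (fun k l => F k l (T f) (Z g) - F k l (Z f) (T g))); last first.
  move=> k l _; rewrite /F exprS mulN1r scaleNr addrC; congr (_ - _).
    by rewrite -[iter l Z (Z g)]iterSr ZT iterSr.
  by rewrite -[iter k Z (Z f)]iterSr ZT [iter k.+1 T _]iterSr.
by apply: eq_bigr => k _; rewrite mulrnBl.
Qed.

(** The n-th power of B12 + B13 + B23, then the triple product, where Bij is the bivector acting on
    the factors i and j. Both bracketings expand to it. *)
Fixpoint moyal3 n f g h : A :=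
  if n is n'.+1 then
    moyal3 n' (T f) (Z g) h - moyal3 n' (Z f) (T g) h
    + (moyal3 n' (T f) g (Z h) - moyal3 n' (Z f) g (T h))
    + (moyal3 n' f (T g) (Z h) - moyal3 n' f (Z g) (T h))
  else f * g * h.

(** By the Leibniz rule the bivector, applied after multiplying the first two factors, becomes B13 +
    B23. This commutes with B12, and the binomial theorem applies. *)
Lemma moyal3_left n f g h :
  \sum_(k < n.+1) moyal k (moyal (n - k) f g) h *+ 'C(n, k) = moyal3 n f g h.
Proof.
elim: n f g h => [|n IH] f g h.
  by rewrite big_ord_recl big_ord0 /= bin0 addr0.
rewrite (@pascal_sum _ (fun k l => moyal k (moyal l f g) h)
  (fun k l => moyal k (moyal l (T f) (Z g)) h - moyal k (moyal l (Z f) (T g)) h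
    + (moyal k (moyal l (T f) g) (Z h) - moyal k (moyal l (Z f) g) (T h))
    + (moyal k (moyal l f (T g)) (Z h) - moyal k (moyal l f (Z g)) (T h)))).
  rewrite /= -!IH -!sumrB -!big_split; apply: eq_bigr => k _ /=.
  by rewrite -!mulrnBl -!mulrnDl.
move=> k l _ /=; rewrite moyal_T moyal_Z moyalBl !moyalDl; ring.
Qed.

Lemma moyal3_right n f g h :
  \sum_(k < n.+1) moyal k f (moyal (n - k) g h) *+ 'C(n, k) = moyal3 n f g h.
Proof.
elim: n f g h => [|n IH] f g h.
  by rewrite big_ord_recl big_ord0 /= bin0 addr0 mulrA.
rewrite (@pascal_sum _ (fun k l => moyal k f (moyal l g h))
  (fun k l => moyal k (T f) (moyal l (Z g) h) - moyal k (Z f) (moyal l (T g) h)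
    + (moyal k (T f) (moyal l g (Z h)) - moyal k (Z f) (moyal l g (T h)))
    + (moyal k f (moyal l (T g) (Z h)) - moyal k f (moyal l (Z g) (T h))))).
  rewrite /= -!IH -!sumrB -!big_split; apply: eq_bigr => k _ /=.
  by rewrite -!mulrnBl -!mulrnDl.
move=> k l _ /=; rewrite moyal_T moyal_Z moyalBr !moyalDr; ring.
Qed.

Lemma moyal_assoc n f g h :
  \sum_(k < n.+1) k`!%:R^-1 *: moyal k ((n - k)`!%:R^-1 *: moyal (n - k) f g) h =
  \sum_(k < n.+1) k`!%:R^-1 *: moyal k f ((n - k)`!%:R^-1 *: moyal (n - k) g h) :> A.
Proof.
have fact0 m : m`!%:R != 0 :> K by rewrite pnatr_eq0 -lt0n fact_gt0.
(* 1 / (k! (n - k)!) is the binomial coefficient divided by n!. *)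
have key (F : nat -> nat -> A) :
    \sum_(k < n.+1) k`!%:R^-1 *: ((n - k)`!%:R^-1 *: F k (n - k)%N) =
    n`!%:R^-1 *: (\sum_(k < n.+1) F k (n - k)%N *+ 'C(n, k)).
  rewrite scaler_sumr; apply: eq_bigr => k _.
  rewrite -[F _ _ *+ _]scaler_nat !scalerA; congr (_ *: _).
  have kn : (k <= n)%N by rewrite -ltnS.
  have := congr1 (fun m => m%:R : K) (bin_fact kn); rewrite !natrM => e.
  have C0 : 'C(n, k)%:R != 0 :> K by rewrite pnatr_eq0 -lt0n bin_gt0.
  by rewrite -e !invfM mulrAC mulVf // mul1r.
under eq_bigr do rewrite moyalZl.
under [RHS]eq_bigr do rewrite moyalZr.
by rewrite !(key (fun k l => moyal k (moyal l f g) h))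
   !(key (fun k l => moyal k f (moyal l g h))) moyal3_left moyal3_right.
Qed.

End Moyal.

(* The bivector T /\ Z only depends on T modulo Z. *)
Lemma moyal_shear (K : numFieldType) (A : comAlgType K) (T Z T' : A -> A) (a : K) :
  linear T -> linear Z -> (forall f, T' f = T f + a *: Z f) ->
  forall n f g, moyal T' Z n f g = moyal T Z n f g.
Proof.
move=> T_lin Z_lin T'E; elim=> [|n IH] f g //=.
rewrite !IH !T'E !(moyalDl T_lin Z_lin, moyalDr T_lin Z_lin).
by rewrite (moyalZl T_lin Z_lin) (moyalZr T_lin Z_lin); ring.
Qed.

(** * Associativity of the star product from that of its coefficients *)

Section Star.
Context {K : comNzRingType} {A : comAlgType K} (mu : nat -> A -> A -> A).
Hypothesis mu_bil : forall n, bilinear_for *:%R *:%R (mu n).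
Hypothesis mu_assoc : forall n f g h,
  \sum_(k < n.+1) mu k (mu (n - k)%N f g) h = \sum_(k < n.+1) mu k f (mu (n - k)%N g h).

Let muDl n f f' g : mu n (f + f') g = mu n f g + mu n f' g.
Proof. by have [h _] := mu_bil n; have /= := h g 1 f f'; rewrite !scale1r. Qed.
Let muDr n f g g' : mu n f (g + g') = mu n f g + mu n f g'.
Proof. by have [_ h] := mu_bil n; have /= := h f 1 g g'; rewrite !scale1r. Qed.
Let mu0l n g : mu n 0 g = 0.
Proof. by apply: (addrI (mu n 0 g)); rewrite -muDl !addr0. Qed.
Let mu0r n f : mu n f 0 = 0.
Proof. by apply: (addrI (mu n f 0)); rewrite -muDr !addr0. Qed.
(** The indices run over one common range under a condition on their sum, so that sums can be
    interchanged freely; since any [N > n] is allowed, nested products share the range. *)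
Lemma star_cond N n (F G : nat -> A) : (n < N)%N ->
  star mu F G n = \sum_(i < N) \sum_(j < N) \sum_(k < N | (k + i + j)%N == n) mu k (F i) (G j).
Proof.
move=> nN; rewrite /star.
rewrite (big_ord_widen _ (fun k => \sum_(i < (n - k).+1) mu k (F i) (G (n - k - i)%N)) nN).
under [RHS]eq_bigr do (under eq_bigr do rewrite big_mkcond; rewrite exchange_big).
rewrite exchange_big big_mkcond; apply: eq_bigr => k _ /=.
case: ifPn => kn; last first.
  rewrite big1 // => i _; rewrite big1 // => j _; case: eqP => // h.
  by move: kn; rewrite -h; lia.
have nkN : ((n - k).+1 <= N)%N by lia.
rewrite (big_ord_widen _ (fun i => mu k (F i) (G (n - k - i)%N)) nkN) big_mkcond.
apply: eq_bigr => i _; rewrite -big_mkcond; case: ifPn => ik; last first.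
  by rewrite big1 // => j /eqP h; move: ik; rewrite -h; lia.
have jN : (n - k - i < N)%N by lia.
rewrite (big_pred1 (Ordinal jN)) // => j /=.
by rewrite -val_eqE /=; apply/eqP/eqP; lia.
Qed.

(** [Phi k] is [mu k] with one argument fixed, on either side, so that one lemma unfolds both
    bracketings. *)
Lemma star_nested N n i (G H : nat -> A) (Phi : nat -> A -> A) :
  (forall k, Phi k 0 = 0) -> (forall k, {morph Phi k : f g / f + g}) ->
  (n < N)%N ->
  \sum_(s < N) \sum_(k < N | (k + i + s)%N == n) Phi k (star mu G H s) =
  \sum_(j < N) \sum_(m < N) \sum_(k < N) \sum_(l < N | (k + l + (i + j + m))%N == n)
     Phi k (mu l (G j) (H m)).
Proof.
move=> Phi0 PhiD nN.
transitivity (\sum_(s < N) \sum_(j < N) \sum_(m < N) \sum_(k < N) \sum_(l < N)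
   if ((k + i + s)%N == n) && ((l + j + m)%N == s) then Phi k (mu l (G j) (H m)) else 0).
  apply: eq_bigr => s _; rewrite big_mkcond.
  under [RHS]eq_bigr do rewrite exchange_big.
  rewrite [RHS]exchange_big; apply: eq_bigr => k _; rewrite (star_cond _ _ (ltn_ord s)).
  case: ifP => _; last by rewrite big1 // => j _; rewrite big1 // => m _; rewrite big1.
  rewrite (big_morph _ (PhiD k) (Phi0 k)); apply: eq_bigr => j _.
  rewrite (big_morph _ (PhiD k) (Phi0 k)); apply: eq_bigr => m _.
  by rewrite (big_morph _ (PhiD k) (Phi0 k)) -big_mkcond.
rewrite exchange_big; apply: eq_bigr => j _.
rewrite exchange_big; apply: eq_bigr => m _.
rewrite exchange_big; apply: eq_bigr => k _.
rewrite exchange_big [RHS]big_mkcond; apply: eq_bigr => l _; rewrite -big_mkcond /=.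
case: ifP => [/eqP h|/eqP h].
  have sN : (l + j + m < N)%N by lia.
  rewrite (big_pred1 (Ordinal sN)) // => s /=; rewrite -val_eqE /=.
  by apply/andP/eqP => [[_ /eqP->] //|->]; split; apply/eqP => //; lia.
by rewrite big1 // => s /andP[/eqP h1 /eqP h2]; exfalso; apply: h; lia.
Qed.

Lemma star_assoc (F G H : nat -> A) : star mu F (star mu G H) = star mu (star mu F G) H.
Proof.
apply/funext => n; rewrite !(@star_cond n.+1 n) //.
transitivity (\sum_(i < n.+1) \sum_(j < n.+1) \sum_(m < n.+1) \sum_(k < n.+1)
   \sum_(l < n.+1 | (k + l + (i + j + m))%N == n) mu k (F i) (mu l (G j) (H m))).
  apply: eq_bigr => i _.
  by apply: (star_nested i G H (Phi := fun k => mu k (F i))) => // k *; rewrite ?mu0r ?muDr.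
rewrite [RHS]exchange_big.
transitivity (\sum_(m < n.+1) \sum_(i < n.+1) \sum_(j < n.+1) \sum_(k < n.+1)
   \sum_(l < n.+1 | (k + l + (m + i + j))%N == n) mu k (mu l (F i) (G j)) (H m)); last first.
  apply: eq_bigr => m _.
  rewrite -(star_nested m F G (Phi := fun k f => mu k f (H m))) //.
  - by apply: eq_bigr => s _; apply: eq_bigl => k; rewrite addnAC.
  - by move=> k f g /=; rewrite muDl.
rewrite [RHS]exchange_big; apply: eq_bigr => i _.
rewrite [RHS]exchange_big; apply: eq_bigr => j _; apply: eq_bigr => m _.
(* For fixed i, j, m the remaining indices satisfy k + l = n - (i + j + m), which is the shape of
   [mu_assoc]. *)
have key (X : nat -> nat -> A) (c : nat) : \sum_(k < n.+1) \sum_(l < n.+1 | (k + l + c)%N == n) X k l =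
    if (c <= n)%N then \sum_(k < (n - c).+1) X k (n - c - k)%N else 0.
  case: ifPn => cn; last first.
    by rewrite big1 // => k _; rewrite big1 // => l /eqP h; exfalso; move: cn; lia.
  have cN : ((n - c).+1 <= n.+1)%N by lia.
  rewrite (big_ord_widen _ (fun k => X k (n - c - k)%N) cN) [RHS]big_mkcond.
  apply: eq_bigr => k _; case: ifPn => kc; last first.
    by rewrite big1 // => l /eqP h; exfalso; move: kc; lia.
  have lN : (n - c - k < n.+1)%N by lia.
  rewrite (big_pred1 (Ordinal lN)) // => l /=.
  by rewrite -val_eqE /=; apply/eqP/eqP; lia.
rewrite (key (fun k l => mu k (F i) (mu l (G j) (H m)))).
rewrite (key (fun k l => mu k (mu l (F i) (G j)) (H m))).
by rewrite -(addnA m) [(m + _)%N]addnC mu_assoc.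
Qed.

End Star.

(** * Quasi-Jacobi forms *)

Section Shift.
Context {R : realType}.
Local Notation C := R[i].
Local Notation D := (@dfun R).
Implicit Types (tau z : C) (f g : D).

Lemma good_shift tau z : good xpredT tau z -> good xpredT tau (z + tau).
Proof.
move=> [ht hz]; split=> // n _; have := hz (n + 1) isT.
by rewrite intrD mulrDl mul1r addrA addrAC.
Qed.

Lemma Ser_shift p tau z : good xpredT tau z ->
  Ser xpredT p 0 tau (z + tau) = Ser xpredT p 0 tau z.
Proof.
move=> hg; apply: has_sum_unique (SerP p 0 (good_shift hg)) _.
have := has_sum_bij (addrK 1) (subrK 1) (SerP p 0 hg).
apply: eq_has_sum => n; rewrite /term /= !expr0.
by have -> : z + tau + n%:~R * tau = z + (n + 1)%:~R * tau by rewrite intrD; ring.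
Qed.

(** The translation moves the rows by one; only the sign corrections notice, through [has_sum_sgz]
    with k = 1. *)
Lemma E1_shift tau z : good xpredT tau z -> E1 tau (z + tau) = E1 tau z - 2 * ipi.
Proof.
move=> hg; rewrite !E1E //; last exact: good_shift.
apply: has_sum_unique (Eis1P (good_shift hg)) _.
have := has_sumB (has_sum_bij (addrK 1) (subrK 1) (Eis1P hg))
  (has_sumZ ipi (has_sum_sgz 1)).
rewrite mulr1 [ipi * 2]mulrC; apply: eq_has_sum => n; rewrite /eterm /= intrB.
have -> : z + tau + n%:~R * tau = z + (n + 1)%:~R * tau by rewrite intrD; ring.
by ring.
Qed.

Lemma wp_shift tau z : good xpredT tau z -> wp tau (z + tau) = wp tau z.
Proof.
move=> hg; rewrite !wpE ?Ser_shift //; try by case: hg.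
exact: good_shift.
Qed.

Lemma lat_shift_subproof (p : @domain R) : ((val p).1, (val p).2 + (val p).1) \in off_lattice.
Proof. by apply/mem_set/good_off/good_shift/domain_good. Qed.

Definition lat_shift (p : @domain R) : @domain R :=
  exist (fun p => p \in off_lattice) _ (lat_shift_subproof p).

Definition sg f : D := f \o lat_shift.

Lemma sg_wpf : sg (@wpf R) = @wpf R.
Proof. by apply/funext => p; exact: (wp_shift (domain_good p)). Qed.

Lemma sg_dz_wpf : sg (dz (@wpf R)) = dz (@wpf R).
Proof.
by rewrite dz_wpf_restr; apply/funext => p; exact: (Ser_shift _ (domain_good p)).
Qed.

Lemma sg_E1f : sg (@E1f R) = @E1f R - (2 * ipi)%:A.
Proof.
apply/funext => p; have := E1_shift (domain_good p).
by rewrite /sg /E1f /restr /= => ->; congr (_ - _); rewrite -[LHS]mulr1.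
Qed.

End Shift.

Section GeneratedInduction.
Context {K : comNzRingType} {A : comAlgType K}.

Lemma mem_gen (X : set A) f : X f -> f \in in_gen_subalg X.
Proof. by move=> Xf; apply/mem_set => S [_]; exact. Qed.

Lemma gen_ind (X : set A) (S : A -> Prop) :
  (forall f, X f -> S f) -> S 1 -> (forall a f g, S f -> S g -> S (a *: f + g)) ->
  (forall f g, S f -> S g -> S (f * g)) ->
  forall f, f \in in_gen_subalg X -> S f.
Proof.
move=> SX S1 SL SM f /set_mem; apply; split=> //; split.
- exact/mem_set.
- by move=> a x y /set_mem Sx /set_mem Sy; apply/mem_set; exact: SL.
- by move=> x y /set_mem Sx /set_mem Sy; apply/mem_set; exact: SM.
Qed.

End GeneratedInduction.

(** * Stability of JS under the two derivations, and their commutation *)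

Section Closure.
Context {R : realType}.
Local Notation C := R[i].
Local Notation D := (@dfun R).
Implicit Types (f g : D).
Local Notation js := (in_gen_subalg (@singular_gens R)).
Local Notation js0 := (in_gen_subalg (@quasimodular_gens R)).

Local Notation P := (@wpf R).
Local Notation P1 := (dz (@wpf R)).
Local Notation Q := (@e4f R).
Local Notation E := (@E1f R).
Local Notation G := (@e2f R).

Lemma js_P : P \in js. Proof. by apply: mem_gen; do 4 left. Qed.
Lemma js_P1 : P1 \in js. Proof. by apply: mem_gen; do 3 left; right. Qed.
Lemma js_Q : Q \in js. Proof. by apply: mem_gen; do 2 left; right. Qed.
Lemma js_E : E \in js. Proof. by apply: mem_gen; left; right. Qed.
Lemma js_G : G \in js. Proof. by apply: mem_gen; right. Qed.

Local Opaque wpf e4f E1f e2f dz dtau.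

Local Ltac mem_js := repeat lazymatch goal with
  | |- is_true ((_ + _) \in _) => apply: rpredD
  | |- is_true ((- _) \in _) => rewrite rpredN
  | |- is_true ((_ *: _) \in _) => apply: rpredZ
  | |- is_true ((_ * _) \in _) => apply: rpredM
  | |- is_true (0 \in _) => exact: rpred0
  | |- is_true (wpf \in _) => exact: js_P
  | |- is_true (dz wpf \in _) => exact: js_P1
  | |- is_true (e4f \in _) => exact: js_Q
  | |- is_true (E1f \in _) => exact: js_E
  | |- is_true (e2f \in _) => exact: js_G
  end.

(** Differentiability and stability go through one induction, as the product rule uses the
    derivatives of both factors. On the generators the explicit derivatives are polynomials in the
    generators. *)
Lemma js_has_partials f : f \in js ->
  exists fz ft, [/\ has_partials f fz ft, fz \in js & ft \in js].
Proof.
move=> jf; suff [] : f \in js /\ exists fz ft, [/\ has_partials f fz ft, fz \in js & ft \in js] by [].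
move: f jf; apply: gen_ind.
- move=> f Xf; split; first exact: mem_gen.
  case: Xf => [[[[]|]|]|] ->; (do 2 eexists); split.
  + exact: P_partials.
  + by mem_js.
  + by mem_js.
  + exact: P1_partials.
  + by mem_js.
  + by mem_js.
  + exact: Q_partials.
  + exact: rpred0.
  + by mem_js.
  + exact: E_partials.
  + by mem_js.
  + by mem_js.
  + exact: G_partials.
  + exact: rpred0.
  + by mem_js.
- split; first exact: rpred1.
  by exists 0, 0; split; [exact: has_partials1|exact: rpred0|exact: rpred0].
- move=> a f g [jf [fz [ft [hf fz1 ft1]]]] [jg [gz [gt [hg gz1 gt1]]]].
  split; first by rewrite rpredD ?rpredZ.
  exists (a *: fz + gz), (a *: ft + gt).
  by split; rewrite ?(rpredD, rpredZ) //; exact: has_partialsD (has_partialsZ a hf) hg.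
- move=> f g [jf [fz [ft [hf fz1 ft1]]]] [jg [gz [gt [hg gz1 gt1]]]].
  split; first by rewrite rpredM.
  exists (fz * g + f * gz), (ft * g + f * gt).
  by split; rewrite ?(rpredD, rpredM) //; exact: has_partialsM.
Qed.

Lemma js_partials f : f \in js -> has_partials f (dz f) (dtau f).
Proof.
move=> /js_has_partials[fz [ft [h _ _]]].
by rewrite (has_partials_dz h) (has_partials_dtau h).
Qed.

Lemma js_dz f : f \in js -> dz f \in js.
Proof. by move=> /js_has_partials[fz [ft [h jz _]]]; rewrite (has_partials_dz h). Qed.

Lemma js_dtau f : f \in js -> dtau f \in js.
Proof. by move=> /js_has_partials[fz [ft [h _ jt]]]; rewrite (has_partials_dtau h). Qed.

Lemma dz1 : dz (1 : D) = 0. Proof. exact: has_partials_dz has_partials1. Qed.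
Lemma dtau1 : dtau (1 : D) = 0. Proof. exact: has_partials_dtau has_partials1. Qed.

Lemma dz_lin a f g : f \in js -> g \in js -> dz (a *: f + g) = a *: dz f + dz g.
Proof.
move=> /js_partials hf /js_partials hg.
exact: has_partials_dz (has_partialsD (has_partialsZ a hf) hg).
Qed.

Lemma dtau_lin a f g : f \in js -> g \in js -> dtau (a *: f + g) = a *: dtau f + dtau g.
Proof.
move=> /js_partials hf /js_partials hg.
exact: has_partials_dtau (has_partialsD (has_partialsZ a hf) hg).
Qed.

Lemma dzM f g : f \in js -> g \in js -> dz (f * g) = dz f * g + f * dz g.
Proof.
by move=> /js_partials hf /js_partials hg; exact: has_partials_dz (has_partialsM hf hg).
Qed.

Lemma dtauM f g : f \in js -> g \in js -> dtau (f * g) = dtau f * g + f * dtau g.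
Proof.
by move=> /js_partials hf /js_partials hg; exact: has_partials_dtau (has_partialsM hf hg).
Qed.

Lemma dz0 : dz (0 : D) = 0.
Proof. by have := dz_lin (-1) (rpred1 js) (rpred1 js); rewrite scaleN1r addNr dz1 scaler0 addr0. Qed.

Lemma dtau0 : dtau (0 : D) = 0.
Proof. by have := dtau_lin (-1) (rpred1 js) (rpred1 js); rewrite scaleN1r addNr dtau1 scaler0 addr0. Qed.

Lemma dfunZE a f p : (a *: f) p = a * f p. Proof. by []. Qed.
Lemma dfunDE f g p : (f + g) p = f p + g p. Proof. by []. Qed.
Lemma dfunNE f p : (- f) p = - f p. Proof. by []. Qed.
Lemma dfunME f g p : (f * g) p = f p * g p. Proof. by []. Qed.
Lemma dfun0E p : (0 : D) p = 0. Proof. by []. Qed.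

Lemma has_partialsN f fz ft : has_partials f fz ft -> has_partials (- f) (- fz) (- ft).
Proof. by move=> h; have := has_partialsZ (-1) h; rewrite !scaleN1r. Qed.

Lemma has_partials0 : @has_partials R 0 0 0.
Proof. by have := has_partialsZ 0 (@has_partials1 R); rewrite !scale0r. Qed.

Local Ltac partials := repeat lazymatch goal with
  | |- has_partials (_ + _) _ _ => eapply has_partialsD
  | |- has_partials (- _) _ _ => eapply has_partialsN
  | |- has_partials (_ *: _) _ _ => eapply has_partialsZ
  | |- has_partials (_ * _) _ _ => eapply has_partialsM
  | |- has_partials wpf _ _ => exact: P_partials
  | |- has_partials (dz wpf) _ _ => exact: P1_partials
  | |- has_partials e4f _ _ => exact: Q_partials
  | |- has_partials E1f _ _ => exact: E_partials
  | |- has_partials e2f _ _ => exact: G_partials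
  end.

Local Ltac dfun_field :=
  apply/funext => p; rewrite !(dfunZE, dfunDE, dfunNE, dfunME, dfun0E); by field.

(** Takes the place of a theorem on mixed derivatives: for a generator, [a] and [d] are explicit
    polynomials in the generators, compared pointwise by [field]. *)
Lemma partials_comm f fz ft a b c d :
  has_partials f fz ft -> has_partials ft a b -> has_partials fz c d -> a = d ->
  dz (dtau f) = dtau (dz f).
Proof.
move=> hf ht hz; rewrite (has_partials_dz hf) (has_partials_dtau hf).
by rewrite (has_partials_dz ht) (has_partials_dtau hz).
Qed.

Lemma dz_dtau_P : dz (dtau P) = dtau (dz P).
Proof.
eapply partials_comm.
- exact: P_partials.
- by partials.
- exact: P1_partials.
- by dfun_field.
Qed.

Lemma dz_dtau_P1 : dz (dtau P1) = dtau (dz P1).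
Proof.
eapply partials_comm.
- exact: P1_partials.
- by partials.
- by partials.
- by dfun_field.
Qed.

Lemma dz_dtau_Q : dz (dtau Q) = dtau (dz Q).
Proof.
eapply partials_comm.
- exact: Q_partials.
- by partials.
- exact: has_partials0.
- by dfun_field.
Qed.

Lemma dz_dtau_E : dz (dtau E) = dtau (dz E).
Proof.
eapply partials_comm.
- exact: E_partials.
- by partials.
- by partials.
- by dfun_field.
Qed.

Lemma dz_dtau_G : dz (dtau G) = dtau (dz G).
Proof.
eapply partials_comm.
- exact: G_partials.
- by partials.
- exact: has_partials0.
- by dfun_field.
Qed.

Let mixed_leibniz (f g fz ft gz gt ftz fzt gtz gzt : D) : ftz = fzt -> gtz = gzt ->
  ftz * g + ft * gz + (fz * gt + f * gtz) = fzt * g + fz * gt + (ft * gz + f * gzt).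
Proof. by move=> -> ->; rewrite !addrA; congr (_ + _); rewrite addrAC. Qed.

(** The commutator of two derivations is a derivation, so it vanishes on JS once it does on the
    generators. *)
Lemma dz_dtau f : f \in js -> dz (dtau f) = dtau (dz f).
Proof.
move=> jf; suff [] : f \in js /\ dz (dtau f) = dtau (dz f) by [].
move: f jf; apply: gen_ind.
- move=> f Xf; split; first exact: mem_gen.
  case: Xf => [[[[]|]|]|] ->.
  + exact: dz_dtau_P.
  + exact: dz_dtau_P1.
  + exact: dz_dtau_Q.
  + exact: dz_dtau_E.
  + exact: dz_dtau_G.
- by split; [exact: rpred1|rewrite dz1 dtau1 dz0 dtau0].
- move=> a f g [jf hf] [jg hg]; split; first by rewrite rpredD ?rpredZ.
  have [df dg] := (js_partials jf, js_partials jg).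
  have [dzf dzg] := (js_partials (js_dz jf), js_partials (js_dz jg)).
  have [dtf dtg] := (js_partials (js_dtau jf), js_partials (js_dtau jg)).
  eapply partials_comm.
  + exact: has_partialsD (has_partialsZ a df) dg.
  + exact: has_partialsD (has_partialsZ a dtf) dtg.
  + exact: has_partialsD (has_partialsZ a dzf) dzg.
  by congr (_ *: _ + _); [exact: hf|exact: hg].
- move=> f g [jf hf] [jg hg]; split; first by rewrite rpredM.
  have [df dg] := (js_partials jf, js_partials jg).
  have [dzf dzg] := (js_partials (js_dz jf), js_partials (js_dz jg)).
  have [dtf dtg] := (js_partials (js_dtau jf), js_partials (js_dtau jg)).
  eapply partials_comm.
  + exact: has_partialsM df dg.
  + exact: has_partialsD (has_partialsM dtf dg) (has_partialsM df dtg).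
  + exact: has_partialsD (has_partialsM dzf dg) (has_partialsM df dzg).
  exact: (mixed_leibniz f g _ _ _ _ hf hg).
Qed.

End Closure.

(** * The translation by tau and its invariants *)

Section ShiftAlgebra.
Context {R : realType}.
Local Notation C := R[i].
Local Notation D := (@dfun R).
Implicit Types (f g : D).
Local Notation js := (in_gen_subalg (@singular_gens R)).
Local Notation js0 := (in_gen_subalg (@quasimodular_gens R)).
Local Notation P := (@wpf R).
Local Notation P1 := (dz (@wpf R)).
Local Notation Q := (@e4f R).
Local Notation E := (@E1f R).
Local Notation G := (@e2f R).

Local Opaque wpf e4f E1f e2f dz dtau.

Lemma sg_e4f : sg Q = Q.
Proof. by []. Qed.

Lemma sg_e2f : sg G = G.
Proof. by []. Qed.

(** The chain rule for the translation: in the tau direction it adds [kap] times the z-derivative.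
    It is checked on the generators from their explicit derivatives and extended by the rules for
    [has_partials]. *)
Definition sg_cocycle f := exists fz ft, [/\ has_partials f fz ft, sg f \in js &
  has_partials (sg f) (sg fz) (sg ft + kap *: sg fz)].

(** [c] is the constant by which a generator changes under the translation: nonzero for [E1f]
    only. *)
Let sg_cocycle_gen f fz ft (c : C) : f \in js -> has_partials f fz ft ->
  sg f = f + c *: 1 -> sg fz = fz ->
  (forall p, ft p = ft (lat_shift p) + kap * fz p) -> sg_cocycle f.
Proof.
move=> jf hf fE fzE ftE; exists fz, ft; split=> //.
  by rewrite fE rpredD // rpredZ // rpred1.
rewrite fzE fE; have -> : sg ft + kap *: fz = ft by apply/funext => p; rewrite ftE.
have := has_partialsD hf (has_partialsZ c has_partials1).
by rewrite (scaler0 D c) !addr0.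
Qed.

Let shP p : P (lat_shift p) = P p. Proof. exact: (congr1 (@^~ p) sg_wpf). Qed.
Let shP1 p : P1 (lat_shift p) = P1 p. Proof. exact: (congr1 (@^~ p) sg_dz_wpf). Qed.
Let shQ p : Q (lat_shift p) = Q p. Proof. exact: (congr1 (@^~ p) sg_e4f). Qed.
Let shG p : G (lat_shift p) = G p. Proof. exact: (congr1 (@^~ p) sg_e2f). Qed.
Let shE p : E (lat_shift p) = E p - 2 * ipi.
Proof. by rewrite -[LHS]/((sg E) p) sg_E1f -[(2 * ipi) in RHS]mulr1. Qed.

Local Ltac sg_field :=
  move=> p; rewrite !(dfunZE, dfunDE, dfunNE, dfunME, dfun0E) ?shP ?shP1 ?shQ ?shG ?shE kapE;
  move: (@ipi R) => c; by field.

Let sgP : sg_cocycle P.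
Proof.
eapply (@sg_cocycle_gen _ _ _ 0).
- exact: js_P.
- exact: P_partials.
- by rewrite scale0r addr0; exact: sg_wpf.
- exact: sg_dz_wpf.
- by sg_field.
Qed.

Let sgP1 : sg_cocycle P1.
Proof.
eapply (@sg_cocycle_gen _ _ _ 0).
- exact: js_P1.
- exact: P1_partials.
- by rewrite scale0r addr0; exact: sg_dz_wpf.
- apply/funext => p; rewrite /sg /=.
  by rewrite !(dfunZE, dfunDE, dfunNE, dfunME) shP shQ.
- by sg_field.
Qed.

Let sgQ : sg_cocycle Q.
Proof.
eapply (@sg_cocycle_gen _ _ _ 0).
- exact: js_Q.
- exact: Q_partials.
- by rewrite scale0r addr0; exact: sg_e4f.
- by [].
- by sg_field.
Qed.

Let sgG : sg_cocycle G.
Proof.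
eapply (@sg_cocycle_gen _ _ _ 0).
- exact: js_G.
- exact: G_partials.
- by rewrite scale0r addr0; exact: sg_e2f.
- by [].
- by sg_field.
Qed.

Let sgE : sg_cocycle E.
Proof.
eapply (@sg_cocycle_gen _ _ _ (- (2 * ipi))).
- exact: js_E.
- exact: E_partials.
- by rewrite scaleNr; exact: sg_E1f.
- apply/funext => p; rewrite /sg /=.
  by rewrite !(dfunZE, dfunDE, dfunNE, dfunME) shP shG.
- by sg_field.
Qed.

Lemma js_sg_cocycle f : f \in js -> sg_cocycle f.
Proof.
move: f; apply: gen_ind.
- by move=> f [[[[]|]|]|] ->; [exact: sgP|exact: sgP1|exact: sgQ|exact: sgE|exact: sgG].
- exists 0, 0; split; [exact: has_partials1|exact: rpred1|].
  have -> : sg (0 : D) + kap *: sg (0 : D) = 0 by rewrite -[sg 0]/(0 : D) scaler0 addr0.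
  exact: has_partials1.
- move=> a f g [fz [ft [hf jf hf']]] [gz [gt [hg jg hg']]].
  exists (a *: fz + gz), (a *: ft + gt); split.
  + exact: has_partialsD (has_partialsZ a hf) hg.
  + exact: (rpredD (rpredZ a jf) jg).
  have -> : sg (a *: ft + gt) + kap *: sg (a *: fz + gz) =
     a *: (sg ft + kap *: sg fz) + (sg gt + kap *: sg gz).
    by apply/funext => p; rewrite !(dfunZE, dfunDE) /sg /= !(dfunZE, dfunDE); ring.
  exact: has_partialsD (has_partialsZ a hf') hg'.
- move=> f g [fz [ft [hf jf hf']]] [gz [gt [hg jg hg']]].
  exists (fz * g + f * gz), (ft * g + f * gt); split.
  + exact: has_partialsM hf hg.
  + exact: (rpredM jf jg).
  have -> : sg (ft * g + f * gt) + kap *: sg (fz * g + f * gz) =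
     (sg ft + kap *: sg fz) * sg g + sg f * (sg gt + kap *: sg gz).
    by apply/funext => p; rewrite !(dfunZE, dfunDE, dfunME) /sg /= !(dfunZE, dfunDE, dfunME); ring.
  exact: has_partialsM hf' hg'.
Qed.

Lemma js_sg f : f \in js -> sg f \in js.
Proof. by case/js_sg_cocycle => fz [ft []]. Qed.

Lemma sg_dz f : f \in js -> sg (dz f) = dz (sg f).
Proof.
move=> /js_sg_cocycle[fz [ft [hf _ hf']]].
by rewrite (has_partials_dz hf) (has_partials_dz hf').
Qed.

Lemma sg_dtau f : f \in js -> sg (dtau f) = dtau (sg f) + (- kap) *: dz (sg f).
Proof.
move=> /js_sg_cocycle[fz [ft [hf _ hf']]].
by rewrite (has_partials_dtau hf) (has_partials_dz hf') (has_partials_dtau hf') scaleNr addrK.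
Qed.

Lemma js0_sg f : f \in js0 -> sg f = f.
Proof.
move: f; apply: gen_ind.
- by move=> f [[[]|]|] ->; [exact: sg_wpf|exact: sg_dz_wpf|exact: sg_e4f|exact: sg_e2f].
- by [].
- by move=> a f g hf hg; rewrite -[LHS]/(a *: sg f + sg g) hf hg.
- by move=> f g hf hg; rewrite -[LHS]/(sg f * sg g) hf hg.
Qed.

(** The coefficients are functions; evaluating them at a point yields the complex polynomial in
    [js_sg_fixed]. *)
Lemma js_horner f : f \in js ->
  exists2 p : {poly D}, p \is a polyOver js0 & f = p.[E].
Proof.
have cst f' : f' \in js0 -> exists2 p : {poly D}, p \is a polyOver js0 & f' = p.[E].
  by move=> h; exists f'%:P; rewrite ?polyOverC ?hornerC.
move: f; apply: gen_ind.
- move=> f [[[[]|]|]|] ->.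
  + by apply: cst; apply: mem_gen; do 3 left.
  + by apply: cst; apply: mem_gen; do 2 left; right.
  + by apply: cst; apply: mem_gen; left; right.
  + by exists 'X; rewrite ?polyOverX ?hornerX.
  + by apply: cst; apply: mem_gen; right.
- by apply: cst; exact: rpred1.
- move=> a f g [p jp ->] [q jq ->]; exists (a%:A%:P * p + q).
    by rewrite rpredD // rpredM // polyOverC rpredZ // rpred1.
  by rewrite hornerD hornerM hornerC mulr_algl.
- move=> f g [p jp ->] [q jq ->]; exists (p * q); first by rewrite rpredM.
  by rewrite hornerM.
Qed.

Lemma dfun_expE f n p : (f ^+ n) p = f p ^+ n.
Proof. by elim: n => // n IH; rewrite !exprS dfunME IH. Qed.

Lemma dfun_sumE n (F : 'I_n -> D) p : (\sum_(i < n) F i) p = \sum_(i < n) F i p.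
Proof. by elim/big_ind2: _ => // x y z t <- <-. Qed.

(* Along the orbit of x under lat_shift the function p.[E] is a polynomial in
   E x - 2 ipi n; when it is constant, so is the polynomial. *)
Lemma js_sg_fixed f : f \in js -> sg f = f -> f \in js0.
Proof.
move=> /js_horner[p /polyOverP jp fE] sgf.
suff -> : f = p`_0 by [].
apply/funext => x.
have iter_sg h n : sg h = h -> h (iter n lat_shift x) = h x.
  by move=> hh; elim: n => // n <-; exact: (congr1 (@^~ (iter n lat_shift x)) hh).
have iter_E n : E (iter n lat_shift x) = E x - 2 * ipi * n%:R.
  elim: n => [|n IH]; first by rewrite mulr0 subr0.
  by rewrite iterS shE IH -[n.+1]addn1 natrD mulrDr mulr1 opprD addrA.
pose q : {poly C} := \poly_(i < size p) (p`_i x) - (f x)%:P.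
have qroot n : root q (E x - 2 * ipi * n%:R).
  rewrite /root /q hornerD hornerN hornerC subr_eq0 horner_poly.
  rewrite -(iter_sg f n sgf) fE horner_coef; apply/eqP; rewrite [RHS]dfun_sumE.
  apply: eq_bigr => i _; rewrite dfunME dfun_expE iter_E iter_sg //.
  exact: js0_sg.
have q0 : q = 0.
  apply/eqP/negPn/negP => q0.
  (* These are [size q] distinct roots, one more than the degree permits. *)
  pose rs := [seq E x - 2 * ipi * n%:R | n <- iota 0 (size q)].
  have : (size rs < size q)%N.
    apply: max_poly_roots q0 _ _; first by apply/allP => y /mapP[n _ ->].
    rewrite map_inj_uniq ?iota_uniq // => m n /addrI/oppr_inj.
    by move=> /(mulfI (mulf_neq0 _ ipi_neq0))/eqP; rewrite eqr_nat pnatr_eq0 => /(_ isT)/eqP.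
  by rewrite size_map size_iota ltnn.
have := congr1 (fun r : {poly C} => r`_0) q0.
rewrite coefB coefC coef0 coef_poly /= => /eqP; rewrite subr_eq0 => /eqP <-.
by case: ifPn => //; rewrite -leqNgt => hp; rewrite nth_default.
Qed.

End ShiftAlgebra.

Lemma moyal_intertwine (K : numFieldType) (A : comAlgType K) (T Z s : A -> A) (a : K) :
  linear T -> linear Z -> {morph s : f g / f - g} -> {morph s : f g / f * g} ->
  (forall f, s (Z f) = Z (s f)) -> (forall f, s (T f) = T (s f) + a *: Z (s f)) ->
  forall n f g, s (moyal T Z n f g) = moyal T Z n (s f) (s g).
Proof.
move=> T_lin Z_lin sB sM sZ sT n f g.
(* With the sheared operator on the right, [s] passes through the recursion one step at a time. *)
rewrite -[RHS](moyal_shear T_lin Z_lin (T' := fun f => T f + a *: Z f) (a := a)) //.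
elim: n f g => [|n IH] f g /=; first exact: sM.
by rewrite sB !IH !sZ !sT.
Qed.

(** * Transvectants as a deformation of JS0 *)

Section Transvectants.
Context {R : realType}.
Implicit Types (n : nat).

(** On the subtype every element is differentiable, so the operators become the linear commuting
    derivations that the Moyal product asks for. *)
Let jdz (f : JS R) : JS R := Sub (dz (val f)) (js_dz (valP f)).
Let jdtau (f : JS R) : JS R := Sub (dtau (val f)) (js_dtau (valP f)).
Let jsg (f : JS R) : JS R := Sub (sg (val f)) (js_sg (valP f)).

Let jdz_lin : linear jdz.
Proof. by move=> a f g; apply: val_inj; exact: dz_lin (valP f) (valP g). Qed.
Let jdtau_lin : linear jdtau.
Proof. by move=> a f g; apply: val_inj; exact: dtau_lin (valP f) (valP g). Qed.
Let jdzM f g : jdz (f * g) = jdz f * g + f * jdz g.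
Proof. by apply: val_inj; exact: dzM (valP f) (valP g). Qed.
Let jdtauM f g : jdtau (f * g) = jdtau f * g + f * jdtau g.
Proof. by apply: val_inj; exact: dtauM (valP f) (valP g). Qed.
Let jcomm f : jdtau (jdz f) = jdz (jdtau f).
Proof. by apply: val_inj; apply: esym; exact: dz_dtau (valP f). Qed.

Definition tvJS n (f g : JS R) : JS R := moyal jdtau jdz n f g.

Let val_jdz n f : val (iter n jdz f) = iter n dz (val f).
Proof. elim: n => [|n IH]; [by []|exact: (congr1 dz IH)]. Qed.
Let val_jdtau n f : val (iter n jdtau f) = iter n dtau (val f).
Proof. elim: n => [|n IH]; [by []|exact: (congr1 dtau IH)]. Qed.

Lemma val_tvJS n f g : val (tvJS n f g) = transvectant n (val f) (val g).
Proof.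
have valZM c (x y : JS R) : val (c *: (x * y)) = c *: (val x * val y) by [].
rewrite /tvJS (moyalE jcomm) /transvectant raddf_sum.
apply: eq_bigr => r _; apply: etrans (valZM _ _ _) _; congr (_ *: (_ * _)).
  by rewrite val_jdtau val_jdz.
by rewrite val_jdtau val_jdz.
Qed.

Let jsg_tv n f g : jsg (tvJS n f g) = tvJS n (jsg f) (jsg g).
Proof.
apply: (moyal_intertwine (a := - kap)) => //.
- by move=> {}f {}g; apply: val_inj.
- by move=> {}f {}g; apply: val_inj.
- by move=> {}f; apply: val_inj; exact: sg_dz (valP f).
- by move=> {}f; apply: val_inj; exact: sg_dtau (valP f).
Qed.

Lemma tvJS_js0 n (f g : JS0 R) :
  val (tvJS n (JS0_incl f) (JS0_incl g)) \in in_gen_subalg (@quasimodular_gens R).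
Proof.
apply: js_sg_fixed; first exact: valP.
have sgK (h : JS0 R) : jsg (JS0_incl h) = JS0_incl h.
  by apply: val_inj; exact: js0_sg (valP h).
by have := congr1 val (jsg_tv n (JS0_incl f) (JS0_incl g)); rewrite !sgK.
Qed.

Definition muJS0 n (f g : JS0 R) : JS0 R :=
  (n`!%:R : R[i])^-1 *:
    (exist (in_gen_subalg _) _ (tvJS_js0 n f g) : JS0 R).

Lemma JS0_incl_inj : injective (@JS0_incl R).
Proof. by move=> f g /(congr1 val) e; apply: val_inj. Qed.

Lemma JS0_incl_mu n f g :
  JS0_incl (muJS0 n f g) = (n`!%:R)^-1 *: tvJS n (JS0_incl f) (JS0_incl g).
Proof. by apply: val_inj. Qed.

Let JS0_incl_lin : linear (@JS0_incl R).
Proof. by move=> a f g; apply: val_inj. Qed.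

Let JS0_incl_sum n (F : 'I_n -> JS0 R) :
  JS0_incl (\sum_(i < n) F i) = \sum_(i < n) JS0_incl (F i).
Proof.
apply: (big_morph (@JS0_incl R)); first by move=> f g; apply: val_inj.
by apply: val_inj.
Qed.

Lemma muJS0_bilinear n : bilinear_for *:%R *:%R (muJS0 n).
Proof.
split=> [g a f f'|f a g g'] /=; apply: JS0_incl_inj; rewrite JS0_incl_lin !JS0_incl_mu.
  by rewrite JS0_incl_lin /tvJS (moyal_linl jdtau_lin jdz_lin) scalerDr !scalerA mulrC.
by rewrite JS0_incl_lin /tvJS (moyal_linr jdtau_lin jdz_lin) scalerDr !scalerA mulrC.
Qed.

Lemma muJS0_assoc n f g h :
  \sum_(k < n.+1) muJS0 k (muJS0 (n - k) f g) h =
  \sum_(k < n.+1) muJS0 k f (muJS0 (n - k) g h).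
Proof.
apply: JS0_incl_inj; rewrite !JS0_incl_sum.
under eq_bigr do rewrite !JS0_incl_mu.
under [RHS]eq_bigr do rewrite !JS0_incl_mu.
exact: (moyal_assoc jdtau_lin jdz_lin jdtauM jdzM jcomm).
Qed.

Lemma muJS0_deformation : formal_deformation muJS0.
Proof.
split; first exact: muJS0_bilinear.
  by move=> f g; apply: JS0_incl_inj; rewrite JS0_incl_mu fact0 invr1 scale1r; apply: val_inj.
exact: (star_assoc muJS0_bilinear muJS0_assoc).
Qed.

End Transvectants.

(** That [tv] takes its values in [JS R] expresses the stability of JS. As [JS0_incl] is the
    inclusion, the second clause determines [mu] and contains the claim that transvectants of
    elements of JS0 lie in JS0. *)
Theorem theorem47 (R : realType) :
  exists (tv : nat -> JS R -> JS R -> JS R)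
         (mu : nat -> JS0 R -> JS0 R -> JS0 R),
    [/\ forall n (f g : JS R), val (tv n f g) = transvectant n (val f) (val g),
        forall n (f g : JS0 R),
          JS0_incl (mu n f g) =
            (n`!%:R : R[i])^-1 *: tv n (JS0_incl f) (JS0_incl g)
      & formal_deformation mu].
Proof.
exists tvJS, muJS0.
by split; [exact: val_tvJS|exact: JS0_incl_mu|exact: muJS0_deformation].
Qed.
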